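(* For each $n\in\mathbb{N}$ and every countable model $M\models\mathrm{B}\Sigma_{n+2}$, there is a proper end extension $K$ of $M$ such that $M\preccurlyeq_{\Sigma_{n+2}}K$ and $K\models\mathrm{B}\Sigma_{n+1}$.
   Context: All theories contain $\mathrm{PA}^-$. $\mathrm{B}\Sigma_k$ is the $\Sigma_k$-collection scheme $\forall x<a\,\exists y\,\phi\to\exists b\,\forall x<a\,\exists y<b\,\phi$ (for $\Sigma_k$ formulas $\phi$ with parameters) together with $\mathrm{I}\Delta_0$. $M\preccurlyeq_{\Sigma_k}K$ means every $\Sigma_k$ formula with parameters from $M$ has the same truth value in $M$ and $K$; an end extension means every element of $K\setminus M$ exceeds every element of $M$; proper means $K\neq M$. *)

(* Defs.v *)
From Stdlib Require Import Arith.

Record arith_str : Type := ArithStr {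
  carrier :> Type;
  zero : carrier;
  one : carrier;
  add : carrier -> carrier -> carrier;
  mul : carrier -> carrier -> carrier;
  lt : carrier -> carrier -> Prop
}.

Inductive term : Type :=
| Tvar : nat -> term
| Tzero : term
| Tone : term
| Tadd : term -> term -> term
| Tmul : term -> term -> term.

(* Variables are de Bruijn indices: a quantifier binds index 0.
   In the bounded quantifiers [Fallb t phi] (= forall x < t, phi) and
   [Fexb t phi] (= exists x < t, phi) the bound [t] is interpreted
   outside the scope of the new variable. *)
Inductive formula : Type :=
| Feq : term -> term -> formula
| Flt : term -> term -> formula
| Fnot : formula -> formula
| Fand : formula -> formula -> formula
| For : formula -> formula -> formula
| Fimp : formula -> formula -> formula
| Fall : formula -> formula
| Fex : formula -> formula
| Fallb : term -> formula -> formula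
| Fexb : term -> formula -> formula.

Definition scons {A : Type} (a : A) (e : nat -> A) : nat -> A :=
  fun i => match i with 0 => a | S j => e j end.

Fixpoint eval (M : arith_str) (e : nat -> M) (t : term) : M :=
  match t with
  | Tvar i => e i
  | Tzero => zero M
  | Tone => one M
  | Tadd s u => add M (eval M e s) (eval M e u)
  | Tmul s u => mul M (eval M e s) (eval M e u)
  end.

Fixpoint sat (M : arith_str) (e : nat -> M) (phi : formula) : Prop :=
  match phi with
  | Feq s u => eval M e s = eval M e u
  | Flt s u => lt M (eval M e s) (eval M e u)
  | Fnot p => ~ sat M e p
  | Fand p q => sat M e p /\ sat M e q
  | For p q => sat M e p \/ sat M e q
  | Fimp p q => sat M e p -> sat M e q
  | Fall p => forall a : M, sat M (scons a e) p
  | Fex p => exists a : M, sat M (scons a e) p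
  | Fallb t p => forall a : M, lt M a (eval M e t) -> sat M (scons a e) p
  | Fexb t p => exists a : M, lt M a (eval M e t) /\ sat M (scons a e) p
  end.

Inductive is_delta0 : formula -> Prop :=
| D0_eq : forall s u, is_delta0 (Feq s u)
| D0_lt : forall s u, is_delta0 (Flt s u)
| D0_not : forall p, is_delta0 p -> is_delta0 (Fnot p)
| D0_and : forall p q, is_delta0 p -> is_delta0 q -> is_delta0 (Fand p q)
| D0_or : forall p q, is_delta0 p -> is_delta0 q -> is_delta0 (For p q)
| D0_imp : forall p q, is_delta0 p -> is_delta0 q -> is_delta0 (Fimp p q)
| D0_allb : forall t p, is_delta0 p -> is_delta0 (Fallb t p)
| D0_exb : forall t p, is_delta0 p -> is_delta0 (Fexb t p).

Inductive is_sigma : nat -> formula -> Prop :=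
| Sig0 : forall p, is_delta0 p -> is_sigma 0 p
| SigPi : forall k p, is_pi k p -> is_sigma (S k) p
| SigEx : forall k p, is_sigma (S k) p -> is_sigma (S k) (Fex p)
with is_pi : nat -> formula -> Prop :=
| Pi0 : forall p, is_delta0 p -> is_pi 0 p
| PiSig : forall k p, is_sigma k p -> is_pi (S k) p
| PiAll : forall k p, is_pi (S k) p -> is_pi (S k) (Fall p).

Definition le_M (M : arith_str) (x y : M) : Prop := lt M x y \/ x = y.

(* PA^- : the theory of nonnegative parts of discretely ordered rings. *)
Definition PAminus (M : arith_str) : Prop :=
  (forall x y z : M, add M (add M x y) z = add M x (add M y z)) /\
  (forall x y : M, add M x y = add M y x) /\
  (forall x y z : M, mul M (mul M x y) z = mul M x (mul M y z)) /\
  (forall x y : M, mul M x y = mul M y x) /\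
  (forall x y z : M, mul M x (add M y z) = add M (mul M x y) (mul M x z)) /\
  (forall x : M, add M x (zero M) = x /\ mul M x (zero M) = zero M) /\
  (forall x : M, mul M x (one M) = x) /\
  (forall x y z : M, lt M x y -> lt M y z -> lt M x z) /\
  (forall x : M, ~ lt M x x) /\
  (forall x y : M, lt M x y \/ x = y \/ lt M y x) /\
  (forall x y z : M, lt M x y -> lt M (add M x z) (add M y z)) /\
  (forall x y z : M, lt M (zero M) z -> lt M x y -> lt M (mul M x z) (mul M y z)) /\
  (forall x y : M, lt M x y -> exists z, add M x z = y) /\
  lt M (zero M) (one M) /\
  (forall x : M, lt M (zero M) x -> le_M M (one M) x) /\
  (forall x : M, le_M M (zero M) x).

Definition induction_instance (M : arith_str) (phi : formula) : Prop :=
  forall e : nat -> M,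
    sat M (scons (zero M) e) phi ->
    (forall a : M, sat M (scons a e) phi -> sat M (scons (add M a (one M)) e) phi) ->
    forall a : M, sat M (scons a e) phi.

Definition IDelta0 (M : arith_str) : Prop :=
  PAminus M /\ forall phi, is_delta0 phi -> induction_instance M phi.

Definition collection_instance (M : arith_str) (phi : formula) : Prop :=
  forall (e : nat -> M) (a : M),
    (forall x : M, lt M x a -> exists y : M, sat M (scons y (scons x e)) phi) ->
    exists b : M, forall x : M, lt M x a ->
      exists y : M, lt M y b /\ sat M (scons y (scons x e)) phi.

Definition BSigma (k : nat) (M : arith_str) : Prop :=
  IDelta0 M /\ forall phi, is_sigma k phi -> collection_instance M phi.

Definition embedding (M K : arith_str) (f : M -> K) : Prop :=
  (forall x y, f x = f y -> x = y) /\
  f (zero M) = zero K /\ f (one M) = one K /\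
  (forall x y, f (add M x y) = add K (f x) (f y)) /\
  (forall x y, f (mul M x y) = mul K (f x) (f y)) /\
  (forall x y, lt M x y <-> lt K (f x) (f y)).

Definition end_extension (M K : arith_str) (f : M -> K) : Prop :=
  embedding M K f /\
  forall k : K, (forall m : M, f m <> k) -> forall m : M, lt K (f m) k.

Definition proper_ext (M K : arith_str) (f : M -> K) : Prop :=
  exists k : K, forall m : M, f m <> k.

Definition sigma_elementary (k : nat) (M K : arith_str) (f : M -> K) : Prop :=
  forall phi, is_sigma k phi ->
    forall e : nat -> M, sat M e phi <-> sat K (fun i => f (e i)) phi.

Definition countable (M : arith_str) : Prop :=
  exists g : M -> nat, forall x y, g x = g y -> x = y.

(* Main.v *)
(* Write "Sigma" for the class of Sigma_{n+1} relations of M.  Since M satisfies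
   B Sigma_{n+2}, it satisfies B Sigma_2 relative to Sigma, and there is a
   universal Sigma relation.

   Low basis theorem inside M: a consistent Pi_1 class of sets has a member A
   whose jump is Delta_2.  Whether the i-th Sigma_1(A) fact is kept false is
   decided by priority order, and collection makes every initial segment of the
   decisions a coded set.  As Sigma_1(A) relations are then Delta_2, the class
   Sigma(A) inherits B Sigma_2, so this step can be iterated.  The Pi_1 class is
   chosen so that A uniformizes all Pi relations with bounded values.  The union
   of an omega-chain of such steps is a countable class, closed under bounded Pi
   uniformization, for which B Sigma_2 still holds.

   K is the ultrapower of M by the functions in that class, along a decreasing
   sequence of unbounded sets of the class which decides every set of the class.
   B Sigma_2 keeps a set unbounded while a function with bounded values is made
   constant on it, so K is an end extension.  Sigma relations have choice
   functions, so Los's theorem holds for Sigma_{n+1} and Pi_{n+1} formulas and M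
   is a Sigma_{n+2}-elementary submodel.  For B Sigma_{n+1} in K with bound
   represented by a function F, consider the set of indices i at which every
   x < F(i) has a witness.  If it is generic, collection in M gives a function
   bounding the witnesses; otherwise its complement is, and Pi uniformization gives
   an element of K below the bound without a witness. *)

Require Import Defs.
From Stdlib Require Import Arith Lia Ring Cantor Classical ClassicalEpsilon FunctionalExtensionality PropExtensionality.

(** * Arithmetic in PA^- *)

(* The obstacle is the failing case of collection: the missing element is a solution of a Pi
   condition, and a Sigma search cannot find it. Selecting solutions of arbitrary Pi conditions
   would make every Sigma_2 relation Pi_1 in the enlarged class, against lowness. A bound on the
   values changes this: the admissible selections are then the paths of a tree with boundedly many
   choices at each point, and a low path exists. The selector lives in a larger class, whose own Pi
   conditions must again be uniformized; hence the omega iterations. Definability is handled by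
   classes of predicates with closure properties, so that every lemma applies unchanged to
   Sigma_{n+1} and to its relativization to a new set. The number [n] matters only where classes are
   compared with formulas. Each class of the chain keeps a universal relation with indices in [M],
   so the limit class is countable, and a descending sequence of length omega can meet all
   requirements. *)
Existing Class PAminus.

Declare Scope m_scope.
Delimit Scope m_scope with m.
Notation "x + y" := (add _ x y) : m_scope.
Notation "x * y" := (mul _ x y) : m_scope.
Notation "x < y" := (lt _ x y) : m_scope.
Notation "x <= y" := (le_M _ x y) : m_scope.
Local Open Scope m_scope.

Section Arithmetic.
Context {M : arith_str} {HM : PAminus M}.
Local Notation "0" := (zero M) : m_scope.
Local Notation "1" := (one M) : m_scope.

Lemma M_semiring :
  semi_ring_theory (zero M) (one M) (add M) (mul M) (@eq M).
Proof.
  destruct HM as (Aa & Ac & Ma & Mc & D & Z & O & _).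
  constructor; intros.
  - now rewrite Ac, (proj1 (Z n)).
  - apply Ac.
  - now rewrite Aa.
  - now rewrite Mc, O.
  - now rewrite Mc, (proj2 (Z n)).
  - apply Mc.
  - now rewrite Ma.
  - now rewrite Mc, D, (Mc p n), (Mc p m).
Qed.

Add Ring M_ring : M_semiring.

Lemma m_lt_trans (x y z : M) : x < y -> y < z -> x < z.
Proof. apply HM. Qed.

Lemma m_lt_irrefl (x : M) : ~ x < x.
Proof. apply HM. Qed.

Lemma m_lt_total (x y : M) : x < y \/ x = y \/ y < x.
Proof. apply HM. Qed.

Lemma m_add_lt (x y z : M) : x < y -> x + z < y + z.
Proof. apply HM. Qed.

Lemma m_add_cancel (x y z : M) : x + z = y + z -> x = y.
Proof.
  intro H. destruct (m_lt_total x y) as [L|[E|L]]; auto;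
  apply (m_add_lt _ _ z) in L; rewrite H in L; now apply m_lt_irrefl in L.
Qed.

Lemma m_zero_le (x : M) : 0 <= x.
Proof. apply HM. Qed.

Lemma m_zero_one : zero M < 1.
Proof. apply HM. Qed.

(** Discreteness makes the order existential over addition; later inequalities are then proved by
    exhibiting a difference and calling [ring]. *)
Lemma m_lt_iff (x y : M) : x < y <-> exists z, y = x + z + 1.
Proof.
  split.
  - intro L. destruct HM as (_&_&_&_&_&_&_&_&_&_&_&_&S&_&D&_).
    destruct (S _ _ L) as [z <-].
    assert (Hz : 0 < z).
    { destruct (m_zero_le z) as [?|<-]; auto.
      exfalso. apply (m_lt_irrefl x). replace (x + 0) with x in L by ring. auto. }
    destruct (D _ Hz) as [L1|<-].
    + destruct (S _ _ L1) as [w <-]. exists w. ring.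
    + exists 0. ring.
  - intros [z ->].
    assert (L0 : 0 < z + 1).
    { destruct (m_zero_le z) as [L|<-].
      - apply m_lt_trans with (1:=L). replace z with (0 + z) at 1 by ring.
        replace (z+1) with (1+z) by ring. apply m_add_lt, m_zero_one.
      - replace (0+1) with 1 by ring. apply m_zero_one. }
    apply (m_add_lt _ _ x) in L0.
    replace x with (0 + x) at 1 by ring. replace (x+z+1) with (z+1+x) by ring. auto.
Qed.

Lemma m_le_iff (x y : M) : x <= y <-> exists z, y = x + z.
Proof.
  split.
  - intros [L| ->].
    + apply m_lt_iff in L. destruct L as [z ->]. exists (z+1). ring.
    + exists 0. ring.
  - intros [z ->]. destruct (m_zero_le z) as [L|<-].
    + left. apply (m_add_lt _ _ x) in L. replace x with (0+x) at 1 by ring.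
      replace (x+z) with (z+x) by ring. auto.
    + right. ring.
Qed.

Lemma m_le_refl (x : M) : x <= x.
Proof. now right. Qed.

Lemma m_le_lt_trans (x y z : M) : x <= y -> y < z -> x < z.
Proof. intros [L| ->]; auto. now apply m_lt_trans. Qed.

Lemma m_lt_le_trans (x y z : M) : x < y -> y <= z -> x < z.
Proof. intros L [L'| <-]; auto. now apply m_lt_trans with y. Qed.

Lemma m_le_trans (x y z : M) : x <= y -> y <= z -> x <= z.
Proof. intros L [L'| <-]; auto. left. now apply m_le_lt_trans with y. Qed.

Lemma m_not_lt (x y : M) : ~ x < y <-> y <= x.
Proof.
  split.
  - intro H. destruct (m_lt_total x y) as [?|[<-|?]]; [tauto|now right|now left].
  - intros H L. apply (m_lt_irrefl x). now apply m_lt_le_trans with y.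
Qed.

Lemma m_not_le (x y : M) : ~ x <= y <-> y < x.
Proof.
  rewrite <- m_not_lt. split; [apply NNPP|tauto].
Qed.

Lemma m_le_antisym (x y : M) : x <= y -> y <= x -> x = y.
Proof. intros [L|E] H; auto. apply m_not_lt in H. tauto. Qed.

Lemma m_le_total (x y : M) : x <= y \/ y <= x.
Proof. destruct (m_lt_total x y) as [?|[<-|?]]; [left; now left|left; now right|right;now left]. Qed.

Lemma m_lt_succ (x : M) : x < x + 1.
Proof. apply m_lt_iff. exists 0. ring. Qed.

Lemma m_lt_succ_le (x y : M) : x < y + 1 <-> x <= y.
Proof.
  rewrite m_lt_iff, m_le_iff. split; intros [z H].
  - exists z. apply m_add_cancel with 1. rewrite H. ring.
  - exists z. rewrite H. ring.
Qed.

Lemma m_succ_le_lt (x y : M) : x + 1 <= y <-> x < y.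
Proof.
  rewrite m_lt_iff, m_le_iff. split; intros [z H]; exists z; rewrite H; ring.
Qed.

Lemma m_not_lt_zero (x : M) : ~ x < 0.
Proof. apply m_not_lt, m_zero_le. Qed.

Lemma m_zero_or_succ (x : M) : x = 0 \/ exists y, x = y + 1.
Proof.
  destruct (m_zero_le x) as [L|<-]; [right|now left].
  apply m_lt_iff in L. destruct L as [z ->]. exists z. ring.
Qed.

Lemma m_lt_succ_cases (x y : M) : x < y + 1 <-> x < y \/ x = y.
Proof. apply m_lt_succ_le. Qed.

Lemma m_le_add_r (x y : M) : x <= x + y.
Proof. apply m_le_iff. now exists y. Qed.

Lemma m_le_add_l (x y : M) : x <= y + x.
Proof. apply m_le_iff. exists y. ring. Qed.

Lemma m_mul_le (x y z t : M) : x <= y -> z <= t -> x * z <= y * t.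
Proof.
  rewrite !m_le_iff. intros [w ->] [v ->]. exists (x*v+w*z+w*v). ring.
Qed.

Lemma m_add_le2 (x y z t : M) : x <= y -> z <= t -> x + z <= y + t.
Proof. rewrite !m_le_iff. intros [w ->] [v ->]. exists (w+v). ring. Qed.

Lemma m_pos_succ (x : M) : 0 < x <-> exists y, x = y + 1.
Proof.
  rewrite m_lt_iff. split; intros [z ->]; exists z; ring.
Qed.

Lemma m_mul_pos (x y : M) : 0 < x -> 0 < y -> 0 < x * y.
Proof.
  rewrite !m_pos_succ. intros [a ->] [b ->]. exists (a*b+a+b). ring.
Qed.

Lemma m_mul_pos_inv (x y : M) : 0 < x * y -> 0 < x /\ 0 < y.
Proof.
  intro H. split.
  - destruct (m_zero_le x) as [?|<-]; auto. exfalso. apply (m_lt_irrefl 0).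
    now replace (0*y) with 0 in H by ring.
  - destruct (m_zero_le y) as [?|<-]; auto. exfalso. apply (m_lt_irrefl 0).
    now replace (x*0) with 0 in H by ring.
Qed.

Lemma m_le_mul_r (x y : M) : 0 < y -> x <= x * y.
Proof.
  rewrite m_pos_succ, m_le_iff. intros [a ->]. exists (x*a). ring.
Qed.

(** * Divisibility and Goedel's coprime moduli *)

Definition divides (d x : M) : Prop := exists q, x = d * q.

Lemma divides_mul_r (d x y : M) : divides d x -> divides d (x * y).
Proof. intros [q ->]. exists (q*y). ring. Qed.

Lemma divides_mul_l (d x y : M) : divides d x -> divides d (y * x).
Proof. intros [q ->]. exists (q*y). ring. Qed.

Lemma divides_add (d x y : M) : divides d x -> divides d y -> divides d (x + y).
Proof. intros [q ->] [r ->]. exists (q+r). ring. Qed.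

Lemma divides_sub (d x y : M) : divides d (x + y) -> divides d y -> divides d x.
Proof.
  intros [q H] [r ->]. destruct (m_le_total r q) as [L|L]; apply m_le_iff in L; destruct L as [w ->].
  - exists w. apply m_add_cancel with (d*r). rewrite H. ring.
  (* Here [q <= r] gives [x + d * r = d * q <= d * r], so [x] vanishes. *)
  - exists 0. assert (x <= 0).
    { apply m_le_iff. exists (d*w). apply m_add_cancel with (d*q).
      replace (x + d*w + d*q) with (x + d*(q+w)) by ring. rewrite H. ring. }
    replace (d*0) with 0 by ring. apply m_le_antisym; auto. apply m_zero_le.
Qed.

Definition coprime_mod (b i : M) : M := 1 + (i + 1) * b.

(* With j - i = d and b = d q, the explicit Bezout relation
   m_i (1 - (i+1)(j+1) q) + m_j (i+1)^2 q = 1. *)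
Lemma coprime_mod_gauss_lt (b i j a : M) :
  i < j -> (forall d, 0 < d -> d <= j -> divides d b) ->
  (divides (coprime_mod b j) (a * coprime_mod b i) -> divides (coprime_mod b j) a) /\
  (divides (coprime_mod b i) (a * coprime_mod b j) -> divides (coprime_mod b i) a).
Proof.
  intros L Hb. apply m_lt_iff in L. destruct L as [d ->].
  destruct (Hb (d+1)) as [q Hq].
  { apply m_pos_succ. now exists d. }
  { apply m_le_iff. exists i. ring. }
  subst b. unfold coprime_mod. split; intro H.
  - apply divides_sub with (a * (1 + (i+1)*((d+1)*q)) * ((i+1)*(i+d+1+1)*q)).
    2: now apply divides_mul_r.
    replace (a + a * (1 + (i+1)*((d+1)*q)) * ((i+1)*(i+d+1+1)*q)) with
     (a * (1 + (i+1)*((d+1)*q)) + (1 + (i+d+1+1)*((d+1)*q)) * (a * (i+1)*(i+1)*q)) by ring.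
    apply divides_add; auto. apply divides_mul_r. exists 1. ring.
  - apply divides_sub with ((1 + (i+1)*((d+1)*q)) * (a * ((i+1)*(i+d+1+1)*q))).
    2: apply divides_mul_r; exists 1; ring.
    replace (a + (1 + (i+1)*((d+1)*q)) * (a * ((i+1)*(i+d+1+1)*q))) with
     ((1 + (i+1)*((d+1)*q)) * a + a * (1 + (i+d+1+1)*((d+1)*q)) * ((i+1)*(i+1)*q)) by ring.
    apply divides_add. apply divides_mul_r; exists 1; ring. now apply divides_mul_r.
Qed.

(** Euclid's lemma for two moduli without primes or gcds: distinct indices below [u] differ by at
    most [u], and [b] is divisible by that difference. *)
Lemma coprime_mod_gauss (b u i j a : M) :
  (forall d, 0 < d -> d <= u -> divides d b) -> i < u -> j < u -> i <> j ->
  divides (coprime_mod b j) (a * coprime_mod b i) -> divides (coprime_mod b j) a.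
Proof.
  intros Hb Li Lj N H. destruct (m_lt_total i j) as [L|[E|L]]; try tauto.
  - apply (coprime_mod_gauss_lt b i j a L); auto.
    intros d H0 H1. apply Hb; auto. left. now apply m_le_lt_trans with j.
  - apply (coprime_mod_gauss_lt b j i a L); auto.
    intros d H0 H1. apply Hb; auto. left. now apply m_le_lt_trans with i.
Qed.


Lemma coprime_mod_not_one (b i : M) : 0 < b -> ~ divides (coprime_mod b i) 1.
Proof.
  intros Hb [q H]. unfold coprime_mod in H.
  apply m_pos_succ in Hb. destruct Hb as [c ->].
  apply (m_lt_irrefl 1). destruct (m_zero_or_succ q) as [-> | [r ->]].
  - rewrite H at 1. replace ((1+(i+1)*(c+1))*0) with 0 by ring. apply m_zero_one.
  - rewrite H at 2. apply m_lt_iff.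
    exists ((i*c+i+c)*(r+1) + r + r). ring.
Qed.

(** The square of [x + y] is the largest square not exceeding the value, so the sum, and then [x],
    can be recovered. No halving occurs; the map is injective but not onto. *)
Definition pair (x y : M) : M := (x + y) * (x + y) + x.

Lemma pair_sum_le (x y x' y' : M) : pair x y = pair x' y' -> x + y <= x' + y'.
Proof.
  intro H. apply NNPP. intro L. rewrite m_not_le in L.
  apply m_lt_iff in L. destruct L as [z Hz]. unfold pair in H. rewrite Hz in H.
  apply (m_lt_irrefl (pair x' y')). unfold pair at 2. rewrite <- H.
  unfold pair. apply m_lt_iff. exists ((1+1)*z*(x'+y') + x' + y' + y' + z*z + (1+1)*z + x). ring.
Qed.

Lemma pair_inj (x y x' y' : M) : pair x y = pair x' y' -> x = x' /\ y = y'.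
Proof.
  intro H. assert (E : x + y = x' + y').
  { apply m_le_antisym; apply pair_sum_le; auto. }
  unfold pair in H. rewrite E in H.
  assert (exists_class : x = x').
  { apply m_add_cancel with ((x'+y')*(x'+y')).
    replace (x + (x'+y')*(x'+y')) with ((x'+y')*(x'+y') + x) by ring. rewrite H. ring. }
  split; auto. apply m_add_cancel with x'. subst x'.
  replace (y+x) with (x+y) by ring. rewrite E. ring.
Qed.

Lemma m_le_square (x : M) : x <= x * x.
Proof.
  destruct (m_zero_or_succ x) as [-> | [y ->]].
  - right. ring.
  - apply m_le_iff. exists (y*(y+1)). ring.
Qed.

Lemma pair_le_l (x y : M) : x <= pair x y.
Proof. apply m_le_add_l. Qed.

Lemma pair_le_r (x y : M) : y <= pair x y.
Proof.
  unfold pair. apply m_le_trans with (x+y). apply m_le_add_l.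
  apply m_le_trans with ((x+y)*(x+y)). apply m_le_square. apply m_le_add_r.
Qed.

Lemma pair_mono (x y x' y' : M) : x <= x' -> y <= y' -> pair x y <= pair x' y'.
Proof.
  intros. unfold pair. apply m_add_le2; auto. apply m_mul_le; now apply m_add_le2.
Qed.

End Arithmetic.

(** * Classes of definable relations *)

Section Classes.
Context {M : arith_str} {HM : PAminus M}.
Local Notation "0" := (zero M) : m_scope.
Local Notation "1" := (one M) : m_scope.
Add Ring M_ring2 : M_semiring.

Local Notation env := (nat -> M).
Local Notation class := ((env -> Prop) -> Prop).

(** Classes contain predicates and not formulas; extensionality lets membership pass between
    equivalent descriptions of a relation. *)
Lemma rel_ext (P Q : env -> Prop) : (forall e, P e <-> Q e) -> P = Q.
Proof. intro H. extensionality e. apply propositional_extensionality, H. Qed.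

Lemma class_ext (C : class) (P Q : env -> Prop) : (forall e, Q e <-> P e) -> C P -> C Q.
Proof. intros H HP. now rewrite (rel_ext _ _ H). Qed.

Inductive term_fun : (env -> M) -> Prop :=
| term_var i : term_fun (fun e => e i)
| term_const c : term_fun (fun _ => c)
| term_add s t : term_fun s -> term_fun t -> term_fun (fun e => s e + t e)
| term_mul s t : term_fun s -> term_fun t -> term_fun (fun e => s e * t e).

Lemma term_pair s t : term_fun s -> term_fun t -> term_fun (fun e => pair (s e) (t e)).
Proof. intros. unfold pair. repeat (apply term_add || apply term_mul); auto. Qed.

Lemma term_coprime_mod s t : term_fun s -> term_fun t -> term_fun (fun e => coprime_mod (s e) (t e)).
Proof. intros. unfold coprime_mod. repeat (apply term_add || apply term_mul || apply term_const); auto. Qed.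

Lemma term_sub t (tau : env -> env) :
  term_fun t -> (forall i, term_fun (fun e => tau e i)) -> term_fun (fun e => t (tau e)).
Proof. intros H Ht. induction H; auto using term_const, term_add, term_mul. Qed.

Lemma term_scons t (tau : env -> env) :
  term_fun t -> (forall i, term_fun (fun e => tau e i)) -> forall i, term_fun (fun e => scons (t e) (tau e) i).
Proof. intros Ht H [|i]; simpl; auto. Qed.

(* A class is a set of predicates on environments; definability is expressed by
   closure properties instead of formulas, and parameters are always allowed. *)
Class closed (C : class) : Prop := {
  closed_eq s t : term_fun s -> term_fun t -> C (fun e => s e = t e);
  closed_lt s t : term_fun s -> term_fun t -> C (fun e => s e < t e);
  closed_and P Q : C P -> C Q -> C (fun e => P e /\ Q e);
  closed_or P Q : C P -> C Q -> C (fun e => P e \/ Q e);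
  closed_exb0 t P : term_fun t -> C P -> C (fun e => exists x, x < t e /\ P (scons x e));
  closed_allb0 t P : term_fun t -> C P -> C (fun e => forall x, x < t e -> P (scons x e));
  closed_sub P (tau : env -> env) :
    C P -> (forall i, term_fun (fun e => tau e i)) -> C (fun e => P (tau e)) }.

Class has_ex (C : class) : Prop :=
  has_ex0 : forall P, C P -> C (fun e => exists x, P (scons x e)).

Class has_not (C : class) : Prop :=
  closed_not : forall P, C P -> C (fun e => ~ P e).

(** For [C] the class Sigma_k, [dual C] is Pi_k, [delta C] is Delta_k, and [exists_class (dual C)]
    is Sigma_{k+1}. *)
Definition dual (C : class) : class := fun P => C (fun e => ~ P e).
Definition delta (C : class) : class := fun P => C P /\ dual C P.
Definition exists_class (C : class) : class :=
  fun P => exists Q, C Q /\ forall e, P e <-> exists y, Q (scons y e).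

Definition collects (C : class) : Prop := forall P, C P -> forall e a,
  (forall x, x < a -> exists y, P (scons y (scons x e))) ->
  exists b, forall x, x < a -> exists y, y < b /\ P (scons y (scons x e)).

Definition rel1 (C : class) (R : M -> Prop) : Prop := C (fun e => R (e 0%nat)).
Definition rel2 (C : class) (R : M -> M -> Prop) : Prop := C (fun e => R (e 0%nat) (e 1%nat)).
Definition rel3 (C : class) (R : M -> M -> M -> Prop) : Prop :=
  C (fun e => R (e 0%nat) (e 1%nat) (e 2%nat)).
Definition rel4 (C : class) (R : M -> M -> M -> M -> Prop) : Prop :=
  C (fun e => R (e 0%nat) (e 1%nat) (e 2%nat) (e 3%nat)).

Section Closure.
Context (C : class) {HC : closed C}.

Lemma closed_exb t (Q : M -> env -> Prop) :
  term_fun t -> C (fun e => Q (e 0%nat) (fun i => e (S i))) -> C (fun e => exists x, x < t e /\ Q x e).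
Proof. intros Ht H. exact (closed_exb0 t _ Ht H). Qed.

Lemma closed_allb t (Q : M -> env -> Prop) :
  term_fun t -> C (fun e => Q (e 0%nat) (fun i => e (S i))) -> C (fun e => forall x, x < t e -> Q x e).
Proof. intros Ht H. exact (closed_allb0 t _ Ht H). Qed.

Lemma closed_ex {HE : has_ex C} (Q : M -> env -> Prop) :
  C (fun e => Q (e 0%nat) (fun i => e (S i))) -> C (fun e => exists x, Q x e).
Proof. intros H. exact (has_ex0 _ H). Qed.

Lemma closed_le s t : term_fun s -> term_fun t -> C (fun e => s e <= t e).
Proof. intros. apply closed_or; [now apply closed_lt | now apply closed_eq]. Qed.

Lemma closed_nlt s t : term_fun s -> term_fun t -> C (fun e => ~ s e < t e).
Proof.
  intros. apply class_ext with (fun e => t e <= s e); [|now apply closed_le].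
  intro. apply m_not_lt.
Qed.

Lemma closed_neq s t : term_fun s -> term_fun t -> C (fun e => s e <> t e).
Proof.
  intros. apply class_ext with (fun e => s e < t e \/ t e < s e).
  - intro e. split.
    + intro N. destruct (m_lt_total (s e) (t e)) as [?|[?|?]]; tauto.
    + intros [L|L] E; rewrite E in L; now apply m_lt_irrefl in L.
  - now apply closed_or; apply closed_lt.
Qed.

Lemma closed_exle t (Q : M -> env -> Prop) :
  term_fun t -> C (fun e => Q (e 0%nat) (fun i => e (S i))) -> C (fun e => exists x, x <= t e /\ Q x e).
Proof.
  intros Ht H. apply class_ext with (fun e => exists x, x < t e + 1 /\ Q x e).
  - intro e. split; intros [x [? ?]]; exists x; split; auto; now apply m_lt_succ_le.
  - apply closed_exb; auto. apply term_add; auto using term_const.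
Qed.

Lemma closed_allle t (Q : M -> env -> Prop) :
  term_fun t -> C (fun e => Q (e 0%nat) (fun i => e (S i))) -> C (fun e => forall x, x <= t e -> Q x e).
Proof.
  intros Ht H. apply class_ext with (fun e => forall x, x < t e + 1 -> Q x e).
  - intro e. split; intros K x L; apply K; now apply m_lt_succ_le.
  - apply closed_allb; auto. apply term_add; auto using term_const.
Qed.

Lemma closed_true (p : Prop) : C (fun _ => p).
Proof.
  destruct (classic p).
  - apply class_ext with (fun e : env => 0 = 0); [tauto|apply closed_eq; apply term_const].
  - apply class_ext with (fun e : env => 0 = 1).
    + intro. split; [tauto|]. intro E. exfalso. apply (m_lt_irrefl 0). rewrite E at 2. apply m_zero_one.
    + apply closed_eq; apply term_const.
Qed.

Lemma closed_sub1 R a : rel1 C R -> term_fun a -> C (fun e => R (a e)).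
Proof.
  intros H Ha. apply (closed_sub _ (fun e => scons (a e) e) H).
  apply term_scons; auto using term_var.
Qed.

Lemma closed_sub2 R a b : rel2 C R -> term_fun a -> term_fun b -> C (fun e => R (a e) (b e)).
Proof.
  intros H Ha Hb. apply (closed_sub _ (fun e => scons (a e) (scons (b e) e)) H).
  repeat (apply term_scons; auto using term_var).
Qed.

Lemma closed_sub3 R a b c : rel3 C R -> term_fun a -> term_fun b -> term_fun c -> C (fun e => R (a e) (b e) (c e)).
Proof.
  intros H Ha Hb Hc. apply (closed_sub _ (fun e => scons (a e) (scons (b e) (scons (c e) e))) H).
  repeat (apply term_scons; auto using term_var).
Qed.

Lemma closed_sub4 R a b c d : rel4 C R -> term_fun a -> term_fun b -> term_fun c -> term_fun d ->
  C (fun e => R (a e) (b e) (c e) (d e)).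
Proof.
  intros H Ha Hb Hc Hd.
  apply (closed_sub _ (fun e => scons (a e) (scons (b e) (scons (c e) (scons (d e) e)))) H).
  repeat (apply term_scons; auto using term_var).
Qed.

Lemma closed_imp P Q : delta C P -> C Q -> C (fun e => P e -> Q e).
Proof.
  intros [_ H] H'. apply class_ext with (fun e => ~ P e \/ Q e); [intro; tauto | now apply closed_or].
Qed.

Lemma closed_iff P Q : delta C P -> delta C Q -> C (fun e => P e <-> Q e).
Proof.
  intros. apply closed_and; apply closed_imp; auto; firstorder.
Qed.
End Closure.

Lemma delta_l (C : class) P : delta C P -> C P.
Proof. now intros []. Qed.

Lemma delta_not_l (C : class) P : delta C P -> C (fun e => ~ P e).
Proof. now intros []. Qed.

Lemma delta_rel1 (C : class) R : rel1 (delta C) R -> rel1 C R.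
Proof. now intros []. Qed.
Lemma delta_rel2 (C : class) R : rel2 (delta C) R -> rel2 C R.
Proof. now intros []. Qed.
Lemma delta_rel3 (C : class) R : rel3 (delta C) R -> rel3 C R.
Proof. now intros []. Qed.
Lemma delta_rel4 (C : class) R : rel4 (delta C) R -> rel4 C R.
Proof. now intros []. Qed.

Global Instance closed_dual C : closed C -> closed (dual C).
Proof.
  intro HC. unfold dual. split; intros.
  - now apply closed_neq.
  - now apply closed_nlt.
  - apply class_ext with (fun e => ~ P e \/ ~ Q e); [intro; tauto|now apply closed_or].
  - apply class_ext with (fun e => ~ P e /\ ~ Q e); [intro; tauto|now apply closed_and].
  - apply class_ext with (fun e => forall x, x < t e -> ~ P (scons x e)).
    + intro e. firstorder.
    + now apply closed_allb0 with (P := fun e => ~ P e).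
  - apply class_ext with (fun e => exists x, x < t e /\ ~ P (scons x e)).
    + intro e. split; [|firstorder]. intro N. apply not_all_ex_not in N. destruct N as [x N].
      exists x. tauto.
    + now apply closed_exb0 with (P := fun e => ~ P e).
  - now apply (closed_sub (fun e => ~ P e)).
Qed.

Global Instance closed_delta C : closed C -> closed (delta C).
Proof.
  intro HC. pose proof (closed_dual C HC) as H'. split; intros.
  - split; now apply closed_eq.
  - split; now apply closed_lt.
  - destruct H, H0. split; now apply closed_and.
  - destruct H, H0. split; now apply closed_or.
  - destruct H0. split; now apply closed_exb0.
  - destruct H0. split; now apply closed_allb0.
  - destruct H. split; now apply closed_sub.
Qed.

Global Instance has_not_delta C : has_not (delta C).
Proof.
  intros P [H H']. split; auto. red. apply class_ext with P; auto. intro; tauto.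
Qed.

(** [closed_imp] and [closed_iff] ask for premises in the [delta] of the current class; this and its
    variants meet that demand when the current class is itself a [delta]. *)
Lemma delta_delta_rel1 (C : class) P : rel1 (delta C) P -> rel1 (delta (delta C)) P.
Proof. intro H. split; auto. now apply closed_not. Qed.

Lemma delta_delta_rel2 (C : class) P : rel2 (delta C) P -> rel2 (delta (delta C)) P.
Proof. intro H. split; auto. now apply closed_not. Qed.

Lemma delta_delta_rel3 (C : class) P : rel3 (delta C) P -> rel3 (delta (delta C)) P.
Proof. intro H. split; auto. now apply closed_not. Qed.

Lemma delta_delta_rel4 (C : class) P : rel4 (delta C) P -> rel4 (delta (delta C)) P.
Proof. intro H. split; auto. now apply closed_not. Qed.

Lemma delta_delta (C : class) P : delta C P -> delta (delta C) P.
Proof. intro H. split; auto. now apply closed_not. Qed.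

End Classes.

Ltac definable_rel := solve [ eauto with rel nocore ].

(* Proves that an explicitly written predicate belongs to a class, by recursion on
   its logical structure; named relations are looked up in the hint base rel. *)
Ltac definable_step :=
  cbv beta;
  lazymatch goal with
  | |- forall i, @term_fun _ _ => first [ apply term_scons | intro ]
  | |- term_fun _ => first [ apply term_var | apply term_const | apply term_pair | apply term_coprime_mod
                     | apply term_add | apply term_mul | assumption | apply term_sub; [assumption|] ]
  | |- ?C (fun _ => ?p) => apply (closed_true C)
  | |- ?C (fun e => @?A e = @?B e) => apply (closed_eq (C := C))
  | |- ?C (fun e => ~ (@?A e = @?B e)) => apply (closed_neq C)
  | |- ?C (fun e => lt _ (@?A e) (@?B e)) => apply (closed_lt (C := C))
  | |- ?C (fun e => ~ lt _ (@?A e) (@?B e)) => apply (closed_nlt C)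
  | |- ?C (fun e => le_M _ (@?A e) (@?B e)) => apply (closed_le C)
  | |- ?C (fun e => @?A e /\ @?B e) => apply (closed_and (C := C))
  | |- ?C (fun e => @?A e \/ @?B e) => apply (closed_or (C := C))
  | |- ?C (fun e => ~ @?A e) => first [ assumption | apply (closed_not (C := C)) | apply (delta_not_l C) ]
  | |- ?C (fun e => @?A e <-> @?B e) => apply (closed_iff C)
  | |- ?C (fun e => exists x, @?A e x) =>
      first [ apply (closed_exb C) | apply (closed_exle C) | apply (closed_ex C) ]
  | |- ?C (fun e => forall x : carrier _, @?A e x) => first [ apply (closed_allb C) | apply (closed_allle C) ]
  | |- ?C (fun e => @?A e -> @?B e) => apply (closed_imp C)
  | |- ?C ?P =>
    first
    [ assumption
    | lazymatch P with
      | (fun e => ?R (@?a e) (@?b e) (@?c e) (@?d e)) => apply (closed_sub4 C R a b c d); [definable_rel|..]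
      end
    | lazymatch P with
      | (fun e => ?R (@?a e) (@?b e) (@?c e)) => apply (closed_sub3 C R a b c); [definable_rel|..]
      end
    | lazymatch P with
      | (fun e => ?R (@?a e) (@?b e)) => apply (closed_sub2 C R a b); [definable_rel|..]
      end
    | lazymatch P with
      | (fun e => ?R (@?a e)) => apply (closed_sub1 C R a); [definable_rel|..]
      end
    | lazymatch P with
      | (fun e => ?R (@?a e)) => apply (closed_sub (C := C) R a); [definable_rel|..]
      end
    ]
  end.
Ltac definable := repeat definable_step.
Create HintDb rel.
#[export] Hint Resolve delta_rel1 delta_rel2 delta_rel3 delta_rel4 delta_delta delta_delta_rel1 delta_delta_rel2 delta_delta_rel3 delta_delta_rel4 : rel.
#[export] Hint Extern 1 (closed _) => typeclasses eauto : rel.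

(** * Existential classes and collection *)

Section Exists.
Context {M : arith_str} {HM : PAminus M}.
Local Notation "0" := (zero M) : m_scope.
Local Notation "1" := (one M) : m_scope.
Add Ring M_ring3 : M_semiring.
Local Notation env := (nat -> M).
Local Notation class := ((env -> Prop) -> Prop).

Lemma bound2 (x y : M) : exists b, x < b /\ y < b.
Proof.
  exists (x + y + 1). split; apply m_lt_succ_le; [apply m_le_add_r|apply m_le_add_l].
Qed.

Lemma exists_intro (C : class) (Q : M -> env -> Prop) :
  C (fun e => Q (e 0%nat) (fun i => e (S i))) -> exists_class C (fun e => exists y, Q y e).
Proof. intro H. exists (fun e => Q (e 0%nat) (fun i => e (S i))). split; auto. intro e. reflexivity. Qed.

Lemma sub_scons2 (C : class) {HC : closed C} (Q : env -> Prop) (t : env -> M) (tau : env -> env) :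
  C Q -> term_fun t -> (forall i, term_fun (fun e => tau e i)) -> C (fun e => Q (scons (t e) (tau e))).
Proof.
  intros. apply (closed_sub Q (fun e => scons (t e) (tau e))); auto. now apply term_scons.
Qed.

Lemma exists_dummy (C : class) {HC : closed C} P : C P -> exists_class C P.
Proof.
  intro H. exists (fun e => P (fun i => e (S i))). split.
  - apply (closed_sub P (fun e i => e (S i))); auto. intro; apply term_var.
  - intro e. simpl. split; [intro; exists 0|intros [_ ?]]; auto.
Qed.

(** Two unbounded witnesses are replaced by one bound on both, which avoids projections of a pairing
    function. *)
Lemma has_ex_exists (C : class) {HC : closed C} : has_ex (exists_class C).
Proof.
  intros P [Q [HQ E]].
  apply class_ext with (fun e => exists b, exists x, x < b /\ exists y, y < b /\ Q (scons y (scons x e))).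
  - intro e. split.
    + intros [x Hx]. apply E in Hx. destruct Hx as [y Hy].
      destruct (bound2 x y) as [b [? ?]]. exists b, x. split; auto. exists y. auto.
    + intros [b [x [_ [y [_ H]]]]]. exists x. apply E. now exists y.
  - apply exists_intro. definable.
Qed.

(** Collection enters for the bounded universal quantifier, which passes inside the existential one
    through a common bound on the witnesses. *)
Lemma closed_exists_class (C : class) {HC : closed C} : collects C -> closed (exists_class C).
Proof.
  intro K. split; intros.
  - apply exists_dummy; auto. now apply closed_eq.
  - apply exists_dummy; auto. now apply closed_lt.
  - destruct H as [P' [HP EP]], H0 as [Q' [HQ EQ]].
    apply class_ext with (fun e => exists b, (exists y, y < b /\ P' (scons y e)) /\
       (exists y, y < b /\ Q' (scons y e))).
    + intro e. rewrite EP, EQ. split.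
      * intros [[x Hx] [y Hy]]. destruct (bound2 x y) as [b [? ?]]. exists b; split; eauto.
      * intros [b [[x [_ Hx]] [y [_ Hy]]]]. eauto.
    + apply exists_intro. definable.
  - destruct H as [P' [HP EP]], H0 as [Q' [HQ EQ]].
    apply class_ext with (fun e => exists y, P' (scons y e) \/ Q' (scons y e)).
    + intro e. rewrite EP, EQ. split; [intros [[y ?]|[y ?]]; eauto|intros [y [?|?]]; eauto].
    + apply exists_intro. definable.
  - destruct H0 as [Q [HQ E]].
    apply class_ext with (fun e => exists y, exists x, x < t e /\ Q (scons y (scons x e))).
    + intro e. split.
      * intros [x [L H']]. apply E in H'. destruct H' as [y ?]. eauto.
      * intros [y [x [L H']]]. exists x. split; auto. apply E. eauto.
    + apply exists_intro. definable.
  - destruct H0 as [Q [HQ E]].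
    apply class_ext with (fun e => exists b, forall x, x < t e -> exists y, y < b /\ Q (scons y (scons x e))).
    + intro e. split.
      * intro H'. apply K; auto. intros x L. apply E. auto.
      * intros [b Hb] x L. apply E. destruct (Hb x L) as [y [_ ?]]. eauto.
    + apply exists_intro. definable.
  - destruct H as [Q [HQ E]].
    apply class_ext with (fun e => exists y, Q (scons y (tau e))).
    + intro e. apply E.
    + apply exists_intro. apply sub_scons2; auto; definable. apply (term_sub (fun e => tau e i)); auto; definable.
Qed.

Lemma collects_exists (C : class) {HC : closed C} : collects C -> collects (exists_class C).
Proof.
  intros K P [Q [HQ E]] e a H.
  destruct (K (fun e => exists y, y <= e 0%nat /\ exists z, z <= e 0%nat /\ Q (scons z (scons y (fun i => e (S i))))))
    with (e := e) (a := a) as [b Hb].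
  - definable.
  - intros x L. destruct (H x L) as [y Hy]. apply E in Hy. destruct Hy as [z Hz].
    (* The sum bounds both the value and its witness, so a single application of collection
       suffices. *)
    exists (y + z). exists y. split; [apply m_le_add_r|]. exists z. split; [apply m_le_add_l|]. exact Hz.
  - exists b. intros x L. destruct (Hb x L) as [w [Lw [y [Ly [z [Lz Hz]]]]]].
    exists y. split. now apply m_le_lt_trans with w. apply E. now exists z.
Qed.

Lemma collects_mono (C D : class) : (forall P, C P -> D P) -> collects D -> collects C.
Proof. intros H K P HP. apply K; auto. Qed.

Lemma collects_rel (C : class) R : collects C -> rel2 C R -> forall a,
  (forall x, x < a -> exists y, R y x) ->
  exists b, forall x, x < a -> exists y, y < b /\ R y x.
Proof. intros K H a Ha. exact (K _ H (fun _ => 0) a Ha). Qed.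

(* The properties of the Sigma_1 relations of a model of B Sigma_2 used below.
   Collection for the dual class is B Sigma_2. *)
Class arena (Sg : class) : Prop := {
  ar_cls :: closed Sg;
  ar_ex :: has_ex Sg;
  ar_coll : collects (dual Sg);
  ar_lnp : forall P, rel1 (delta Sg) P -> forall x, P x ->
     exists x, P x /\ forall y, y < x -> ~ P y;
  ar_delta : forall P, Sg P -> exists_class (delta Sg) P;
  ar_fin : forall P, Sg P -> exists k, forall e e' : env,
     (forall i, (i < k)%nat -> e i = e' i) -> P e -> P e' }.

Definition sigma2 (C : class) : class := exists_class (dual C).

Section Arena.
Context (Sg : class) {HA : arena Sg}.

Lemma collects_delta : collects (delta Sg).
Proof.
  apply collects_mono with (2 := ar_coll (Sg := Sg)). now intros P [].
Qed.

Lemma collects_base : collects Sg.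
Proof. apply collects_mono with (1 := ar_delta). apply collects_exists; [typeclasses eauto|apply collects_delta]. Qed.

Global Instance closed_sigma2 : closed (sigma2 Sg).
Proof. apply closed_exists_class; [typeclasses eauto|apply ar_coll]. Qed.

Global Instance has_ex_sigma2 : has_ex (sigma2 Sg).
Proof. apply has_ex_exists. typeclasses eauto. Qed.

Lemma collects_sigma2 : collects (sigma2 Sg).
Proof. apply collects_exists; [typeclasses eauto|apply ar_coll]. Qed.

Lemma sigma2_dual P : dual Sg P -> sigma2 Sg P.
Proof. apply exists_dummy. typeclasses eauto. Qed.

Lemma sigma2_base P : Sg P -> sigma2 Sg P.
Proof.
  intro H. apply ar_delta in H. destruct H as [Q [[_ H] E]]. exists Q. split; auto.
Qed.

Lemma delta2_base P : Sg P -> delta (sigma2 Sg) P.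
Proof.
  intro H. split. now apply sigma2_base. apply sigma2_dual. red. apply class_ext with P; auto. intro; tauto.
Qed.

Lemma delta2_delta P : delta Sg P -> delta (sigma2 Sg) P.
Proof. intros []. now apply delta2_base. Qed.

(* Collection bounds the witnesses of membership and of non-membership
   simultaneously, so below a fixed bound both sides become Pi_1. *)
Lemma delta2_restrict P a : rel1 (delta (sigma2 Sg)) P -> rel1 (delta Sg) (fun x => x < a /\ P x).
Proof.
  intros [[R [HR E]] [R' [HR' E']]].
  set (W := fun y x : M => R (scons y (fun _ => x))).
  set (W' := fun y x : M => R' (scons y (fun _ => x))).
  assert (HS : rel2 (dual Sg) W) by (unfold rel2, W; definable).
  assert (HS' : rel2 (dual Sg) W') by (unfold rel2, W'; definable).
  assert (F : forall x, P x <-> exists y, W y x) by (intro x; apply (E (fun _ => x))).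
  assert (F' : forall x, ~ P x <-> exists y, W' y x) by (intro x; apply (E' (fun _ => x))).
  destruct (collects_rel (dual Sg) (fun y x => W y x \/ W' y x) ar_coll) with (a := a) as [b Hb].
  { unfold rel2. definable. }
  { intros x _. destruct (classic (P x)) as [H|H]; [apply F in H|apply F' in H];
    destruct H as [y H]; exists y; auto. }
  split.
  - apply class_ext with (fun e => ~ (~ e 0%nat < a \/ exists y, y < b /\ W' y (e 0%nat))).
    + intro e. split.
      * intros [L H] [N|[y [_ H']]]; auto. apply F' in H; eauto.
      * intro N. split; [apply NNPP; tauto|]. apply NNPP. intro H. apply N.
        destruct (classic (e 0%nat < a)) as [L|]; auto. right.
        destruct (Hb _ L) as [y [Ly [H'|H']]]; eauto. destruct H. apply F. eauto.
    + change (dual Sg (fun e => ~ e 0%nat < a \/ exists y, y < b /\ W' y (e 0%nat))). definable.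
  - apply (class_ext (dual Sg)) with (fun e => e 0%nat < a /\ exists y, y < b /\ W y (e 0%nat)); [|definable].
    intro e. split; intros [L H]; split; auto.
    + destruct (Hb _ L) as [y [Ly [H'|H']]]; eauto. exfalso. cut (~ P (e 0%nat)); auto. apply F'. eauto.
    + apply F. destruct H as [y [_ H]]; eauto.
Qed.

(** Below [x + 1] the Delta_2 set becomes Delta_1, where the least number principle is part of the
    arena. *)
Lemma least2 P x : rel1 (delta (sigma2 Sg)) P -> P x ->
  exists x, P x /\ forall y, y < x -> ~ P y.
Proof.
  intros H Hx. destruct (ar_lnp _ (delta2_restrict P (x+1) H) x) as [y [[Ly Hy] Hmin]].
  { split; auto. apply m_lt_succ. }
  exists y. split; auto. intros z L Hz. apply (Hmin z L). split; auto. now apply m_lt_trans with y.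
Qed.

Lemma induction2 P : rel1 (delta (sigma2 Sg)) P -> P 0 -> (forall x, P x -> P (x + 1)) -> forall x, P x.
Proof.
  intros H H0 HS x. apply NNPP. intro N.
  destruct (least2 (fun x => ~ P x) x) as [y [Hy Hm]]; auto.
  { apply closed_not. apply H. }
  destruct (m_zero_or_succ y) as [-> | [z ->]]; auto.
  apply Hy, HS. apply NNPP. apply Hm, m_lt_succ.
Qed.

Lemma greatest2 P a x : rel1 (delta (sigma2 Sg)) P -> P x -> x < a ->
  exists y, P y /\ y < a /\ forall z, z < a -> P z -> z <= y.
Proof.
  intros H Hx Lx.
  destruct (least2 (fun b => forall z, z < a -> P z -> z < b) a) as [b [Hb Hm]].
  { unfold rel1. definable.
 }
  { auto. }
  destruct (m_zero_or_succ b) as [-> | [c ->]].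
  { now apply Hb, m_not_lt_zero in Hx. }
  (* [c] is the predecessor of the least strict upper bound, so some element below [a] is at least
     [c]; that element is the maximum. *)
  specialize (Hm c (m_lt_succ c)). apply not_all_ex_not in Hm. destruct Hm as [y Hy].
  exists y. apply imply_to_and in Hy. destruct Hy as [Ly Hy]. apply imply_to_and in Hy. destruct Hy as [Py Hy].
  repeat split; auto. intros z Lz Pz. apply m_le_trans with c.
  - apply m_lt_succ_le. auto.
  - now apply m_not_lt.
Qed.

End Arena.
End Exists.

(** * Coded sets *)

Section Coding.
Context {M : arith_str} {HM : PAminus M}.
Local Notation "0" := (zero M) : m_scope.
Local Notation "1" := (one M) : m_scope.
Add Ring M_ring4 : M_semiring.
Local Notation env := (nat -> M).
Local Notation class := ((env -> Prop) -> Prop).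

Definition bdivides (d x : M) : Prop := exists q, q <= x /\ x = d * q.

Lemma bdivides_iff (d x : M) : 0 < d -> (bdivides d x <-> divides d x).
Proof.
  intro H. split.
  - intros [q [_ Hq]]. now exists q.
  - intros [q ->]. exists q. split; auto. replace (d*q) with (q*d) by ring. now apply m_le_mul_r.
Qed.

Lemma coprime_mod_pos (b i : M) : 0 < coprime_mod b i.
Proof. apply m_pos_succ. unfold coprime_mod. exists ((i+1)*b). ring. Qed.

Lemma bdivides_mod (b i x : M) : bdivides (coprime_mod b i) x <-> divides (coprime_mod b i) x.
Proof. apply bdivides_iff, coprime_mod_pos. Qed.

(** Goedel's coding: the pair of [a] and [b] codes those [i] whose modulus [1 + (i+1) b] divides
    [a]. All quantifiers are bounded by the code, so membership lies in every closed class. *)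
Definition in_code (i s : M) : Prop :=
  i < s /\ exists a, a <= s /\ exists b, b <= s /\ s = pair a b /\ bdivides (coprime_mod b i) a.

Lemma bdivides_def (C : class) {HC : closed C} : rel2 C bdivides.
Proof. unfold rel2, bdivides. definable. Qed.
Hint Resolve bdivides_def : rel.

Lemma in_code_def (C : class) {HC : closed C} : rel2 C in_code.
Proof. unfold rel2, in_code. definable. Qed.
Hint Resolve in_code_def : rel.

Definition agree (u s s' : M) : Prop := forall i, i < u -> (in_code i s <-> in_code i s').

Lemma agree_def (C : class) {HC : closed C} : rel3 (delta C) agree.
Proof. unfold rel3, agree. definable.
Qed.

(** [b] plays the role of a factorial of [u]: the moduli with index below [u] become pairwise
    coprime. *)
Definition mods (u b : M) : Prop := 0 < b /\ forall d, d <= u -> 0 < d -> bdivides d b.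

(** [g] is one more than a code of the whole interval below [u]. It replaces the power [2^u] as a
    bound when quantifying over subsets of that interval, and it is Sigma-definable. *)
Definition full_code (u g : M) : Prop :=
  exists a b, mods u b /\ 0 < a /\ (forall j, j < u -> bdivides (coprime_mod b j) a) /\ g = pair a b + 1.

Lemma mods_def (C : class) {HC : closed C} : rel2 (delta C) mods.
Proof. unfold rel2, mods. definable. Qed.
Hint Resolve mods_def : rel.

Context (Sg : class) {HA : arena Sg}.

Lemma full_code_def : rel2 Sg full_code.
Proof. unfold rel2, full_code. definable. Qed.

Lemma induction_base P : rel1 Sg P -> P 0 -> (forall x, P x -> P (x + 1)) -> forall x, P x.
Proof. intro H. apply (induction2 Sg). apply delta2_base; auto. Qed.

Lemma least_base P x : rel1 Sg P -> P x -> exists x, P x /\ forall y, y < x -> ~ P y.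
Proof. intro H. apply (least2 Sg). apply delta2_base; auto. Qed.

Lemma division (a m : M) : 0 < m -> exists q r, a = m * q + r /\ r < m.
Proof.
  intro Hm. destruct (least_base (fun q => a < m * (q + 1)) a) as [q [Hq Hmin]].
  - unfold rel1. definable.
  - apply m_lt_le_trans with (a + 1). apply m_lt_succ. replace (m*(a+1)) with ((a+1)*m) by ring.
    now apply m_le_mul_r.
  - assert (L : m * q <= a).
    { destruct (m_zero_or_succ q) as [-> | [p ->]].
      - replace (m*0) with 0 by ring. apply m_zero_le.
      - apply m_not_lt, Hmin, m_lt_succ. }
    apply m_le_iff in L. destruct L as [r ->]. exists q, r. split; auto.
    apply m_not_le. intro L. apply m_not_le in Hq. apply Hq.
    apply m_le_iff in L. destruct L as [w ->]. apply m_le_iff. exists w. ring.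
Qed.

Lemma mods_exist (u : M) : exists b, mods u b.
Proof.
  revert u. apply induction_base.
  - unfold rel1. definable.
  - exists 1. split. apply m_zero_one. intros d L H. exfalso.
    apply m_lt_le_trans with (1:=H) in L. now apply m_lt_irrefl in L.
  - intros u [b [Hb Hd]]. exists (b * (u + 1)).
    assert (Hu : 0 < u + 1) by (apply m_pos_succ; now exists u). split.
    + now apply m_mul_pos.
    + intros d L H. apply bdivides_iff; auto. destruct L as [L| ->].
      * apply divides_mul_r, bdivides_iff; auto. apply Hd; auto. now apply m_lt_succ_le.
      * apply divides_mul_l. exists 1. ring.
Qed.

Lemma mods_ge (u b : M) : mods u b -> u <= b.
Proof.
  intros [Hb H]. destruct (m_zero_le u) as [L|<-]; [|apply m_zero_le].
  destruct (H u (m_le_refl u) L) as [q [_ E1]]. rewrite E1 in Hb |- *.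
  apply m_le_mul_r. now apply m_mul_pos_inv in Hb.
Qed.

Lemma mods_gauss (u b i j a : M) : mods u b -> i < u -> j < u -> i <> j ->
  bdivides (coprime_mod b j) (a * coprime_mod b i) -> bdivides (coprime_mod b j) a.
Proof.
  intros [Hb H] Li Lj N. rewrite !bdivides_mod. apply (coprime_mod_gauss b u i j); auto.
  intros d H0 H1. apply bdivides_iff; auto.
Qed.

(** The product of the moduli indexed by [P] is built by induction; coprimality ensures that a new
    factor makes no other modulus a divisor. *)
Lemma code_mods (u b : M) P : mods u b -> rel1 (delta (sigma2 Sg)) P ->
  exists a, 0 < a /\ forall j, j < u -> (bdivides (coprime_mod b j) a <-> P j).
Proof.
  intros Hb HP. apply (delta2_restrict Sg P u) in HP.
  cut (forall i, exists a, 0 < a /\ forall j, j < u -> (bdivides (coprime_mod b j) a <-> j < i /\ j < u /\ P j)).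
  { intro H. destruct (H u) as [a [Ha K]]. exists a. split; auto. intros j L. rewrite K; tauto. }
  apply induction_base.
  - set (P' := fun x => x < u /\ P x) in HP. change (rel1 Sg (fun i => exists a, 0 < a /\ forall j, j < u -> (bdivides (coprime_mod b j) a <-> j < i /\ P' j))). unfold rel1. definable.
  - exists 1. split. apply m_zero_one. intros j L. split.
    + rewrite bdivides_mod. intro D. apply coprime_mod_not_one in D; [tauto|apply Hb].
    + intros [L0 _]. now apply m_not_lt_zero in L0.
  - intros i [a [Ha K]]. destruct (classic (i < u /\ P i)) as [[Li Pi]|N].
    + exists (a * coprime_mod b i). split. apply m_mul_pos; auto using coprime_mod_pos.
      intros j L. rewrite m_lt_succ_cases. destruct (classic (i = j)) as [<-|Nij].
      * split; [tauto|]. intros _. rewrite bdivides_mod. apply divides_mul_l. exists 1. ring.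
      * split.
        -- intro D. apply mods_gauss with (u := u) in D; auto. apply K in D; tauto.
        -- intros [[L1|?] ?]; [|congruence]. rewrite bdivides_mod. apply divides_mul_r. rewrite <- bdivides_mod. apply K; auto.
    + exists a. split; auto. intros j L. rewrite K, m_lt_succ_cases; auto.
      split; [tauto|]. intros [[?| ->] ?]; tauto.
Qed.

Lemma in_code_pair (u a b i : M) : mods u b -> i < u -> (in_code i (pair a b) <-> bdivides (coprime_mod b i) a).
Proof.
  intros Hb L. split.
  - intros [_ [a' [_ [b' [_ [E1 H]]]]]]. apply pair_inj in E1. destruct E1 as [-> ->]. auto.
  - intro H. split.
    + apply m_lt_le_trans with u; auto. apply m_le_trans with b. now apply mods_ge. apply pair_le_r.
    + exists a. split. apply pair_le_l. exists b. split; auto. apply pair_le_r.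
Qed.

Lemma full_code_total (u : M) : exists g, full_code u g.
Proof.
  destruct (mods_exist u) as [b Hb]. destruct (code_mods u b (fun _ => True)) as [a [Ha K]]; auto.
  { unfold rel1. definable. }
  exists (pair a b + 1), a, b. repeat split; auto; try apply Hb. intros j L. now apply K.
Qed.

(* The least positive common multiple of the moduli indexed by P divides every
   other common multiple, in particular one that codes P exactly. *)
Lemma code_below (u g : M) P : full_code u g -> rel1 (delta (sigma2 Sg)) P ->
  exists s, s < g /\ forall i, i < u -> (in_code i s <-> P i).
Proof.
  intros [af [b [Hb [Haf [Hf ->]]]]] HP.
  destruct (code_mods u b P Hb HP) as [a0 [Ha0 K0]].
  apply (delta2_restrict Sg P u) in HP. set (P' := fun x => x < u /\ P x) in HP.
  destruct (least_base (fun a => 0 < a /\ forall j, j < u -> P' j -> bdivides (coprime_mod b j) a) af) as [a [[Ha K] Hmin]].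
  { unfold rel1. definable. }
  { auto. }
  assert (Laf : a <= af).
  { apply m_not_lt. intro L. apply (Hmin _ L). auto. }
  destruct (division a0 a Ha) as [q [r [E0 Lr]]].
  (* A positive remainder would be a smaller common multiple. *)
  assert (r = 0).
  { destruct (m_zero_le r) as [Hr|]; auto. exfalso. apply (Hmin r Lr). split; auto.
    intros j L Pj. rewrite bdivides_mod. apply divides_sub with (a * q).
    - replace (r + a*q) with a0 by (rewrite E0; ring). rewrite <- bdivides_mod. apply K0; auto. apply Pj.
    - apply divides_mul_r. rewrite <- bdivides_mod. apply K; auto. }
  subst r. exists (pair a b). split.
  - apply m_lt_succ_le, pair_mono; auto using m_le_refl.
  - intros i L. rewrite (in_code_pair u); auto. split.
    + intro D. apply K0; auto. rewrite bdivides_mod in *. rewrite E0. replace (a*q+0) with (a*q) by ring.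
      now apply divides_mul_r.
    + intro Pi. apply K; auto. now split.
Qed.

Lemma comprehension (u : M) P : rel1 (delta (sigma2 Sg)) P ->
  exists s, forall i, i < u -> (in_code i s <-> P i).
Proof.
  intro H. destruct (full_code_total u) as [g Hg].
  destruct (code_below u g P Hg H) as [s [_ Hs]]. eauto.
Qed.

End Coding.
#[export] Hint Resolve bdivides_def in_code_def agree_def mods_def full_code_def : rel.

(** * The arithmetical hierarchy *)

Section Hierarchy.
Context {M : arith_str} {HM : PAminus M}.
Local Notation "0" := (zero M) : m_scope.
Local Notation "1" := (one M) : m_scope.
Add Ring M_ring5 : M_semiring.
Local Notation env := (nat -> M).
Local Notation class := ((env -> Prop) -> Prop).

Inductive delta0_rel : class :=
| delta0_eq s t : term_fun s -> term_fun t -> delta0_rel (fun e => s e = t e)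
| delta0_lt s t : term_fun s -> term_fun t -> delta0_rel (fun e => s e < t e)
| delta0_and P Q : delta0_rel P -> delta0_rel Q -> delta0_rel (fun e => P e /\ Q e)
| delta0_or P Q : delta0_rel P -> delta0_rel Q -> delta0_rel (fun e => P e \/ Q e)
| delta0_exb t P : term_fun t -> delta0_rel P -> delta0_rel (fun e => exists x, x < t e /\ P (scons x e))
| delta0_allb t P : term_fun t -> delta0_rel P -> delta0_rel (fun e => forall x, x < t e -> P (scons x e)).

Global Instance closed_delta0_rel : closed delta0_rel.
Proof.
  split; try (now constructor). intros P tau H. revert tau.
  induction H; intros tau Ht.
  - apply (delta0_eq (fun e => s (tau e)) (fun e => t (tau e))); now apply term_sub.
  - apply (delta0_lt (fun e => s (tau e)) (fun e => t (tau e))); now apply term_sub.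
  - apply (delta0_and (fun e => P (tau e)) (fun e => Q (tau e))); auto.
  - apply (delta0_or (fun e => P (tau e)) (fun e => Q (tau e))); auto.
  - apply (delta0_exb (fun e => t (tau e)) (fun e => P (scons (e 0%nat) (tau (fun i => e (S i)))))).
    now apply term_sub. apply (IHdelta0_rel (fun e => scons (e 0%nat) (tau (fun i => e (S i))))).
    apply term_scons. apply term_var. intro i. apply (term_sub (fun e => tau e i)); auto. intro; apply term_var.
  - apply (delta0_allb (fun e => t (tau e)) (fun e => P (scons (e 0%nat) (tau (fun i => e (S i)))))).
    now apply term_sub. apply (IHdelta0_rel (fun e => scons (e 0%nat) (tau (fun i => e (S i))))).
    apply term_scons. apply term_var. intro i. apply (term_sub (fun e => tau e i)); auto. intro; apply term_var.
Qed.

(** The dual of a closed class is closed, so it contains everything that the generators of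
    [delta0_rel] produce; this pushes negations inwards. *)
Global Instance has_not_delta0_rel : has_not delta0_rel.
Proof.
  intros P H. change (dual delta0_rel P). induction H; try (now apply closed_eq); try (now apply closed_lt).
  - now apply closed_and. - now apply closed_or. - now apply closed_exb0. - now apply closed_allb0.
Qed.

Fixpoint sigma_rel (k : nat) : class := match k with O => delta0_rel | S k => exists_class (dual (sigma_rel k)) end.

Lemma exists_mono (C D : class) : (forall P, C P -> D P) -> forall P, exists_class C P -> exists_class D P.
Proof. intros H P [Q [HQ HE]]. exists Q. auto. Qed.

Lemma sigma_rel_succ k P : sigma_rel k P -> sigma_rel (S k) P.
Proof.
  revert P. induction k; intros P H.
  - apply exists_dummy. typeclasses eauto. now apply closed_not.
  - simpl sigma_rel. revert H. apply exists_mono. intros Q HQ. apply IHk, HQ.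
Qed.

Lemma sigma_rel_mono k l P : (k <= l)%nat -> sigma_rel k P -> sigma_rel l P.
Proof. induction 1; auto using sigma_rel_succ. Qed.

Definition finitary (P : env -> Prop) : Prop :=
  exists k, forall e e' : env, (forall i, (i < k)%nat -> e i = e' i) -> P e -> P e'.

Lemma term_finitary t : term_fun t ->
  exists k, forall e e' : env, (forall i, (i < k)%nat -> e i = e' i) -> t e = t e'.
Proof.
  induction 1 as [i|c|s t _ [k Hk] _ [l Hl]|s t _ [k Hk] _ [l Hl]].
  - exists (S i). intros e e' H. apply H. lia.
  - exists O. auto.
  - exists (k + l)%nat. intros e e' H. rewrite (Hk e e'), (Hl e e'); auto; intros; apply H; lia.
  - exists (k + l)%nat. intros e e' H. rewrite (Hk e e'), (Hl e e'); auto; intros; apply H; lia.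
Qed.

Lemma scons_agree k (e e' : env) x : (forall i, (i < k)%nat -> e i = e' i) ->
  forall i, (i < S k)%nat -> scons x e i = scons x e' i.
Proof. intros H [|i] L; simpl; auto. apply H. lia. Qed.

Lemma finitary_not P : finitary P -> finitary (fun e => ~ P e).
Proof. intros [k H]. exists k. intros e e' Ha N HP. apply N. apply (H e' e); auto. intros. symmetry. auto. Qed.

Lemma delta0_rel_finitary P : delta0_rel P -> finitary P.
Proof.
  induction 1 as [s t Hs Ht|s t Hs Ht|P Q _ [k Hk] _ [l Hl]|P Q _ [k Hk] _ [l Hl]|t P Ht _ [k Hk]|t P Ht _ [k Hk]].
  - destruct (term_finitary s Hs) as [k Hk], (term_finitary t Ht) as [l Hl]. exists (k+l)%nat.
    intros e e' H. rewrite (Hk e e'), (Hl e e'); auto; intros; apply H; lia.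
  - destruct (term_finitary s Hs) as [k Hk], (term_finitary t Ht) as [l Hl]. exists (k+l)%nat.
    intros e e' H. rewrite (Hk e e'), (Hl e e'); auto; intros; apply H; lia.
  - exists (k + l)%nat. intros e e' H [? ?].
    split; [apply (Hk e)|apply (Hl e)]; auto; intros; apply H; lia.
  - exists (k + l)%nat. intros e e' H [?|?]; [left; apply (Hk e)|right; apply (Hl e)]; auto; intros; apply H; lia.
  - destruct (term_finitary t Ht) as [l Hl]. exists (k+l)%nat. intros e e' H.
    rewrite (Hl e e') by (intros; apply H; lia). intros [x [L Hx]]. exists x. split; auto. revert Hx. apply Hk.
    intros i Hi. apply (scons_agree (k+l)); auto. lia.
  - destruct (term_finitary t Ht) as [l Hl]. exists (k+l)%nat. intros e e' H.
    rewrite (Hl e e') by (intros; apply H; lia). intros K x L. generalize (K x L). apply Hk.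
    intros i Hi. apply (scons_agree (k+l)); auto. lia.
Qed.

Lemma sigma_rel_finitary k P : sigma_rel k P -> finitary P.
Proof.
  revert P. induction k; intros P H.
  - now apply delta0_rel_finitary.
  - destruct H as [Q [HQ HE]]. apply IHk in HQ. apply finitary_not in HQ. destruct HQ as [l Hl].
    exists l. intros e e' H. rewrite !HE. intros [y Hy]. exists y. apply NNPP.
    apply (Hl (scons y e)); [|tauto]. intros i Hi. apply (scons_agree l); auto.
Qed.

Lemma eval_tm t : term_fun (fun e => eval M e t).
Proof. induction t; simpl; constructor; auto. Qed.

Lemma sat_delta0_rel phi : is_delta0 phi -> delta0_rel (fun e => sat M e phi).
Proof.
  induction 1; simpl.
  - apply closed_eq; apply eval_tm.
  - apply closed_lt; apply eval_tm.
  - now apply closed_not.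
  - now apply closed_and.
  - now apply closed_or.
  - apply (closed_imp delta0_rel); auto. split; auto. now apply closed_not.
  - apply (delta0_allb (fun e => eval M e t) (fun e => sat M e p)); auto using eval_tm.
  - apply (delta0_exb (fun e => eval M e t) (fun e => sat M e p)); auto using eval_tm.
Qed.

Section Sat.
Variable m : nat.
Hypothesis Hcls : forall k, (k <= m)%nat -> closed (sigma_rel k).

Lemma has_ex_sigma_rel k : (S k <= m)%nat -> has_ex (sigma_rel (S k)).
Proof. intro L. simpl. pose proof (Hcls k ltac:(lia)). apply has_ex_exists. typeclasses eauto. Qed.

(** A formula may carry a block of like quantifiers, whereas [sigma_rel] adds a single one per
    level; closure under existential quantification contracts the block. *)
Lemma sat_sigma_rel k phi : (k <= m)%nat ->
  (is_sigma k phi -> sigma_rel k (fun e => sat M e phi)) /\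
  (is_pi k phi -> dual (sigma_rel k) (fun e => sat M e phi)).
Proof.
  revert phi. induction k; intros phi L.
  - split; intro H; inversion H; subst.
    + now apply sat_delta0_rel. + apply closed_not. now apply sat_delta0_rel.
  - assert (IHs := fun phi => proj1 (IHk phi ltac:(lia))).
    assert (IHp := fun phi => proj2 (IHk phi ltac:(lia))).
    pose proof (Hcls k ltac:(lia)). split; intro H0.
    + remember (S k) as l. induction H0; try discriminate; injection Heql as ->.
      * apply exists_dummy; [typeclasses eauto|auto].
      * apply (has_ex_sigma_rel k L (fun e => sat M e p)). auto.
    + remember (S k) as l. induction H0; try discriminate; injection Heql as ->.
      * red. apply exists_dummy; [typeclasses eauto|].
        apply (class_ext (sigma_rel k)) with (fun e => sat M e p); [intro; tauto|now apply IHs].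
      * red. apply class_ext with (fun e => exists a, ~ sat M (scons a e) p).
        -- intro e. simpl. split; [apply not_all_ex_not|firstorder].
        -- apply (has_ex_sigma_rel k L (fun e => ~ sat M e p)). apply IHis_pi; auto.
Qed.
End Sat.

(** * From relations back to formulas; collection and least elements at each level *)

Variable p : nat -> M.
Hypothesis p_surj : forall x, exists i, p i = x.

(* Parameters are read off the enumeration p from position N on, so that passing
   under a quantifier merely increases N and formulas need no renaming. *)
Definition envN (N : nat) (e : env) : env := fun i => if i <? N then e i else p (i - N).

Lemma scons_envN N e y : scons y (envN N e) = envN (S N) (scons y e).
Proof. extensionality i. unfold envN. destruct i; simpl; auto. Qed.

(** Expressibility is demanded for all large [N], so that subexpressions can share one [N] and a
    quantifier can raise it. *)
Lemma term_eval t : term_fun t -> exists N0, forall N, (N0 <= N)%nat -> exists u, forall e, t e = eval M (envN N e) u.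
Proof.
  induction 1 as [i|c|s t _ [k Hk] _ [l Hl]|s t _ [k Hk] _ [l Hl]].
  - exists (S i). intros N L. exists (Tvar i). intro e. simpl. unfold envN.
    destruct (Nat.ltb_spec i N); auto; lia.
  - destruct (p_surj c) as [i <-]. exists O. intros N _. exists (Tvar (N + i)). intro e. simpl. unfold envN.
    destruct (Nat.ltb_spec (N+i) N); [lia|]. f_equal. lia.
  - exists (k+l)%nat. intros N L. destruct (Hk N ltac:(lia)) as [u Hu], (Hl N ltac:(lia)) as [v Hv].
    exists (Tadd u v). intro e. simpl. now rewrite Hu, Hv.
  - exists (k+l)%nat. intros N L. destruct (Hk N ltac:(lia)) as [u Hu], (Hl N ltac:(lia)) as [v Hv].
    exists (Tmul u v). intro e. simpl. now rewrite Hu, Hv.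
Qed.

Definition expressed (F : formula -> Prop) (P : env -> Prop) : Prop :=
  exists N0, forall N, (N0 <= N)%nat -> exists phi, F phi /\ forall e, P e <-> sat M (envN N e) phi.

Lemma delta0_rel_expressed P : delta0_rel P -> expressed is_delta0 P.
Proof.
  induction 1 as [s t Hs Ht|s t Hs Ht|P Q _ [k Hk] _ [l Hl]|P Q _ [k Hk] _ [l Hl]|t P Ht _ [k Hk]|t P Ht _ [k Hk]].
  1,2: destruct (term_eval s Hs) as [k Hk], (term_eval t Ht) as [l Hl]; exists (k+l)%nat; intros N L;
    destruct (Hk N ltac:(lia)) as [u Hu], (Hl N ltac:(lia)) as [v Hv].
  - exists (Feq u v). split. constructor. intro e. simpl. now rewrite Hu, Hv.
  - exists (Flt u v). split. constructor. intro e. simpl. now rewrite Hu, Hv.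
  - exists (k+l)%nat; intros N L;
    destruct (Hk N ltac:(lia)) as [u [Du Hu]], (Hl N ltac:(lia)) as [v [Dv Hv]].
    exists (Fand u v). split. now constructor. intro e. simpl. now rewrite Hu, Hv.
  - exists (k+l)%nat; intros N L;
    destruct (Hk N ltac:(lia)) as [u [Du Hu]], (Hl N ltac:(lia)) as [v [Dv Hv]].
    exists (For u v). split. now constructor. intro e. simpl. now rewrite Hu, Hv.
  - destruct (term_eval t Ht) as [l Hl]. exists (k+l)%nat; intros N L.
    destruct (Hk (S N) ltac:(lia)) as [u [Du Hu]], (Hl N ltac:(lia)) as [v Hv].
    exists (Fexb v u). split. now constructor. intro e. simpl. rewrite Hv.
    split; intros [x [? Hx]]; exists x; split; auto; [rewrite scons_envN; now apply Hu|rewrite Hu, <- scons_envN; auto].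
  - destruct (term_eval t Ht) as [l Hl]. exists (k+l)%nat; intros N L.
    destruct (Hk (S N) ltac:(lia)) as [u [Du Hu]], (Hl N ltac:(lia)) as [v Hv].
    exists (Fallb v u). split. now constructor. intro e. simpl. rewrite Hv.
    split; intros K x Lx; generalize (K x Lx); [rewrite scons_envN; now apply Hu|rewrite Hu, <- scons_envN; auto].
Qed.

Lemma sigma_rel_expressed k P :
  (sigma_rel k P -> expressed (is_sigma k) P) /\ (dual (sigma_rel k) P -> expressed (is_pi k) P).
Proof.
  revert P. induction k; intro P.
  - split; intro H; apply delta0_rel_expressed in H; destruct H as [N0 H]; exists N0; intros N L;
    destruct (H N L) as [phi [D Hphi]].
    + exists phi. split; auto. now constructor.
    + exists (Fnot phi). split. now repeat constructor. intro e. simpl. rewrite <- Hphi.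
      split; [tauto|apply NNPP].
  - split; intros [Q [HQ HE]].
    + apply IHk in HQ. destruct HQ as [N0 H]. exists N0. intros N L.
      destruct (H (S N) ltac:(lia)) as [phi [D Hphi]]. exists (Fex phi). split. now repeat constructor.
      intro e. simpl. rewrite HE. split; intros [y Hy]; exists y; [rewrite scons_envN; now apply Hphi|rewrite Hphi, <- scons_envN; auto].
    + change (sigma_rel k (fun e => ~ Q e)) in HQ. apply (proj1 (IHk _)) in HQ. destruct HQ as [N0 H]. exists N0. intros N L.
      destruct (H (S N) ltac:(lia)) as [phi [D Hphi]]. exists (Fall phi). split. now repeat constructor.
      intro e. simpl. transitivity (forall y, ~ Q (scons y e)).
      { split. intros HP y Hy. apply HE in HP; eauto. intro K. apply NNPP. intro N1. apply HE in N1. destruct N1 as [y ?]. now apply (K y). }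
      split; intros K y; generalize (K y); [rewrite scons_envN; now apply Hphi|rewrite Hphi, <- scons_envN; auto].
Qed.

Lemma BSigma_collects k : BSigma k M -> collects (sigma_rel k).
Proof.
  intros [_ HB] P HP e a H. apply sigma_rel_expressed in HP. destruct HP as [N0 HP].
  destruct (HP (S (S N0)) ltac:(lia)) as [phi [D Hphi]].
  assert (F : forall x y, P (scons y (scons x e)) <-> sat M (scons y (scons x (envN N0 e))) phi).
  { intros x y. rewrite !scons_envN. apply Hphi. }
  destruct (HB phi D (envN N0 e) a) as [b Hb].
  - intros x L. destruct (H x L) as [y Hy]. exists y. now apply F.
  - exists b. intros x L. destruct (Hb x L) as [y [Ly Hy]]. exists y. split; auto. now apply F.
Qed.

Definition least_elements (C : class) : Prop := forall P, rel1 C P -> forall x, P x ->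
     exists x, P x /\ forall y, y < x -> ~ P y.

(** Induction is applied to the Delta_0 statement that nothing below [z] satisfies [P]. *)
Lemma least_delta0_rel : IDelta0 M -> least_elements delta0_rel.
Proof.
  intros [_ HI] P HP x Px. apply NNPP. intro N.
  assert (D : delta0_rel (fun e => forall y, y < e 0%nat -> ~ P y)).
  { definable. }
  apply delta0_rel_expressed in D. destruct D as [N0 HN]. destruct (HN (S N0) ltac:(lia)) as [phi [D Hphi]].
  assert (F : forall e z, sat M (scons z (envN N0 e)) phi <-> forall y, y < z -> ~ P y).
  { intros e z. rewrite scons_envN, <- Hphi. reflexivity. }
  assert (K : forall z, forall y, y < z -> ~ P y).
  { intro z. apply (F (fun _ => 0)). apply HI; auto.
    - apply F. intros y L. now apply m_not_lt_zero in L.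
    - intro a. rewrite !F. intros Ha y L. apply m_lt_succ_cases in L. destruct L as [L| ->]; auto.
      intro H. apply N. exists a. auto. }
  apply (K (x+1) x); auto. apply m_lt_succ.
Qed.

Section Arena.
Variable n : nat.
Hypothesis HB : BSigma (S (S n)) M.

Lemma collects_dual_sigma_rel k : (k <= S n)%nat -> closed (sigma_rel k) -> collects (dual (sigma_rel k)).
Proof.
  intros L Hk. apply collects_mono with (sigma_rel (S (S n))); [|now apply BSigma_collects].
  intros P HP. apply sigma_rel_mono with (S k). lia. apply exists_dummy; auto. typeclasses eauto.
Qed.

Lemma sigma_closed k : (k <= S n)%nat -> closed (sigma_rel k).
Proof.
  induction k; intro L. typeclasses eauto. pose proof (IHk ltac:(lia)) as Hk.
  apply closed_exists_class. typeclasses eauto. apply collects_dual_sigma_rel; auto. lia.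
Qed.

(** Collection is applied to the alternative that [P x] fails or has a witness below [w]. This is
    Pi_{k+1} and some [w] always exists, so one bound serves all [x < a]. *)
Lemma sigma_rel_restrict k P a : (k <= n)%nat -> rel1 (sigma_rel (S k)) P ->
  exists P', rel1 (dual (sigma_rel k)) P' /\ forall x, x < a -> (P x <-> P' x).
Proof.
  intros L HP. pose proof (sigma_closed k ltac:(lia)) as Hk. pose proof (sigma_closed (S k) ltac:(lia)) as Hk'.
  destruct HP as [Q [HQ HE]]. set (W := fun y x : M => Q (scons y (fun _ => x))).
  assert (HW : rel2 (dual (sigma_rel k)) W) by (unfold rel2, W; definable).
  assert (F : forall x, P x <-> exists y, W y x) by (intro x; apply (HE (fun _ => x))).
  assert (HP : rel1 (sigma_rel (S k)) P).
  { apply (class_ext (sigma_rel (S k))) with (fun e => exists y, W y (e 0%nat)); [intro; apply F|]. apply (exists_intro (dual (sigma_rel k)) (fun y e => W y (e 0%nat))). apply HW. }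
  assert (HW' : rel2 (dual (sigma_rel (S k))) W) by now apply sigma_rel_succ.
  destruct (collects_rel (dual (sigma_rel (S k))) (fun w x => ~ P x \/ exists y, y < w /\ W y x)) with (a := a) as [b Hb].
  - apply collects_dual_sigma_rel; auto. lia.
  - unfold rel2. apply (closed_or (C := dual (sigma_rel (S k)))); [|definable].
    apply (class_ext (sigma_rel (S k)) (fun e => P (e 1%nat)) (fun e => ~ ~ P (e 1%nat))). intro; tauto.
    apply closed_sub1; auto. definable.
  - intros x _. destruct (classic (P x)) as [H|H].
    + pose proof H as H'. apply F in H'. destruct H' as [y Hy]. exists (y+1). right. exists y. split; auto. apply m_lt_succ.
    + exists 0. now left.
  - exists (fun x => exists y, y < b /\ W y x). split.
    + unfold rel1. definable.
    + intros x Lx. split.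
      * intro Px. destruct (Hb x Lx) as [w [Lw [N|[y [Ly Hy]]]]]; [tauto|]. exists y. split; auto.
        now apply m_lt_trans with w.
      * intros [y [_ Hy]]. apply F. eauto.
Qed.

(** Below [x + 1] a Sigma_{k+1} set agrees with a Pi_k set, so each least number principle at level
    [k + 1] reduces to the opposite one at level [k]. *)
Lemma least_sigma_rel k : (k <= S n)%nat -> least_elements (sigma_rel k) /\ least_elements (dual (sigma_rel k)).
Proof.
  induction k; intro L.
  - assert (H : least_elements delta0_rel) by apply least_delta0_rel, HB. split; auto. intros P HP. apply H.
    apply (has_not_delta0_rel (fun e => ~ P (e 0%nat))) in HP. apply (class_ext delta0_rel (fun e => ~ ~ P (e 0%nat))); [intro; tauto|exact HP].
  - destruct (IHk ltac:(lia)) as [H1 H2]. pose proof (sigma_closed k ltac:(lia)) as Hk. split.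
    + intros P HP x Px. destruct (sigma_rel_restrict k P (x+1) ltac:(lia) HP) as [P' [HP' F]].
      destruct (H2 (fun y => y < x + 1 /\ P' y)) with (x := x) as [y [[Ly Py] Hy]].
      * unfold rel1. definable.
      * split. apply m_lt_succ. apply F; auto. apply m_lt_succ.
      * exists y. split. now apply F. intros z Lz Pz.
        assert (z < x + 1) by now apply m_lt_trans with y. apply (Hy z); auto. split; auto. now apply F.
    + intros P HP x Px. destruct (sigma_rel_restrict k (fun x => ~ P x) (x+1) ltac:(lia) HP) as [P' [HP' F]].
      destruct (H1 (fun y => y < x + 1 /\ ~ P' y)) with (x := x) as [y [[Ly Py] Hy]].
      * unfold rel1. definable.
      * split. apply m_lt_succ. rewrite <- F; auto. apply m_lt_succ.
      * exists y. split. apply NNPP. rewrite F; auto. intros z Lz Pz.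
        assert (z < x + 1) by now apply m_lt_trans with y. apply (Hy z); auto. split; auto. rewrite <- F; auto.
Qed.

Lemma sigma_arena : arena (sigma_rel (S n)).
Proof.
  pose proof (sigma_closed n ltac:(lia)). pose proof (sigma_closed (S n) ltac:(lia)). split; auto.
  - apply has_ex_exists. typeclasses eauto.
  - apply collects_dual_sigma_rel; auto.
  - intros P [HP _]. apply (proj1 (least_sigma_rel (S n) (le_n _)) P HP).
  - intro P. apply exists_mono. intros Q HQ. split.
    + apply exists_dummy; auto. typeclasses eauto.
    + now apply sigma_rel_succ.
  - intro P. apply sigma_rel_finitary.
Qed.
End Arena.
End Hierarchy.

(** * Universal relations *)

Section Universal.
Context {M : arith_str} {HM : PAminus M}.
Local Notation "0" := (zero M) : m_scope.
Local Notation "1" := (one M) : m_scope.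
Add Ring M_ring6 : M_semiring.
Local Notation env := (nat -> M).
Local Notation class := ((env -> Prop) -> Prop).

Fixpoint numeral (k : nat) : M := match k with O => 0 | S k => numeral k + 1 end.

Lemma numeral_inj k l : numeral k = numeral l -> k = l.
Proof.
  revert l. induction k; intros [|l] H; simpl in H; auto.
  - exfalso. apply (m_not_lt_zero (numeral l)). rewrite H. apply m_lt_succ.
  - exfalso. apply (m_not_lt_zero (numeral k)). rewrite <- H. apply m_lt_succ.
  - f_equal. apply IHk. now apply m_add_cancel in H.
Qed.

Fixpoint tuple (k : nat) (e : env) : M :=
  match k with O => 0 | S k => pair (e 0%nat) (tuple k (fun i => e (S i))) end.

(** The matrix is Delta, so an index yields a Sigma relation in normal form. Every sufficiently long
    tuple must be served, because a quantifier lengthens the tuple by one entry. *)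
Definition universal (C : class) : Prop := exists D : M -> M -> M -> Prop, rel3 (delta C) D /\
  forall P, C P -> exists k0, forall k, (k0 <= k)%nat -> exists i, forall e,
    P e <-> exists y, D i (tuple k e) y.

(** Positive formulas without compound terms. Evaluation of terms is traded for existential
    quantifiers, so a truth certificate deals only with atomic facts about entries of a tuple. *)
Inductive flat_rel : class :=
| flat_nth a c : flat_rel (fun e => e a = c)
| flat_add a b c : flat_rel (fun e => e a + e b = e c)
| flat_mul a b c : flat_rel (fun e => e a * e b = e c)
| flat_lt a b : flat_rel (fun e => e a < e b)
| flat_and P Q : flat_rel P -> flat_rel Q -> flat_rel (fun e => P e /\ Q e)
| flat_or P Q : flat_rel P -> flat_rel Q -> flat_rel (fun e => P e \/ Q e)
| flat_ex P : flat_rel P -> flat_rel (fun e => exists y, P (scons y e))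
| flat_all a P : flat_rel P -> flat_rel (fun e => forall y, y < e a -> P (scons y e)).

Lemma flat_rel_ren P : flat_rel P -> forall rho : nat -> nat, flat_rel (fun e => P (fun i => e (rho i))).
Proof.
  assert (F : forall (rho : nat -> nat) (y : M) e, scons y (fun i => e (rho i)) =
    fun i => scons y e (match i with O => O | S i => S (rho i) end)).
  { intros. extensionality i. now destruct i. }
  induction 1; intro rho; try now constructor.
  - apply (class_ext flat_rel) with (fun e => exists y, P (fun i => scons y e (match i with O => O | S i => S (rho i) end))).
    + intro e. split; intros [y Hy]; exists y; [rewrite <- (F rho y e)|rewrite (F rho y e)]; auto.
    + apply (flat_ex (fun e => P (fun i => e (match i with O => O | S i => S (rho i) end)))); apply IHflat_rel.
  - apply (class_ext flat_rel) with (fun e => forall y, y < e (rho a) -> P (fun i => scons y e (match i with O => O | S i => S (rho i) end))).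
    + intro e. split; intros K y L; generalize (K y L); [rewrite <- (F rho y e)|rewrite (F rho y e)]; auto.
    + apply (flat_all (rho a) (fun e => P (fun i => e (match i with O => O | S i => S (rho i) end)))); apply IHflat_rel.
Qed.

(** The renaming that puts the value of a graph into slot [d] and lets its arguments start at slot
    [i]. *)
Definition shift_above (d : nat) (i : nat) (j : nat) : nat := match j with O => d | S j => (i + j)%nat end.

Lemma flat_rel_graph t : term_fun t -> flat_rel (fun e => t (fun i => e (S i)) = e 0%nat).
Proof.
  assert (B : forall s t (op : M -> M -> M), flat_rel (fun e => s (fun i => e (S i)) = e 0%nat) ->
     flat_rel (fun e => t (fun i => e (S i)) = e 0%nat) ->
     flat_rel (fun e => op (e 1%nat) (e 0%nat) = e 2%nat) ->
     flat_rel (fun e => op (s (fun i => e (S i))) (t (fun i => e (S i))) = e 0%nat)).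
  { intros s u op H1 H2 H3.
    apply (flat_rel_ren _) with (rho := shift_above 1 3) in H1.
    apply (flat_rel_ren _) with (rho := shift_above 0 3) in H2.
    apply (class_ext flat_rel) with (2 := flat_ex _ (flat_ex _ (flat_and _ _ (flat_and _ _ H1 H2) H3))).
    intro e. simpl. split.
    - intro H. eexists _, _. eauto.
    - intros [x [y [[H1' H2'] H]]]. rewrite <- H1', <- H2' in H. exact H. }
  induction 1 as [i|c|s t Hs IHs Ht IHt|s t Hs IHs Ht IHt].
  (* There is no equality between two variables among the atoms, so it is expressed by adding a
     variable whose value is 0. *)
  - apply (class_ext flat_rel) with (2 := flat_ex _ (flat_and _ _ (flat_nth 0 0) (flat_add (S (S i)) 0 1))).
    intro e. simpl. split.
    + intro H. exists 0. split; auto. rewrite H. ring.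
    + intros [y [-> H]]. rewrite <- H. ring.
  - apply (class_ext flat_rel) with (2 := flat_nth 0 c). intro e. split; congruence.
  - apply B; auto. apply flat_add.
  - apply B; auto. apply flat_mul.
Qed.

Lemma delta0_flat P : delta0_rel P -> flat_rel P.
Proof.
  induction 1 as [s t Hs Ht|s t Hs Ht| | |t P Ht HP IH|t P Ht HP IH]; try now constructor.
  - apply (class_ext flat_rel) with (2 := flat_ex _ (flat_and _ _ (flat_rel_graph s Hs) (flat_rel_graph t Ht))).
    intro e. simpl. split; [eauto|]. intros [y [H1 H2]]. exact (eq_trans H1 (eq_sym H2)).
  - pose proof (flat_rel_ren _ (flat_rel_graph s Hs) (shift_above 1 2)) as H1.
    pose proof (flat_rel_ren _ (flat_rel_graph t Ht) (shift_above 0 2)) as H2.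
    apply (class_ext flat_rel) with (2 := flat_ex _ (flat_ex _ (flat_and _ _ (flat_and _ _ H1 H2) (flat_lt 1 0)))).
    intro e. simpl. split.
    + intro H. eexists _, _. eauto.
    + intros [x [y [[K1 K2] H]]]. rewrite <- K1, <- K2 in H. exact H.
  - apply (flat_rel_ren _) with (rho := shift_above 0 2) in IH.
    apply (class_ext flat_rel) with (2 := flat_ex _ (flat_and _ _ (flat_rel_graph t Ht) (flat_ex _ (flat_and _ _ (flat_lt 0 1) IH)))).
    assert (F : forall (x y : M) e, (fun i => scons x (scons y e) (shift_above 0 2 i)) = scons x e).
    { intros. extensionality i. now destruct i. }
    intro e. simpl. split.
    + intros [x [L Hx]]. eexists. split; eauto. exists x. split; auto. now rewrite F.
    + intros [y [Hy [x [L Hx]]]]. rewrite F in Hx. rewrite <- Hy in L. exists x. split; [exact L|exact Hx].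
  - apply (flat_rel_ren _) with (rho := shift_above 0 2) in IH.
    apply (class_ext flat_rel) with (2 := flat_ex _ (flat_and _ _ (flat_rel_graph t Ht) (flat_all 0 _ IH))).
    assert (F : forall (x y : M) e, (fun i => scons x (scons y e) (shift_above 0 2 i)) = scons x e).
    { intros. extensionality i. now destruct i. }
    intro e. simpl. split.
    + intros K. eexists. split; eauto. intros x L. rewrite F. auto.
    + intros [y [Hy K]] x L. rewrite <- Hy in K. specialize (K x L). now rewrite F in K.
Qed.

(** * Truth certificates *)

Definition nth_ix (a v : M) : M := pair (numeral 0) (pair a v).

Definition just_nth (B : M) (X : M -> Prop) (i x : M) : Prop :=
  exists a, a <= B /\ exists v, v <= B /\ exists y, y <= B /\ exists x', x' <= B /\
    i = nth_ix a v /\ x = pair y x' /\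
    ((a = 0 /\ y = v) \/ (exists a', a' <= B /\ (a = a' + 1 /\ X (pair (nth_ix a' v) x')))).

Definition just_op (B : M) (X : M -> Prop) (i x : M) : Prop :=
  exists t, t <= B /\ exists a, a <= B /\ exists b, b <= B /\ exists c, c <= B /\
  exists u, u <= B /\ exists v, v <= B /\ exists w, w <= B /\
    i = pair (numeral 1) (pair t (pair a (pair b c))) /\
    X (pair (nth_ix a u) x) /\ X (pair (nth_ix b v) x) /\ X (pair (nth_ix c w) x) /\
    ((t = numeral 0 /\ u + v = w) \/ (t = numeral 1 /\ u * v = w) \/ (t = numeral 2 /\ u < v)).

Definition just_and (B : M) (X : M -> Prop) (i x : M) : Prop :=
  exists j, j <= B /\ exists l, l <= B /\ i = pair (numeral 2) (pair j l) /\ X (pair j x) /\ X (pair l x).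

Definition just_or (B : M) (X : M -> Prop) (i x : M) : Prop :=
  exists j, j <= B /\ exists l, l <= B /\ i = pair (numeral 3) (pair j l) /\ (X (pair j x) \/ X (pair l x)).

Definition just_ex (B : M) (X : M -> Prop) (i x : M) : Prop :=
  exists j, j <= B /\ exists y, y <= B /\ i = pair (numeral 4) j /\ X (pair j (pair y x)).

Definition just_all (B : M) (X : M -> Prop) (i x : M) : Prop :=
  exists a, a <= B /\ exists j, j <= B /\ exists v, v <= B /\ i = pair (numeral 5) (pair a j) /\
    X (pair (nth_ix a v) x) /\ forall y, y < v -> X (pair j (pair y x)).

(* [just B X i x]: the fact "formula i holds of the tuple x" follows in one step
   from facts in X; B bounds the quantifiers, which keeps it Delta_0.  A fact with
   index nth_ix a v says that the a-th entry of the tuple is v. *)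
Definition just (B : M) (X : M -> Prop) (i x : M) : Prop :=
  just_nth B X i x \/ just_op B X i x \/ just_and B X i x \/ just_or B X i x \/ just_ex B X i x \/ just_all B X i x.

(* A set is coded together with a strict upper bound, since a bare code may have
   spurious large elements. *)
Definition in_set (q W : M) : Prop :=
  exists u, u <= W /\ exists s, s <= W /\ W = pair u s /\ q < u /\ in_code q s.

(** No order on the facts is demanded. Soundness uses recursion on the formula outside the model,
    and inverting a justification leads to an immediate subformula or a shorter tuple. *)
Definition good (W : M) : Prop := forall p, p < W -> in_set p W ->
  exists i, i <= W /\ exists x, x <= W /\ p = pair i x /\ just W (fun q => in_set q W) i x.

Definition certified_by (i x W : M) : Prop := good W /\ in_set (pair i x) W.
Definition certified (i x : M) : Prop := exists W, certified_by i x W.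

Lemma just_mono B B' (X X' : M -> Prop) i x : B <= B' -> (forall q, X q -> X' q) -> just B X i x -> just B' X' i x.
Proof.
  intros LB HX H.
  assert (T : forall z, z <= B -> z <= B') by (intros; now apply m_le_trans with B).
  destruct H as [H|[H|[H|[H|[H|H]]]]].
  - left. destruct H as [a [La [v [Lv [y [Ly [x' [Lx [H1 [H2 H]]]]]]]]]].
    exists a; split; auto. exists v; split; auto. exists y; split; auto. exists x'; split; auto.
    split; auto. split; auto. destruct H as [H|[a' [L [Ha H]]]]; [auto|right]. exists a'. auto.
  - right; left. destruct H as [t [Lt [a [La [b [Lb [c [Lc [u [Lu [v [Lv [w [Lw [H1 [H2 [H3 [H4 H]]]]]]]]]]]]]]]]]].
    exists t; split; auto. exists a; split; auto. exists b; split; auto. exists c; split; auto.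
    exists u; split; auto. exists v; split; auto. exists w; split; auto. repeat (split; auto).
  - do 2 right; left. destruct H as [j [Lj [l [Ll [H1 [H2 H3]]]]]].
    exists j; split; auto. exists l; split; auto.
  - do 3 right; left. destruct H as [j [Lj [l [Ll [H1 H2]]]]].
    exists j; split; auto. exists l; split; auto. split; auto. destruct H2; auto.
  - do 4 right; left. destruct H as [j [Lj [l [Ll [H1 H2]]]]].
    exists j; split; auto. exists l; split; auto.
  - do 5 right. destruct H as [a [La [j [Lj [v [Lv [H1 [H2 H3]]]]]]]].
    exists a; split; auto. exists j; split; auto. exists v; split; auto.
Qed.

Lemma in_set_lt q W : in_set q W -> q < W.
Proof. intros [u [L [s [_ [_ [H _]]]]]]. now apply m_lt_le_trans with u. Qed.

Lemma in_set_def (C : class) {HC : closed C} : rel2 C in_set.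
Proof. unfold rel2, in_set. definable. Qed.
Hint Resolve in_set_def : rel.

Lemma good_def (C : class) {HC : closed C} : rel1 (delta C) good.
Proof.
  unfold rel1, good, just, just_nth, just_op, just_and, just_or, just_ex, just_all, nth_ix. definable.
Qed.
Hint Resolve good_def : rel.

Lemma certified_by_def (C : class) {HC : closed C} : rel3 (delta C) certified_by.
Proof. unfold rel3, certified_by. definable. Qed.
Hint Resolve certified_by_def : rel.

Section Certificates.
Context (Sg : class) {HA : arena Sg}.

Lemma set_code u P : rel1 (delta Sg) P -> exists W, u <= W /\ forall q, in_set q W <-> q < u /\ P q.
Proof.
  intro HP. destruct (comprehension Sg u P (delta2_delta Sg _ HP)) as [s Hs].
  exists (pair u s). split. apply pair_le_l. intro q. split.
  - intros [u' [_ [s' [_ [H [L K]]]]]]. apply pair_inj in H. destruct H as [<- <-]. split; auto. now apply Hs.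
  - intros [L K]. exists u. split. apply pair_le_l. exists s. split. apply pair_le_r. split; auto. split; auto. now apply Hs.
Qed.

Lemma good_just W i x : good W -> in_set (pair i x) W -> just W (fun q => in_set q W) i x.
Proof.
  intros G H. destruct (G _ (in_set_lt _ _ H) H) as [i' [_ [x' [_ [K J]]]]].
  apply pair_inj in K. destruct K as [-> ->]. auto.
Qed.

(** The new certificate is the union of all good sets below [B] together with the new fact; it is
    good because [just] is monotone. Merging all of them at once handles even a nonstandard number
    of premises. *)
Lemma certified_close i x B :
  (forall W, B <= W -> (forall w q, w < B -> good w -> in_set q w -> in_set q W) -> just W (fun q => in_set q W) i x) ->
  certified i x.
Proof.
  intro H. set (p := pair i x).
  destruct (set_code (B + p + 1) (fun q => (exists w, w < B /\ good w /\ in_set q w) \/ q = p)) as [W [LW HW]].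
  { unfold rel1. definable. }
  assert (LB : B <= W).
  { apply m_le_trans with (2 := LW). apply m_le_iff. exists (p+1). ring. }
  assert (LP : p <= W).
  { apply m_le_trans with (2 := LW). apply m_le_iff. exists (B+1). ring. }
  assert (K : forall w q, w < B -> good w -> in_set q w -> in_set q W).
  { intros w q L G Hq. apply HW. split; eauto. apply in_set_lt in Hq. apply m_lt_le_trans with B.
    now apply m_lt_trans with w. apply m_le_iff. exists (p+1). ring. }
  exists W. split.
  - intros q _ Hq. apply HW in Hq. destruct Hq as [_ [[w [L [G Hq]]]|Hq]].
    + destruct (G q (in_set_lt _ _ Hq) Hq) as [j [Lj [y [Ly [Ep J]]]]].
      assert (LwW : w <= W) by (apply m_le_trans with B; auto; now left).
      exists j. split. now apply m_le_trans with w. exists y. split. now apply m_le_trans with w.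
      split; auto. apply just_mono with (3 := J); auto. intros r Hr. now apply K with w.
    + subst q. exists i. split.
      { apply m_le_trans with p; auto. apply pair_le_l. }
      exists x. split; auto.
      { apply m_le_trans with p; auto. apply pair_le_r. }
  - apply HW. split; auto. change (p < B + p + 1). apply m_lt_iff. exists B. ring.
Qed.

Ltac tag_absurd :=
  exfalso; unfold nth_ix in *; repeat match goal with
  | H : pair _ _ = pair _ _ |- _ => apply pair_inj in H; destruct H
  end; match goal with H : numeral _ = numeral _ |- _ => apply numeral_inj in H; discriminate H end.

Ltac inv_pairs :=
  unfold nth_ix in *; repeat match goal with
  | H : pair _ _ = pair _ _ |- _ => apply pair_inj in H; destruct H
  end; subst.

Ltac certified_cases H :=
  let W := fresh "W" in let G := fresh "G" in
  destruct H as [W [G H]]; apply good_just in H; [|exact G];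
  destruct H as [H|[H|[H|[H|[H|H]]]]];
  unfold just_nth, just_op, just_and, just_or, just_ex, just_all in H;
  decompose [ex and] H; clear H; try solve [tag_absurd]; inv_pairs.

Ltac lesum := solve [repeat first [apply m_le_refl | apply m_le_add_l | eapply m_le_trans; [|apply m_le_add_r]]].

Lemma certified_in W i x : good W -> in_set (pair i x) W -> certified i x.
Proof. intros. exists W. now split. Qed.

Lemma certified_nth_zero v y x : certified (nth_ix 0 v) (pair y x) <-> y = v.
Proof.
  split.
  - intros H. certified_cases H.
    match goal with K : _ \/ _ |- _ => destruct K as [[_ K1]|[a' [_ [K1 _]]]] end; auto.
    exfalso. apply (m_not_lt_zero a'). rewrite K1. apply m_lt_succ.
  - intros <-. apply certified_close with (y + x). intros W L _. left.
    assert (T : forall z, z <= y + x -> z <= W) by (intros; now apply m_le_trans with (y + x)).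
    exists 0. split. apply m_zero_le. exists y. split. apply T; lesum. exists y. split. apply T; lesum.
    exists x. split. apply T; lesum. auto.
Qed.

Lemma certified_nth_succ a v y x : certified (nth_ix (a + 1) v) (pair y x) <-> certified (nth_ix a v) x.
Proof.
  split.
  - intros H. certified_cases H.
    match goal with K : _ \/ _ |- _ => destruct K as [[K1 _]|[a' [_ [K1 K2]]]] end.
    + exfalso. apply (m_not_lt_zero a). rewrite <- K1. apply m_lt_succ.
    + apply m_add_cancel in K1. subst a'. now apply certified_in with W.
  - intros [w [G H]]. set (B := (a + 1) + a + v + y + x + w + 1). apply certified_close with B.
    intros W L HW. left.
    assert (T : forall z, z <= B -> z <= W) by (intros; now apply m_le_trans with B).
    exists (a + 1). split. apply T; unfold B; lesum. exists v. split. apply T; unfold B; lesum.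
    exists y. split. apply T; unfold B; lesum. exists x. split. apply T; unfold B; lesum.
    split; auto. split; auto. right. exists a. split. apply T; unfold B; lesum. split; auto.
    apply HW with w; auto. unfold B. apply m_lt_succ_le. lesum.
Qed.

Lemma certified_nth_var a k v e : (a < k)%nat -> certified (nth_ix (numeral a) v) (tuple k e) <-> e a = v.
Proof.
  revert k e. induction a; intros [|k] e L; try lia; simpl.
  - apply certified_nth_zero.
  - rewrite certified_nth_succ. apply (IHa k (fun i => e (S i))). lia.
Qed.

Lemma certified_op (t a b c x u v w : M) :
  (forall u', certified (nth_ix a u') x <-> u = u') ->
  (forall u', certified (nth_ix b u') x <-> v = u') ->
  (forall u', certified (nth_ix c u') x <-> w = u') ->
  certified (pair (numeral 1) (pair t (pair a (pair b c)))) x <->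
  ((t = numeral 0 /\ u + v = w) \/ (t = numeral 1 /\ u * v = w) \/ (t = numeral 2 /\ u < v)).
Proof.
  intros Ha Hb Hc. split.
  - intros H. certified_cases H.
    repeat match goal with K : in_set (pair _ _) _ |- _ => apply (certified_in _ _ _ G) in K end.
    unfold nth_ix in *.
    repeat match goal with
    | F : forall u', certified (pair _ (pair ?a u')) _ <-> _, K : certified (pair _ (pair ?a _)) _ |- _ =>
       apply F in K; subst end. auto.
  - intro H. destruct (proj2 (Ha u) eq_refl) as [w1 [G1 H1]].
    destruct (proj2 (Hb v) eq_refl) as [w2 [G2 H2]]. destruct (proj2 (Hc w) eq_refl) as [w3 [G3 H3]].
    set (B := t + a + b + c + u + v + w + w1 + w2 + w3 + 1). apply certified_close with B.
    intros W L HW. right; left.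
    assert (T : forall z, z <= B -> z <= W) by (intros; now apply m_le_trans with B).
    exists t. split. apply T; unfold B; lesum. exists a. split. apply T; unfold B; lesum.
    exists b. split. apply T; unfold B; lesum. exists c. split. apply T; unfold B; lesum.
    exists u. split. apply T; unfold B; lesum. exists v. split. apply T; unfold B; lesum.
    exists w. split. apply T; unfold B; lesum. split; auto.
    split. apply HW with w1; auto. unfold B. apply m_lt_succ_le. lesum.
    split. apply HW with w2; auto. unfold B. apply m_lt_succ_le. lesum.
    split; auto. apply HW with w3; auto. unfold B. apply m_lt_succ_le. lesum.
Qed.

Lemma certified_and j l x : certified (pair (numeral 2) (pair j l)) x <-> certified j x /\ certified l x.
Proof.
  split.
  - intros H. certified_cases H. eauto using certified_in.
  - intros [[w [G H]] [w' [G' H']]]. set (B := j + l + w + w' + 1). apply certified_close with B.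
    intros W L HW. do 2 right; left.
    assert (T : forall z, z <= B -> z <= W) by (intros; now apply m_le_trans with B).
    exists j. split. apply T; unfold B; lesum. exists l. split. apply T; unfold B; lesum. split; auto.
    split. apply HW with w; auto. unfold B. apply m_lt_succ_le. lesum.
    apply HW with w'; auto. unfold B. apply m_lt_succ_le. lesum.
Qed.

Lemma certified_or j l x : certified (pair (numeral 3) (pair j l)) x <-> certified j x \/ certified l x.
Proof.
  split.
  - intros H. certified_cases H. match goal with K : _ \/ _ |- _ => destruct K end; eauto using certified_in.
  - intros H. assert (K : exists w, good w /\ (in_set (pair j x) w \/ in_set (pair l x) w)).
    { destruct H as [[w [? ?]]|[w [? ?]]]; exists w; auto. }
    destruct K as [w [G K]]. set (B := j + l + w + 1). apply certified_close with B.
    intros W L HW. do 3 right; left.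
    assert (T : forall z, z <= B -> z <= W) by (intros; now apply m_le_trans with B).
    exists j. split. apply T; unfold B; lesum. exists l. split. apply T; unfold B; lesum. split; auto.
    assert (w < B) by (unfold B; apply m_lt_succ_le; lesum).
    destruct K; [left|right]; apply HW with w; auto.
Qed.

Lemma certified_ex j x : certified (pair (numeral 4) j) x <-> exists y, certified j (pair y x).
Proof.
  split.
  - intros H. certified_cases H. eauto using certified_in.
  - intros [y [w [G H]]]. set (B := j + y + w + 1). apply certified_close with B.
    intros W L HW. do 4 right; left.
    assert (T : forall z, z <= B -> z <= W) by (intros; now apply m_le_trans with B).
    exists j. split. apply T; unfold B; lesum. exists y. split. apply T; unfold B; lesum. split; auto.
    apply HW with w; auto. unfold B. apply m_lt_succ_le. lesum.
Qed.

(** Collection bounds the certificates of all instances below [v], after which they can be merged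
    into one. *)
Lemma certified_all a j v x : (forall u, certified (nth_ix a u) x <-> v = u) ->
  certified (pair (numeral 5) (pair a j)) x <-> forall y, y < v -> certified j (pair y x).
Proof.
  intro Ha. split.
  - intros H. certified_cases H.
    repeat match goal with K : in_set (pair _ _) _ |- _ => apply (certified_in _ _ _ G) in K end.
    unfold nth_ix in *.
    repeat match goal with
    | F : forall u', certified (pair _ (pair ?a u')) _ <-> _, K : certified (pair _ (pair ?a _)) _ |- _ =>
       apply F in K; subst end. eauto using certified_in.
  - intro H. destruct (proj2 (Ha v) eq_refl) as [w [G Hw]].
    destruct (collects_rel Sg (fun w y => certified_by j (pair y x) w) (collects_base Sg)) with (a := v) as [b Hb].
    { apply delta_rel2. unfold rel2. definable. }
    { auto. }
    set (B := a + j + v + w + b + 1). apply certified_close with B.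
    intros W L HW. do 5 right.
    assert (T : forall z, z <= B -> z <= W) by (intros; now apply m_le_trans with B).
    exists a. split. apply T; unfold B; lesum. exists j. split. apply T; unfold B; lesum.
    exists v. split. apply T; unfold B; lesum. split; auto. split.
    { apply HW with w; auto. unfold B. apply m_lt_succ_le. lesum. }
    intros y Ly. destruct (Hb y Ly) as [w' [Lw' [G' H']]]. apply HW with w'; auto.
    apply m_lt_le_trans with b; auto. unfold B. lesum.
Qed.

Lemma flat_rel_cert P : flat_rel P -> exists k0, forall k, (k0 <= k)%nat -> exists i, forall e,
  P e <-> certified i (tuple k e).
Proof.
  assert (V : forall a k e, (a < k)%nat -> forall u, certified (nth_ix (numeral a) u) (tuple k e) <-> e a = u).
  { intros. now apply certified_nth_var. }
  induction 1 as [a c|a b c|a b c|a b|P Q _ [k0 HP] _ [l0 HQ]|P Q _ [k0 HP] _ [l0 HQ]|P _ [k0 HP]|a P _ [k0 HP]].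
  - exists (S a). intros k L. exists (nth_ix (numeral a) c). intro e. now rewrite certified_nth_var.
  - exists (S (a + b + c)). intros k L. exists (pair (numeral 1) (pair (numeral 0) (pair (numeral a) (pair (numeral b) (numeral c))))).
    intro e. rewrite (certified_op _ _ _ _ _ (e a) (e b) (e c)) by (apply V; lia).
    split; [auto|]. intros [[_ ?]|[[H _]|[H _]]]; auto; apply numeral_inj in H; discriminate.
  - exists (S (a + b + c)). intros k L. exists (pair (numeral 1) (pair (numeral 1) (pair (numeral a) (pair (numeral b) (numeral c))))).
    intro e. rewrite (certified_op _ _ _ _ _ (e a) (e b) (e c)) by (apply V; lia).
    split; [auto|]. intros [[H _]|[[_ ?]|[H _]]]; auto; apply numeral_inj in H; discriminate.
  (* The third argument of an order fact is a dummy; repeating [a] keeps it within the tuple. *)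
  - exists (S (a + b)). intros k L. exists (pair (numeral 1) (pair (numeral 2) (pair (numeral a) (pair (numeral b) (numeral a))))).
    intro e. rewrite (certified_op _ _ _ _ _ (e a) (e b) (e a)) by (apply V; lia).
    split; [auto|]. intros [[H _]|[[H _]|[_ ?]]]; auto; apply numeral_inj in H; discriminate.
  - exists (k0 + l0)%nat. intros k L. destruct (HP k ltac:(lia)) as [i Hi], (HQ k ltac:(lia)) as [j Hj].
    exists (pair (numeral 2) (pair i j)). intro e. now rewrite certified_and, Hi, Hj.
  - exists (k0 + l0)%nat. intros k L. destruct (HP k ltac:(lia)) as [i Hi], (HQ k ltac:(lia)) as [j Hj].
    exists (pair (numeral 3) (pair i j)). intro e. now rewrite certified_or, Hi, Hj.
  - exists k0. intros k L. destruct (HP (S k) ltac:(lia)) as [i Hi].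
    exists (pair (numeral 4) i). intro e. rewrite certified_ex. split; intros [y Hy]; exists y; now apply (Hi (scons y e)).
  - exists (S a + k0)%nat. intros k L. destruct (HP (S k) ltac:(lia)) as [i Hi].
    exists (pair (numeral 5) (pair (numeral a) i)). intro e. rewrite (certified_all _ _ (e a)) by (apply V; lia).
    split; intros K y Ly; apply (Hi (scons y e)); exact (K y Ly).
Qed.

End Certificates.

(** The arena supplies codes and collection for building certificates, while the certificate
    relation itself is Delta_0; this places universality at the lowest level. *)
Lemma sigma1_universal (Sg : class) : arena Sg -> universal (sigma_rel 1).
Proof.
  intros HA. exists certified_by. split.
  - assert (H : rel3 (delta delta0_rel) certified_by) by definable_rel.
    split; apply exists_dummy; try typeclasses eauto; red; [apply H|].
    apply closed_not. apply H.
  - intros P [Q [HQ HE]]. apply (flat_rel_cert Sg).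
    assert (DQ : delta0_rel Q).
    { apply (class_ext delta0_rel (fun e => ~ ~ Q e)); [intro; tauto|exact (has_not_delta0_rel (fun e => ~ Q e) HQ)]. }
    apply (class_ext flat_rel) with (2 := flat_ex Q (delta0_flat Q DQ)). exact HE.
Qed.

(** A Sigma_{k+2} relation is existential over the complement of a Sigma_{k+1} one, so the new
    matrix negates the old universal relation with the witness as an additional tuple entry. *)
Lemma sigma_universal_succ k : closed (sigma_rel k : class) -> closed (sigma_rel (S k) : class) -> universal (sigma_rel (S k) : class) -> universal (sigma_rel (S (S k))).
Proof.
  intros Hc Hc' [D [HD HU]]. exists (fun i x y => ~ exists w, D i (pair y x) w). split.
  - assert (Hx : has_ex (sigma_rel (S k))) by (apply has_ex_exists; typeclasses eauto).
    assert (H : rel3 (sigma_rel (S k)) (fun i x y => exists w, D i (pair y x) w)).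
    { unfold rel3. definable. }
    assert (H' : sigma_rel (S k) (fun e => ~ ~ exists w, D (e 0%nat) (pair (e 2%nat) (e 1%nat)) w)).
    { apply (class_ext (sigma_rel (S k))) with (2 := H). intro e. split; [apply NNPP|intros ? ?; contradiction]. }
    split.
    + apply (exists_dummy (dual (sigma_rel (S k))) (fun e => ~ exists w, D (e 0%nat) (pair (e 2%nat) (e 1%nat)) w)). exact H'.
    + apply sigma_rel_succ. exact H'.
  - intros P [Q [HQ HE]]. destruct (HU _ HQ) as [k0 Hk0]. exists k0. intros l L.
    destruct (Hk0 (S l) ltac:(lia)) as [i Hi]. exists i. intro e. rewrite HE.
    split; intros [y Hy]; exists y.
    + intro N. apply (Hi (scons y e)) in N. auto.
    + apply NNPP. intro N. apply Hy. now apply (Hi (scons y e)).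
Qed.

Lemma sigma_universal (p : nat -> M) n : (forall x, exists i, p i = x) ->
  BSigma (S (S n)) M -> universal (sigma_rel (S n)).
Proof.
  intros Hp HB. cut (forall k, (k <= n)%nat -> universal (sigma_rel (S k))); auto.
  induction k; intro L.
  - apply (sigma1_universal (sigma_rel (S n))). eapply sigma_arena; eauto.
  - apply sigma_universal_succ; [eapply sigma_closed with (n := n)|eapply sigma_closed with (n := n)|apply IHk]; eauto; lia.
Qed.
End Universal.
#[export] Hint Resolve in_set_def good_def certified_by_def : rel.

(** * The low basis theorem *)

Section LowBasis.
Context {M : arith_str} {HM : PAminus M}.
Local Notation "0" := (zero M) : m_scope.
Local Notation "1" := (one M) : m_scope.
Add Ring M_ring7 : M_semiring.
Local Notation env := (nat -> M).
Local Notation class := ((env -> Prop) -> Prop).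

Lemma term_tuple k (tau : env -> env) : (forall i, term_fun (fun e => tau e i)) -> term_fun (fun e => tuple k (tau e)).
Proof.
  revert tau. induction k; intros tau H; simpl.
  - apply term_const.
  - apply term_pair; auto.
Qed.

Lemma tuple_agree k (e e' : env) : (forall i, (i < k)%nat -> e i = e' i) -> tuple k e = tuple k e'.
Proof.
  revert e e'. induction k; intros e e' H; simpl; auto.
  rewrite (H O) by lia. f_equal. apply IHk. intros; apply H; lia.
Qed.

Context (Sg : class) {HA : arena Sg}.
Variable D : M -> M -> M -> Prop.
Hypothesis HD : rel3 (delta Sg) D.
Hypothesis HU : forall P, Sg P -> exists k0, forall k, (k0 <= k)%nat -> exists i, forall e,
    P e <-> exists y, D i (tuple k e) y.
Hint Resolve HD : rel.

(* At stage u the part of s below u verifies the i-th Sigma_1 fact, i = (j,x). *)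
Definition verifies (u i s : M) : Prop := exists j, j <= i /\ exists x, x <= i /\ i = pair j x /\
  exists u', u' <= u /\ exists s', s' <= u /\ exists y, y <= u /\ agree u' s' s /\ D j (pair u' (pair s' x)) y.

Lemma verifies_def : rel3 (delta Sg) verifies.
Proof. unfold rel3, verifies. definable. Qed.
Hint Resolve verifies_def : rel.

Lemma agree_sym (u s t : M) : agree u s t -> agree u t s.
Proof. intros H i L. symmetry. now apply H. Qed.

Lemma agree_trans (u s t r : M) : agree u s t -> agree u t r -> agree u s r.
Proof. intros H K i L. rewrite (H i L). now apply K. Qed.

Lemma agree_le (u v s t : M) : u <= v -> agree v s t -> agree u s t.
Proof. intros L H i Li. apply H. now apply m_lt_le_trans with u. Qed.

Lemma verifies_mono (u v i s t : M) : u <= v -> agree u s t -> verifies u i s -> verifies v i t.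
Proof.
  intros L Ha [j [Lj [x [Lx [H [u' [Lu [s' [Ls [y [Ly [K HDy]]]]]]]]]]]].
  exists j; split; auto. exists x; split; auto. split; auto.
  exists u'; split. now apply m_le_trans with u. exists s'; split. now apply m_le_trans with u.
  exists y; split. now apply m_le_trans with u. split; auto. apply agree_trans with s; auto.
  now apply agree_le with u.
Qed.

Lemma verifies_intro (j x u s y u' s' : M) : u' <= u -> s' <= u -> y <= u -> agree u' s' s ->
  D j (pair u' (pair s' x)) y -> verifies u (pair j x) s.
Proof.
  intros. exists j. split. apply pair_le_l. exists x. split. apply pair_le_r. split; auto.
  exists u'. split; auto. exists s'. split; auto. exists y. auto.
Qed.

Lemma verifies_elim (j x u s : M) : verifies u (pair j x) s -> exists u' s' y, u' <= u /\ agree u' s' s /\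
  D j (pair u' (pair s' x)) y.
Proof.
  intros [j' [_ [x' [_ [H [u' [Lu [s' [Ls [y [Ly [K HDy]]]]]]]]]]]].
  apply pair_inj in H. destruct H as [<- <-]. eauto 10.
Qed.

(** [Tb u s] means that the node given by [s] below [u] has left the tree. A set belongs to the Pi_1
    class when none of its initial segments does so, and consistency says that every height has a
    live node. *)
Variable Tb : M -> M -> Prop.
Hypothesis Tb_def : rel2 (delta Sg) Tb.
Hypothesis Tb_mono : forall u v s t, u <= v -> agree u s t -> Tb u s -> Tb v t.
Hypothesis Tb_cons : forall u, exists s, ~ Tb u s.
Hint Resolve Tb_def : rel.

Definition acceptable (i z u s : M) : Prop :=
  ~ Tb u s /\ ~ verifies u i s /\ forall j, j < i -> (in_code j z -> ~ verifies u j s).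

Lemma acceptable_def : rel4 (delta Sg) acceptable.
Proof. unfold rel4, acceptable. definable. Qed.
Hint Resolve acceptable_def : rel.

Lemma acceptable_mono i z u s v t : v <= u -> agree v s t -> acceptable i z u s -> acceptable i z v t.
Proof.
  intros L Ha [H1 [H2 H3]]. apply agree_sym in Ha. split; [|split].
  - intro H. apply H1. now apply (Tb_mono v u t s).
  - intro H. apply H2. now apply (verifies_mono v u i t s).
  - intros j Lj Hj H. apply (H3 j Lj Hj). now apply (verifies_mono v u j t s).
Qed.

Definition refuted_at (u i z : M) : Prop :=
  exists g, full_code u g /\ forall s, s < g -> ~ acceptable i z u s.

Lemma refuted_at_def : rel3 Sg refuted_at.
Proof. unfold rel3, refuted_at. definable. Qed.
Hint Resolve refuted_at_def : rel.

(** Compactness: a node of height [u] matters only through its elements below [u], and every such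
    node has a code below [g]. A statement about all nodes is thereby a Sigma statement. *)
Lemma refuted_at_iff u i z : refuted_at u i z <-> forall s, ~ acceptable i z u s.
Proof.
  split.
  - intros [g [Hg K]] s H. destruct (code_below Sg u g (fun x => in_code x s) Hg) as [t [Lt Ht]].
    { unfold rel1. definable. }
    apply (K t Lt). revert H. apply acceptable_mono. apply m_le_refl. intros x L. symmetry. auto.
  - intro H. destruct (full_code_total Sg u) as [g Hg]. exists g. auto.
Qed.

Definition refuted (i z : M) : Prop := exists u, refuted_at u i z.

Lemma refuted_def : rel2 (delta (sigma2 Sg)) refuted.
Proof. apply delta2_base; auto. unfold refuted. definable. Qed.
Hint Resolve refuted_def : rel.

Lemma refuted_agree i z z' : agree i z z' -> refuted i z -> refuted i z'.
Proof.
  intros Ha [u H]. exists u. rewrite refuted_at_iff in *. intros s [H1 [H2 H3]].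
  apply (H s). split; auto. split; auto. intros j L Hj. apply H3; auto. now apply Ha.
Qed.

(* z decides, in order of priority, which of the first n Sigma_1(A) facts are to
   be kept false of the set A under construction. *)
Definition correct (n z : M) : Prop := forall i, i < n -> (in_code i z <-> ~ refuted i z).

Lemma correct_def : rel2 (delta (sigma2 Sg)) correct.
Proof. unfold rel2, correct. definable. Qed.
Hint Resolve correct_def : rel.

Lemma correct_le n m z : m <= n -> correct n z -> correct m z.
Proof. intros L H i Li. apply H. now apply m_lt_le_trans with m. Qed.

(** At a least disagreement the two codes agree on all earlier decisions and hence pose the same
    question. *)
Lemma correct_unique n z z' : correct n z -> correct n z' -> agree n z z'.
Proof.
  intros H H'. apply NNPP. intro N. apply not_all_ex_not in N. destruct N as [i Hi].
  destruct (least_base Sg (fun i => ~ (i < n -> (in_code i z <-> in_code i z'))) i) as [j [Hj Hm]]; auto.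
  { apply delta_rel1. unfold rel1. definable. }
  apply Hj. intro L. rewrite (H j L), (H' j L).
  assert (Ha : agree j z z').
  { intros l Ll. apply NNPP. intro Nl. apply (Hm l Ll). intro K. apply Nl, K. now apply m_lt_trans with j. }
  split; intros F K; apply F; revert K; apply refuted_agree; auto using agree_sym.
Qed.

(** The bound [g], fixed in advance for all stages up to [n], keeps the induction statement Delta_2;
    with an unbounded [z] it would only be Sigma_2. *)
Lemma correct_exists n : exists z, correct n z.
Proof.
  destruct (full_code_total Sg n) as [g Hg].
  cut (forall m, m <= n -> exists z, z < g /\ correct m z).
  { intro H. destruct (H n (m_le_refl n)) as [z [_ ?]]. eauto. }
  apply (induction2 Sg (fun m => m <= n -> exists z, z < g /\ correct m z)).
  - unfold rel1. definable.
  - intros _. destruct (code_below Sg n g (fun _ => True) Hg) as [z [L _]].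
    { unfold rel1. definable. }
    exists z. split; auto. intros i Li. now apply m_not_lt_zero in Li.
  - intros m IH L. assert (Lm : m < n) by now apply m_succ_le_lt.
    destruct IH as [z [Lz Hz]]; [now left|].
    destruct (code_below Sg n g (fun i => (i < m /\ in_code i z) \/ (i = m /\ ~ refuted m z)) Hg) as [z' [Lz' Hz']].
    { unfold rel1. definable. }
    exists z'. split; auto.
    assert (Ha : agree m z z').
    { intros i Li. rewrite Hz' by now apply m_lt_trans with m. split; [auto|].
      intros [[_ ?]|[-> _]]; auto. now apply m_lt_irrefl in Li. }
    intros i Li. apply m_lt_succ_cases in Li. destruct Li as [Li| ->].
    + rewrite <- (Ha i Li), (Hz i Li).
      assert (Hi : agree i z z') by (apply agree_le with m; auto; now left).
      split; intros F K; apply F; revert K; apply refuted_agree; auto using agree_sym.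
    + rewrite Hz' by auto. split.
      * intros [[K _]|[_ K]]; [now apply m_lt_irrefl in K|]. intro F. apply K. revert F. apply refuted_agree. now apply agree_sym.
      * intro F. right. split; auto. intro K. apply F. revert K. now apply refuted_agree.
Qed.

Definition suppressed (i : M) : Prop := exists z, correct i z /\ ~ refuted i z.

Lemma suppressed_correct n z i : correct n z -> i < n -> (suppressed i <-> in_code i z).
Proof.
  intros H L. rewrite (H i L). assert (Hi : correct i z) by (apply correct_le with n; auto; now left).
  split.
  - intros [z' [Hz' F]] K. apply F. revert K. apply refuted_agree. now apply correct_unique.
  - intro. exists z. auto.
Qed.

Lemma not_suppressed i : ~ suppressed i <-> exists z, correct i z /\ refuted i z.
Proof.
  split.
  - intro H. destruct (correct_exists i) as [z Hz]. exists z. split; auto. apply NNPP. intro F. apply H. now exists z.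
  - intros [z [Hz F]] [z' [Hz' F']]. apply F'. revert F. apply refuted_agree. now apply correct_unique.
Qed.

(** Correct decisions exist and agree with each other, so both the predicate and its negation can be
    stated by asserting some correct code. *)
Lemma suppressed_def : rel1 (delta (sigma2 Sg)) suppressed.
Proof.
  split.
  - unfold suppressed. definable.
  - apply (class_ext (sigma2 Sg)) with (fun e => exists z, correct (e 0%nat) z /\ refuted (e 0%nat) z).
    intro; apply not_suppressed. definable.
Qed.
Hint Resolve suppressed_def : rel.

Definition admissible (n z u s : M) : Prop := ~ Tb u s /\ forall j, j < n -> in_code j z -> ~ verifies u j s.

(** The greatest index below [n] that [z] keeps false carries the demands of all smaller ones, so
    its not being refuted supplies the node. If there is no such index, the tree alone supplies
    it. *)
Lemma admissible_exists n z u : correct n z -> exists s, admissible n z u s.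
Proof.
  intro H. destruct (classic (exists j, j < n /\ in_code j z)) as [[j [Lj Hj]]|K].
  - destruct (greatest2 Sg (fun j => in_code j z) n j) as [m [Hm [Lm Hmax]]]; auto.
    { unfold rel1. definable. }
    apply (H m Lm) in Hm.
    assert (T : exists s, acceptable m z u s).
    { apply NNPP. intro N1. apply Hm. exists u. apply refuted_at_iff. intros s Hs. eauto. }
    destruct T as [s [H1 [H2 H3]]]. exists s. split; auto. intros l Ll Hl.
    destruct (Hmax l Ll Hl) as [L| ->]; auto.
  - destruct (Tb_cons u) as [s Hs]. exists s. split; auto. intros l Ll Hl. exfalso. eauto.
Qed.

(** From the stage of refutation on, a live node that honours the earlier suppressions has no way to
    keep fact [i] false. *)
Lemma admissible_fail n z i u v s : correct n z -> i < n -> refuted_at u i z -> u <= v -> admissible n z v s -> verifies u i s.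
Proof.
  intros H L F Lu [H1 H2]. rewrite refuted_at_iff in F. apply NNPP. intro K. apply (F s).
  split; [|split]; auto.
  - intro T. apply H1. revert T. apply Tb_mono; auto. now intros x Lx.
  - intros j Lj Hj T. apply (H2 j); auto. now apply m_lt_trans with i. revert T. apply verifies_mono; auto. now intros x Lx.
Qed.

(** The last clause is uniform: one stage [v] serves every [x < u] and every set [s]. Up to
    agreement below [u], only the codes below [g] occur, so collection can bound the
    verifications. *)
Lemma mem_index : exists c : M -> M, term_fun (fun e => c (e 0%nat)) /\
  (forall x u s, verifies u (c x) s -> in_code x s) /\
  (forall u, exists v, forall x s, x < u -> in_code x s -> verifies v (c x) s).
Proof.
  destruct (HU (fun e => e 2%nat < e 0%nat /\ in_code (e 2%nat) (e 1%nat))) as [k0 H].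
  { definable. }
  destruct (H (S (S (S k0))) ltac:(lia)) as [i Hi].
  assert (F : forall u s x, x < u /\ in_code x s <-> exists y, D i (pair u (pair s (tuple (S k0) (scons x (fun _ => 0))))) y).
  { intros u s x. apply (Hi (scons u (scons s (scons x (fun _ => 0))))). }
  exists (fun x => pair i (tuple (S k0) (scons x (fun _ => 0)))). split; [|split].
  - apply term_pair; [apply term_const|]. apply (term_tuple (S k0) (fun e => scons (e 0%nat) (fun _ => 0))). definable.
  - intros x u s Hv. apply verifies_elim in Hv. destruct Hv as [u' [s' [y [Lu [Ha Hy]]]]].
    assert (K : x < u' /\ in_code x s') by (apply F; eauto). destruct K. now apply Ha.
  - intro u. destruct (full_code_total Sg u) as [g Hg].
    set (x' := fun x => tuple (S k0) (scons x (fun _ => 0))) in *.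
    assert (Hx' : term_fun (fun e => x' (e 0%nat))).
    { apply (term_tuple (S k0) (fun e => scons (e 0%nat) (fun _ => 0))). definable. }
    assert (D' : rel4 (delta Sg) (fun y u s x => D i (pair u (pair s (x' x))) y)).
    { unfold rel4. apply (closed_sub3 (delta Sg) D (fun _ => i) (fun e => pair (e 1%nat) (pair (e 2%nat) (x' (e 3%nat)))) (fun e => e 0%nat));
        [exact HD|apply term_const| |apply term_var].
      apply term_pair; [apply term_var|]. apply term_pair; [apply term_var|]. exact (term_sub _ (fun e i => e 3%nat) Hx' (fun _ => term_var 3)). }
    set (D4 := fun y u s x => D i (pair u (pair s (x' x))) y) in D'.
    (* Collection is used twice, here over the codes below [g] and then over the elements below
       [u]. *)
    assert (B : forall x, x < u -> exists w, forall s, s < g -> (in_code x s -> exists y, y < w /\ D4 y u s x)).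
    { intros x Lx.
      destruct (collects_rel Sg (fun y s => in_code x s -> D4 y u s x) (collects_base Sg)) with (a := g) as [b Hb].
      - unfold rel2. definable.
      - intros s _. destruct (classic (in_code x s)) as [K|K]; [|exists 0; tauto].
        destruct (proj1 (F u s x) (conj Lx K)) as [y Hy]. now exists y.
      - exists b. intros s Ls K. destruct (Hb s Ls) as [y [Ly Hy]]. exists y. split; auto. }
    destruct (collects_rel Sg (fun w x => forall s, s < g -> (in_code x s -> exists y, y < w /\ D4 y u s x)) (collects_base Sg)
      ltac:(unfold rel2; definable) u B) as [b Hb].
    exists (u + g + b). intros x s Lx Hs.
    destruct (code_below Sg u g (fun x => in_code x s) Hg) as [t [Lt Ht]].
    { unfold rel1. definable. }
    destruct (Hb x Lx) as [w [Lw K]]. destruct (K t Lt) as [y [Ly Hy]]; [now apply Ht|].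
    apply verifies_intro with (y := y) (u' := u) (s' := t); auto.
    + apply m_le_iff. exists (g + b). ring.
    + apply m_le_trans with g. now left. apply m_le_iff. exists (u + b). ring.
    + apply m_le_trans with b. left. now apply m_lt_trans with w. apply m_le_add_l.
Qed.

(** * The low path and the relations that are Sigma_1 in it *)

Section Path.
Variable c : M -> M.
Hypothesis c_tm : term_fun (fun e => c (e 0%nat)).
Hypothesis c_sound : forall x u s, verifies u (c x) s -> in_code x s.
Hypothesis c_complete : forall u, exists v, forall x s, x < u -> in_code x s -> verifies v (c x) s.

(* c x is the index of the fact "x belongs to the set". *)
Definition path (x : M) : Prop := ~ suppressed (c x).

Lemma term_c t : term_fun t -> term_fun (fun e : env => c (t e)).
Proof. intro H. exact (term_sub (fun e => c (e 0%nat)) (fun e i => t e) c_tm (fun _ => H)). Qed.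

Lemma path_def : rel1 (delta (sigma2 Sg)) path.
Proof.
  unfold path. apply (closed_not (C := delta (sigma2 Sg)) (fun e => suppressed (c (e 0%nat)))).
  apply (closed_sub1 (delta (sigma2 Sg)) suppressed (fun e => c (e 0%nat))); [apply suppressed_def|exact c_tm].
Qed.
Hint Resolve path_def : rel.

Definition codes_path (u s : M) : Prop := forall x, x < u -> (in_code x s <-> path x).

Lemma codes_path_def2 : rel2 (delta (sigma2 Sg)) codes_path.
Proof. unfold rel2, codes_path. definable. Qed.

Lemma codes_path_code u : exists s, codes_path u s.
Proof. apply (comprehension Sg u path path_def). Qed.

Lemma codes_path_agree u v s t : codes_path u s -> codes_path v t -> u <= v -> agree u s t.
Proof. intros H K L x Lx. rewrite (H x Lx), (K x); [tauto|]. now apply m_lt_le_trans with u. Qed.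

Lemma codes_path_of_agree u v s t : codes_path u s -> v <= u -> agree v t s -> codes_path v t.
Proof. intros H L K x Lx. rewrite (K x Lx). apply H. now apply m_lt_le_trans with v. Qed.

(** The decisions are taken far enough to cover [c x] for all [x < u]. A late admissible node omits
    [x] when [c x] is suppressed, since membership would by then be verified; otherwise it contains
    [x], since the fact has by then become unavoidable. Such nodes therefore agree with the path
    below [u]. *)
Lemma settle u i : exists n z v, correct n z /\ i < n /\ u <= v /\ forall s, admissible n z v s -> codes_path u s.
Proof.
  destruct (collects_rel Sg (fun y x => y = c x) (collects_base Sg)) with (a := u) as [b Hb].
  { unfold rel2. definable. now apply term_c, term_var. }
  { eauto. }
  assert (Lc : forall x, x < u -> c x < b).
  { intros x Lx. destruct (Hb x Lx) as [y [Ly ->]]. auto. }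
  set (n := b + i + 1).
  assert (Ln : forall x, x < u -> c x < n).
  { intros x Lx. apply m_lt_le_trans with b; auto. apply m_le_iff. exists (i + 1). unfold n. ring. }
  destruct (correct_exists n) as [z Hz].
  destruct (collects_rel Sg (fun w x => in_code (c x) z \/ refuted_at w (c x) z) (collects_base Sg)) with (a := u) as [w Hw].
  { unfold rel2. apply closed_or.
    - apply (closed_sub2 Sg in_code (fun e => c (e 1%nat)) (fun _ => z)); [definable_rel|apply term_c|]; definable.
    - apply (closed_sub3 Sg refuted_at (fun e => e 0%nat) (fun e => c (e 1%nat)) (fun _ => z)); [definable_rel| |apply term_c|]; definable. }
  { intros x Lx. destruct (classic (in_code (c x) z)) as [K|K]; [exists 0; auto|].
    rewrite (Hz (c x) (Ln x Lx)) in K. apply NNPP in K. destruct K as [w Hw]. exists w. auto. }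
  destruct (c_complete u) as [v Hv].
  exists n, z, (u + w + v). split; auto. split. { apply m_lt_iff. exists b. unfold n. ring. }
  split. { apply m_le_iff. exists (w + v). ring. }
  intros s Hs x Lx. unfold path. rewrite (suppressed_correct n z) by auto. split.
  - intros Hx Hc. destruct Hs as [_ Hs]. apply (Hs (c x)); auto.
    apply verifies_mono with (u := v) (s := s). apply m_le_add_l. now intros j Lj. auto.
  - intro K. destruct (Hw x Lx) as [w' [Lw [?|F]]]; [tauto|].
    apply (c_sound x w'). apply (admissible_fail n z _ w' (u + w + v)); auto.
    apply m_le_trans with w. now left. apply m_le_iff. exists (u + v). ring.
Qed.

Lemma path_avoids u s : codes_path u s -> ~ Tb u s.
Proof.
  intros H T. destruct (settle u 0) as [n [z [v [Hz [_ [Lv K]]]]]].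
  destruct (admissible_exists n z v Hz) as [t Ht]. pose proof (K t Ht) as At. destruct Ht as [Ht _].
  apply Ht. apply (Tb_mono u v s t); auto. apply codes_path_agree with u; auto using m_le_refl.
Qed.

Definition path_fact (i : M) : Prop := exists u s, codes_path u s /\ verifies u i s.

(** Lowness: the jump of the path is read off from the decisions. Late admissible nodes carry
    initial segments of the path; they avoid each suppressed fact and verify each of the others. *)
Lemma path_fact_iff i : path_fact i <-> ~ suppressed i.
Proof.
  split.
  - intros [u [s [Hs Hv]]] HN. destruct (settle u i) as [n [z [v [Hz [Li [Lv K]]]]]].
    destruct (admissible_exists n z v Hz) as [t Ht]. pose proof (K t Ht) as At. destruct Ht as [_ Ht].
    apply (Ht i Li). now apply (suppressed_correct n z). apply (verifies_mono u v i s t); auto.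
    apply codes_path_agree with u; auto using m_le_refl.
  - intro HN. apply not_suppressed in HN. destruct HN as [z0 [Hz0 [u F]]].
    destruct (settle u i) as [n [z [v [Hz [Li [Lv K]]]]]].
    destruct (admissible_exists n z v Hz) as [t Ht]. exists u, t. split; auto.
    apply (admissible_fail n z i u v); auto. rewrite refuted_at_iff in *. intros s [H1 [H2 H3]].
    apply (F s). split; auto. split; auto. intros j Lj Hj. apply H3; auto.
    apply (correct_unique i z0 z); auto. apply correct_le with n; auto. now left.
Qed.

(** The normal form of a relation Sigma_1 in the path: a Sigma relation applied to a code of some
    initial segment of the path. *)
Definition over_path : class := fun P => exists R, Sg R /\
  forall e, P e <-> exists u s, codes_path u s /\ R (scons u (scons s e)).

Lemma over_path_index R : Sg R -> exists k0, forall k, (k0 <= k)%nat -> exists i, forall e,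
  (exists u s, codes_path u s /\ R (scons u (scons s e))) <->
  exists u s, codes_path u s /\ exists y, D i (pair u (pair s (tuple k e))) y.
Proof.
  intro HR. destruct (HU R HR) as [k0 H]. exists k0. intros k L.
  destruct (H (S (S k)) ltac:(lia)) as [i Hi]. exists i. intro e.
  split; intros [u [s [Hs K]]]; exists u, s; split; auto; now apply (Hi (scons u (scons s e))).
Qed.

Lemma path_fact_pair i x : path_fact (pair i x) <-> exists u s, codes_path u s /\ exists y, D i (pair u (pair s x)) y.
Proof.
  split.
  - intros [u [s [Hs Hv]]]. apply verifies_elim in Hv. destruct Hv as [u' [s' [y [Lu [Ha Hy]]]]].
    exists u', s'. split; eauto. now apply codes_path_of_agree with u s.
  - intros [u [s [Hs [y Hy]]]]. set (v := u + s + y). destruct (codes_path_code v) as [t Ht].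
    exists v, t. split; auto. apply verifies_intro with y u s; auto.
    + apply m_le_iff. exists (s + y). unfold v. ring.
    + apply m_le_iff. exists (u + y). unfold v. ring.
    + apply m_le_add_l.
    + apply codes_path_agree with v; auto. apply m_le_iff. exists (s + y). unfold v. ring.
Qed.

Lemma over_path_fact P : over_path P -> exists k0, forall k, (k0 <= k)%nat -> exists i, forall e, P e <-> path_fact (pair i (tuple k e)).
Proof.
  intros [R [HR HE]]. destruct (over_path_index R HR) as [k0 H]. exists k0. intros k L.
  destruct (H k L) as [i Hi]. exists i. intro e. now rewrite HE, Hi, path_fact_pair.
Qed.

(** The universal relation turns any relation over the path into questions [path_fact] indexed by a
    term, so the decided jump answers them. *)
Lemma over_path_delta2 P : over_path P -> delta (sigma2 Sg) P.
Proof.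
  intro H. destruct (over_path_fact P H) as [k0 K]. destruct (K k0 (le_n _)) as [i Hi].
  apply (class_ext (delta (sigma2 Sg))) with (fun e => ~ suppressed (pair i (tuple k0 e))).
  - intro e. now rewrite Hi, path_fact_iff.
  - apply (closed_not (C := delta (sigma2 Sg)) (fun e => suppressed (pair i (tuple k0 e)))).
    apply (closed_sub1 _ suppressed (fun e => pair i (tuple k0 e))). apply suppressed_def.
    apply term_pair. apply term_const. apply (term_tuple k0 (fun e => e)). intro; apply term_var.
Qed.

Lemma over_path_intro (R : M -> M -> env -> Prop) : Sg (fun e => R (e 0%nat) (e 1%nat) (fun i => e (S (S i)))) ->
  over_path (fun e => exists u s, codes_path u s /\ R u s e).
Proof. intro H. exists (fun e => R (e 0%nat) (e 1%nat) (fun i => e (S (S i)))). split; auto. intro e. reflexivity. Qed.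

(** A matrix that persists to longer segments allows the segments used by different witnesses to be
    merged, as conjunction and bounded universal quantification require. *)
Lemma over_path_mono P : over_path P -> exists R, Sg R /\ (forall e, P e <-> exists u s, codes_path u s /\ R (scons u (scons s e))) /\
  forall u v s t e, u <= v -> agree u s t -> R (scons u (scons s e)) -> R (scons v (scons t e)).
Proof.
  intros [R [HR HE]].
  exists (fun e => exists u, u <= e 0%nat /\ exists s, agree u s (e 1%nat) /\ R (scons u (scons s (fun i => e (S (S i)))))).
  split; [|split].
  - definable.
  - intro e. rewrite HE. split; intros [u [s [Hs K]]].
    + exists u, s. split; auto. exists u. split. apply m_le_refl. exists s. split; [now intros x Lx|exact K].
    + destruct K as [u' [L [s' [Ha K]]]]. exists u', s'. split; [|exact K]. now apply codes_path_of_agree with u s.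
  - intros u v s t e L Ha [u' [L' [s' [Ha' K]]]]. exists u'. split. now apply m_le_trans with u.
    exists s'. split; [|exact K]. apply agree_trans with s; auto. now apply agree_le with u.
Qed.

Lemma over_path_base P : Sg P -> over_path P.
Proof.
  intro H. apply (class_ext over_path) with (fun e => exists u s, codes_path u s /\ P e).
  - intro e. destruct (codes_path_code 0) as [s Hs]. split; eauto. now intros [_ [_ [_ ?]]].
  - apply over_path_intro. definable.
Qed.

Lemma over_path_ex : has_ex over_path.
Proof.
  intros P [R [HR HE]].
  apply (class_ext over_path) with (fun e => exists u s, codes_path u s /\ exists x, R (scons u (scons s (scons x e)))).
  - intro e. split.
    + intros [x Hx]. apply HE in Hx. destruct Hx as [u [s [? ?]]]. eauto.
    + intros [u [s [? [x ?]]]]. exists x. apply HE. eauto.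
  - apply over_path_intro. definable.
Qed.

Instance over_path_cls : closed over_path.
Proof.
  split; intros.
  - apply over_path_base. now apply closed_eq.
  - apply over_path_base. now apply closed_lt.
  - destruct (over_path_mono _ H) as [R [HR [HE HM1]]], (over_path_mono _ H0) as [R' [HR' [HE' HM2]]].
    apply (class_ext over_path) with (fun e => exists u s, codes_path u s /\ (R (scons u (scons s e)) /\ R' (scons u (scons s e)))).
    + intro e. rewrite HE, HE'. split.
      * intros [[u [s [Hs K]]] [u' [s' [Hs' K']]]]. destruct (codes_path_code (u + u')) as [t Ht].
        pose proof (m_le_add_r u u'). pose proof (m_le_add_l u' u).
        exists (u + u'), t. split; auto. split.
        -- apply (HM1 u _ s); auto. now apply codes_path_agree with (u + u').
        -- apply (HM2 u' _ s'); auto. now apply codes_path_agree with (u + u').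
      * intros [u [s [Hs [? ?]]]]. eauto 10.
    + apply over_path_intro. definable.
  - destruct H as [R [HR HE]], H0 as [R' [HR' HE']].
    apply (class_ext over_path) with (fun e => exists u s, codes_path u s /\ (R (scons u (scons s e)) \/ R' (scons u (scons s e)))).
    + intro e. rewrite HE, HE'. split.
      * intros [[u [s [? ?]]]|[u [s [? ?]]]]; eauto 10.
      * intros [u [s [? [?|?]]]]; eauto 10.
    + apply over_path_intro. definable.
  - destruct H0 as [R [HR HE]].
    apply (class_ext over_path) with (fun e => exists u s, codes_path u s /\ exists x, x < t e /\ R (scons u (scons s (scons x e)))).
    + intro e. split.
      * intros [x [L Hx]]. apply HE in Hx. destruct Hx as [u [s [? ?]]]. eauto 10.
      * intros [u [s [? [x [? ?]]]]]. exists x. split; auto. apply HE. eauto.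
    + apply over_path_intro. definable.
  - destruct (over_path_mono _ H0) as [R [HR [HE HM1]]].
    apply (class_ext over_path) with (fun e => exists u s, codes_path u s /\ forall x, x < t e -> R (scons u (scons s (scons x e)))).
    + intro e. split.
      * intro K.
        (* [codes_path] is Delta_2 over the old class, whose Sigma_2 collection bounds the segments
           for all [x < t e]; persistence then moves them to one segment. *)
        destruct (collects_rel (sigma2 Sg) (fun u x => exists s, codes_path u s /\ R (scons u (scons s (scons x e)))) (collects_sigma2 Sg)) with (a := t e) as [b Hb].
        { pose proof codes_path_def2 as I2. apply delta_rel2 in I2. unfold rel2. definable.
          apply (closed_sub (C := sigma2 Sg) R (fun e' => scons (e' 1%nat) (scons (e' 0%nat) (scons (e' 2%nat) e)))).
          now apply sigma2_base. definable. }
        { intros x L. now apply HE, K. }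
        destruct (codes_path_code b) as [r Hr]. exists b, r. split; auto. intros x L.
        destruct (Hb x L) as [u [Lu [s [Hs Hx]]]]. apply (HM1 u _ s); auto. now left.
        apply codes_path_agree with b; auto. now left.
      * intros [u [s [? K]]] x L. apply HE. eauto.
    + apply over_path_intro. definable.
  - destruct H as [R [HR HE]].
    apply (class_ext over_path) with (fun e => exists u s, codes_path u s /\ R (scons u (scons s (tau e)))).
    + intro e. apply HE.
    + apply over_path_intro. definable. apply (term_sub (fun e => tau e i) (fun e i => e (S (S i)))); [auto|intro; apply term_var].
Qed.
Existing Instance over_path_ex.

Lemma delta_path : rel1 (delta over_path) path.
Proof.
  split.
  - apply (class_ext over_path) with (fun e => exists u s, codes_path u s /\ (e 0%nat < u /\ in_code (e 0%nat) s)).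
    + intro e. split.
      * intro H. destruct (codes_path_code (e 0%nat + 1)) as [s Hs]. exists (e 0%nat + 1), s. split; auto.
        split. apply m_lt_succ. apply Hs; auto. apply m_lt_succ.
      * intros [u [s [Hs [L H]]]]. now apply Hs in H.
    + apply over_path_intro. definable.
  - apply (class_ext over_path) with (fun e => exists u s, codes_path u s /\ (e 0%nat < u /\ ~ in_code (e 0%nat) s)).
    + intro e. split.
      * intro H. destruct (codes_path_code (e 0%nat + 1)) as [s Hs]. exists (e 0%nat + 1), s. split; auto.
        split. apply m_lt_succ. rewrite (Hs (e 0%nat)); auto. apply m_lt_succ.
      * intros [u [s [Hs [L H]]]] K. apply H. now apply Hs.
    + apply over_path_intro. definable.
Qed.
Hint Resolve delta_path : rel.

Lemma codes_path_def : rel2 (delta over_path) codes_path.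
Proof. unfold rel2, codes_path. definable. Qed.
Hint Resolve codes_path_def : rel.

Definition path_witness (i x w : M) : Prop := exists u, u <= w /\ exists s, s <= w /\ exists y, y <= w /\
  codes_path u s /\ D i (pair u (pair s x)) y.

Lemma path_witness_def : rel3 (delta over_path) path_witness.
Proof.
  assert (rel3 (delta over_path) D) by (split; apply over_path_base, HD). unfold rel3, path_witness. definable.
Qed.

Lemma over_path_witness P : over_path P -> exists k0, forall k, (k0 <= k)%nat -> exists i, forall e,
  P e <-> exists w, path_witness i (tuple k e) w.
Proof.
  intros HP. destruct (over_path_fact P HP) as [k0 H]. exists k0. intros k L. destruct (H k L) as [i Hi].
  exists i. intro e. rewrite Hi, path_fact_pair. split.
  - intros [u [s [Hs [y Hy]]]]. exists (u + s + y). exists u. split. apply m_le_iff; exists (s+y); ring.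
    exists s. split. apply m_le_iff; exists (u+y); ring. exists y. split; auto. apply m_le_add_l.
  - intros [w [u [_ [s [_ [y [_ [? ?]]]]]]]]. eauto 10.
Qed.

Lemma over_path_arena : arena over_path.
Proof.
  split.
  - typeclasses eauto.
  - typeclasses eauto.
  (* Lowness pays off here: a Pi relation over the path is Sigma_2 over the old class, where
     collection is available. *)
  - apply collects_mono with (2 := collects_sigma2 Sg). intros P HP. apply over_path_delta2 in HP. destruct HP as [_ HP].
    apply (class_ext (sigma2 Sg)) with (2 := HP). intro; tauto.
  - intros P [HP _] x Hx. apply (least2 Sg P x); auto. now apply over_path_delta2.
  - intros P HP. destruct (over_path_witness P HP) as [k0 H]. destruct (H k0 (le_n _)) as [i Hi].
    exists (fun e => path_witness i (tuple k0 (fun i => e (S i))) (e 0%nat)). split.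
    + apply (closed_sub3 (delta over_path) path_witness (fun _ => i) (fun e => tuple k0 (fun i => e (S i))) (fun e => e 0%nat)).
      apply path_witness_def. apply term_const. apply (term_tuple k0 (fun e i => e (S i))). intro; apply term_var. apply term_var.
    + exact Hi.
  - intros P HP. destruct (over_path_witness P HP) as [k0 H]. destruct (H k0 (le_n _)) as [i Hi].
    exists k0. intros e e' Ha. rewrite !Hi. now rewrite (tuple_agree k0 e e' Ha).
Qed.
End Path.

Lemma low_basis_aux : exists (path : M -> Prop) (over_path : class), arena over_path /\ universal over_path /\
  (forall P, Sg P -> over_path P) /\ rel1 (delta over_path) path /\
  forall u s, (forall x, x < u -> (in_code x s <-> path x)) -> ~ Tb u s.
Proof.
  destruct mem_index as [c [H1 [H2 H3]]]. exists (path c), (over_path c).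
  split; [|split; [|split; [|split]]].
  - now apply over_path_arena.
  - exists (path_witness c). split. now apply path_witness_def. now apply over_path_witness.
  - now apply over_path_base.
  - now apply delta_path.
  - intros u s H. now apply (path_avoids c).
Qed.

End LowBasis.

Theorem low_basis {M : arith_str} {HM : PAminus M} (Sg : ((nat -> M) -> Prop) -> Prop) (Tb : M -> M -> Prop) :
  arena Sg -> universal Sg -> rel2 (delta Sg) Tb ->
  (forall u v s t, u <= v -> agree u s t -> Tb u s -> Tb v t) ->
  (forall u, exists s, ~ Tb u s) ->
  exists (path : M -> Prop) (over_path : ((nat -> M) -> Prop) -> Prop), arena over_path /\ universal over_path /\
    (forall P, Sg P -> over_path P) /\ rel1 (delta over_path) path /\
    forall u s, (forall x, x < u -> (in_code x s <-> path x)) -> ~ Tb u s.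
Proof. intros HA [D [HD HU]]. intros. now apply low_basis_aux with D. Qed.

(** * Uniformization of bounded Pi relations *)

Section Uniformization.
Context {M : arith_str} {HM : PAminus M}.
Local Notation "0" := (zero M) : m_scope.
Local Notation "1" := (one M) : m_scope.
Add Ring M_ring8 : M_semiring.
Local Notation env := (nat -> M).
Local Notation class := ((env -> Prop) -> Prop).

Section Step.
Context (Sg : class) {HA : arena Sg}.
Variable D : M -> M -> M -> Prop.
Hypothesis HD : rel3 (delta Sg) D.
Hint Resolve HD : rel.

Definition enumerated (w t v : M) : Prop := exists j, j <= t /\ exists x, x <= t /\ exists a, a <= t /\
  t = pair (pair j x) a /\ exists y, y <= w /\ D j (pair v x) y.

Definition bound_of (t a : M) : Prop := exists p, p <= t /\ t = pair p a.

Definition exhausted (w t : M) : Prop := exists a, a <= t /\ bound_of t a /\ forall v, v < a -> enumerated w t v.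

(* t = ((j,x),a) asks for some v < a outside the j-th Sigma_1 set with parameter
   x.  A path must propose at least one such v, and may only propose an
   enumerated v when all of [0,a) has been enumerated. *)
Definition violation (u s : M) : Prop := exists t, t < u /\ exists a, a <= t /\ bound_of t a /\ 0 < a /\
  (((forall v, v < a -> pair t v < u) /\ (forall v, v < a -> ~ in_code (pair t v) s)) \/
   (exists v, v < a /\ exists w, w < u /\ pair t v < u /\ in_code (pair t v) s /\ enumerated w t v /\ ~ exhausted w t)).

Lemma enumerated_def : rel3 (delta Sg) enumerated.
Proof. unfold rel3, enumerated. definable. Qed.
Hint Resolve enumerated_def : rel.

Lemma bound_of_def : rel2 (delta Sg) bound_of.
Proof. unfold rel2, bound_of. definable. Qed.
Hint Resolve bound_of_def : rel.

Lemma exhausted_def : rel2 (delta Sg) exhausted.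
Proof. unfold rel2, exhausted. definable. Qed.
Hint Resolve exhausted_def : rel.

Lemma violation_def : rel2 (delta Sg) violation.
Proof. unfold rel2, violation. definable. Qed.

Lemma enumerated_mono w w' t v : w <= w' -> enumerated w t v -> enumerated w' t v.
Proof.
  intros L [j [Lj [x [Lx [a [La [H [y [Ly Hy]]]]]]]]]. exists j; split; auto. exists x; split; auto.
  exists a; split; auto. split; auto. exists y; split; auto. now apply m_le_trans with w.
Qed.

Lemma exhausted_mono w w' t : w <= w' -> exhausted w t -> exhausted w' t.
Proof.
  intros L [a [La [H K]]]. exists a. split; auto. split; auto. intros v Lv. apply enumerated_mono with w; auto.
Qed.

Lemma bound_of_inj t a a' : bound_of t a -> bound_of t a' -> a = a'.
Proof. intros [p [_ ->]] [q [_ H]]. now apply pair_inj in H. Qed.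

Lemma violation_mono u v s t : u <= v -> agree u s t -> violation u s -> violation v t.
Proof.
  intros L Ha [x [Lx [a [La [Hb [Ha0 [[H1 H2]|[y [Ly [w [Lw [H1 [H2 [H3 H4]]]]]]]]]]]]]];
  (exists x; split; [now apply m_lt_le_trans with u|]); exists a; split; auto; split; auto; split; auto.
  - left. split; intros z Lz. apply m_lt_le_trans with u; auto. intro K. apply (H2 z Lz). apply Ha; auto.
  - right. exists y; split; auto. exists w; split. now apply m_lt_le_trans with u.
    split. now apply m_lt_le_trans with u. split; auto. now apply Ha.
Qed.

(** The node proposes each [v] that is not enumerated before exhaustion. To see that some [v < a] is
    proposed, let [w] be the least stage that is exhausted or at least [u]: a value not enumerated
    just before [w] qualifies. *)
Lemma violation_cons u : exists s, ~ violation u s.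
Proof.
  destruct (comprehension Sg u (fun c => exists t, t <= c /\ exists v, v <= c /\ c = pair t v /\
    forall w, w < u -> (enumerated w t v -> exhausted w t))) as [s Hs].
  { apply delta2_delta; auto. unfold rel1. definable. }
  assert (F : forall t v, pair t v < u -> (in_code (pair t v) s <-> forall w, w < u -> (enumerated w t v -> exhausted w t))).
  { intros t v L. rewrite Hs by auto. split.
    - intros [t' [_ [v' [_ [K H]]]]]. apply pair_inj in K. destruct K as [<- <-]. auto.
    - intro H. exists t. split. apply pair_le_l. exists v. split. apply pair_le_r. auto. }
  exists s. intros [t [Lt [a [La [Hb [Ha0 [[H1 H2]|[v [Lv [w [Lw [H1 [H2 [H3 H4]]]]]]]]]]]]]].
  - cut (exists v, v < a /\ forall w, w < u -> (enumerated w t v -> exhausted w t)).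
    { intros [v [Lv K]]. apply (H2 v Lv). apply F; auto. }
    destruct (least_base Sg (fun w => u <= w \/ exhausted w t) u) as [w [Hw Hm]].
    { apply delta_rel1. unfold rel1. definable. }
    { left. apply m_le_refl. }
    destruct (m_zero_or_succ w) as [-> | [w1 ->]].
    + exists 0. split; auto. intros w Lw _. destruct Hw as [K|K].
      * exfalso. apply (m_not_lt_zero t). now apply m_lt_le_trans with u.
      * apply exhausted_mono with (2 := K). apply m_zero_le.
    + specialize (Hm w1 (m_lt_succ w1)).
      assert (K : exists v, v < a /\ ~ enumerated w1 t v).
      { apply NNPP. intro N. apply Hm. right. exists a. split; auto. split; auto. intros v Lv.
        apply NNPP. eauto. }
      destruct K as [v [Lv K]]. exists v. split; auto. intros w Lw HE.
      assert (L : w1 < w). { apply m_not_le. intro L. apply K. now apply enumerated_mono with w. }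
      apply m_succ_le_lt in L. destruct Hw as [L'|Hf].
      * exfalso. apply (m_lt_irrefl w). apply m_lt_le_trans with u; auto. now apply m_le_trans with (w1 + 1).
      * now apply exhausted_mono with (w1 + 1).
  - apply H4. apply (F t v); auto.
Qed.
End Step.

Definition graph3 (C : class) (X : M -> M -> M) : Prop := rel3 C (fun y i a => y = X i a).

(** [R] is Sigma, so [X] solves the Pi condition [~ R v i] below [a], with a graph in the possibly
    larger class [C']. Where no solution exists the value is arbitrary, which keeps [X] total. *)
Definition uniformizes (C C' : class) : Prop := forall R, rel2 C R -> exists X, graph3 C' X /\
  forall i a, (exists v, v < a /\ ~ R v i) -> X i a < a /\ ~ R (X i a) i.

Lemma unif_step (Sg : class) : arena Sg -> universal Sg -> exists Sg' : class, arena Sg' /\ universal Sg' /\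
  (forall P, Sg P -> Sg' P) /\ uniformizes Sg Sg'.
Proof.
  intros HA HU. destruct HU as [D [HD HU]].
  destruct (low_basis Sg (violation D)) as [A [over_path [Hover [HUA [Hincl [HdA Hav]]]]]]; auto.
  { now exists D. }
  { now apply violation_def. }
  { exact (violation_mono D). }
  { exact (violation_cons Sg D HD). }
  exists over_path. split; auto. split; auto. split; auto. intros R HR.
  destruct (HU _ HR) as [k0 H]. destruct (H (S (S k0)) ltac:(lia)) as [j Hj].
  set (tx := fun i a => pair (pair j (tuple (S k0) (scons i (fun _ => 0)))) a).
  assert (F : forall v i, R v i <-> exists y, D j (pair v (tuple (S k0) (scons i (fun _ => 0)))) y).
  { intros v i. apply (Hj (scons v (scons i (fun _ => 0)))). }
  assert (Htx : term_fun (fun e => tx (e 0%nat) (e 1%nat))).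
  { apply term_pair; [apply term_pair|apply term_var]. apply term_const.
    apply (term_tuple (S k0) (fun e => scons (e 0%nat) (fun _ => 0))). definable. }
  pose (B := fun y i a => A (pair (tx i a) y)).
  assert (HB : rel3 (delta over_path) B).
  { apply (closed_sub1 (delta over_path) A (fun e => pair (tx (e 1%nat) (e 2%nat)) (e 0%nat))); auto.
    apply term_pair; [|apply term_var].
    apply (term_sub _ (fun e => scons (e 1%nat) (scons (e 2%nat) (fun _ => 0))) Htx). definable. }
  (* The least proposed value, with default 0 when nothing below [a] is proposed. Only bounded
     searches in the path occur, so the graph is Delta. *)
  pose (G := fun y i a => (y < a /\ B y i a /\ forall v, v < y -> ~ B v i a) \/
    (y = 0 /\ forall v, v < a -> ~ B v i a)).
  assert (HG : rel3 over_path G).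
  { apply delta_rel3. unfold rel3, G. definable. }
  assert (Gex : forall i a, exists y, G y i a).
  { intros i a. destruct (classic (exists v, v < a /\ A (pair (tx i a) v))) as [[v [Lv Hv]]|N].
    - destruct (least_base over_path (fun v => v < a /\ A (pair (tx i a) v)) v) as [y [[Ly Hy] Hm]]; auto.
      { apply delta_rel1. change (rel1 (delta over_path) (fun v => v < a /\ B v i a)). unfold rel1. definable. }
      exists y. left. split; auto. split; auto. intros z Lz Hz. apply (Hm z Lz). split; auto. now apply m_lt_trans with y.
    - exists 0. right. split; auto. intros v Lv Hv. eauto. }
  assert (Guniq : forall i a y z, G y i a -> G z i a -> y = z).
  { intros i a y z [[L1 [H1 K1]]|[-> K1]] [[L2 [H2 K2]]|[-> K2]]; auto.
    - destruct (m_lt_total y z) as [L|[L|L]]; auto; exfalso; [now apply (K2 y L)|now apply (K1 z L)].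
    - exfalso. now apply (K2 y).
    - exfalso. now apply (K1 z). }
  exists (fun i a => proj1_sig (constructive_indefinite_description _ (Gex i a))).
  split.
  - apply (class_ext over_path) with (2 := HG). intro e.
    destruct (constructive_indefinite_description _ (Gex (e 1%nat) (e 2%nat))) as [y Hy]. simpl. split.
    + intros ->. auto.
    + intro. eapply Guniq; eauto.
  - intros i a [v0 [L0 N0]]. destruct (constructive_indefinite_description _ (Gex i a)) as [y Hy]. simpl.
    assert (Ha0 : 0 < a) by (apply m_le_lt_trans with v0; auto using m_zero_le).
    set (t := tx i a) in *.
    assert (Hbd : bound_of t a). { exists (pair j (tuple (S k0) (scons i (fun _ => 0)))). split; auto. apply pair_le_l. }
    (* The solution [v0] is never enumerated, so exhaustion can never excuse proposing an enumerated
       value. *)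
    assert (Nf : forall w, ~ exhausted D w t).
    { intros w [a' [_ [Hb K]]]. rewrite <- (bound_of_inj t a a' Hbd Hb) in K. destruct (K v0 L0) as [j' [_ [x [_ [a'' [_ [H1 [z [_ Hz]]]]]]]]].
      apply pair_inj in H1. destruct H1 as [H1 _]. apply pair_inj in H1. destruct H1 as [<- <-].
      apply N0, F. eauto. }
    assert (Av : forall u, exists s, forall x, x < u -> (in_code x s <-> A x)).
    { intro u. apply (comprehension over_path u A). apply delta2_delta; auto. }
    assert (La : a <= t) by apply pair_le_r.
    assert (Lt : t <= pair t a) by apply pair_le_l.
    destruct Hy as [[Ly [Hy _]]|[_ Hy]].
    + split; auto. intro HRy. apply F in HRy. destruct HRy as [w Hw].
      set (u := pair t a + w + 1). destruct (Av u) as [s Hs]. apply (Hav u s Hs).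
      assert (Lpu : forall z, z <= pair t a -> z < u).
      { intros z Lz. apply m_lt_succ_le. apply m_le_trans with (pair t a); auto. apply m_le_add_r. }
      exists t. split; auto. exists a. split; auto. split; auto. split; auto. right.
      exists y. split; auto. exists w. split. { apply m_lt_succ_le, m_le_add_l. }
      assert (Lyu : pair t y < u). { apply Lpu, pair_mono. apply m_le_refl. now left. }
      split; auto. split. now apply Hs. split; auto.
      exists j. split. { apply m_le_trans with (pair j (tuple (S k0) (scons i (fun _ => 0)))); apply pair_le_l. }
      exists (tuple (S k0) (scons i (fun _ => 0))). split.
      { apply m_le_trans with (pair j (tuple (S k0) (scons i (fun _ => 0)))). apply pair_le_r. apply pair_le_l. }
      exists a. split; auto. split; auto. exists w. split; auto. apply m_le_refl.
    (* If nothing below [a] is proposed, a segment long enough to contain all the pairs shows the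
       first kind of violation. *)
    + exfalso. set (u := pair t a + 1). destruct (Av u) as [s Hs]. apply (Hav u s Hs).
      assert (Lpu : forall v, v < a -> pair t v < u).
      { intros v Lv. apply m_lt_succ_le, pair_mono. apply m_le_refl. now left. }
      exists t. split. { now apply m_lt_succ_le. } exists a. split; auto. split; auto. split; auto. left. split; auto.
      intros v Lv K. apply (Hy v Lv). apply Hs; auto.
Qed.

(** * Iteration along omega and the countable limit class *)

Section Chain.
Variable p : nat -> M.
Hypothesis p_surj : forall x, exists i, p i = x.
Variable base : class.
Hypothesis Hbase : arena base /\ universal base.

Definition stage : Type := {C : class | arena C /\ universal C}.

Lemma next_stage (C : stage) : {C' : stage | (forall P, proj1_sig C P -> proj1_sig C' P) /\
  uniformizes (proj1_sig C) (proj1_sig C')}.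
Proof.
  apply constructive_indefinite_description. destruct C as [C [HA HU]]. simpl.
  destruct (unif_step C HA HU) as [C' [HA' [HU' [Hi Hu]]]].
  exists (exist _ C' (conj HA' HU')). auto.
Qed.

Fixpoint chain (k : nat) : stage :=
  match k with O => exist _ base Hbase | S k => proj1_sig (next_stage (chain k)) end.

Definition level (k : nat) : class := proj1_sig (chain k).

Definition limit_class : class := fun P => exists k, level k P.

Lemma level_arena k : arena (level k).
Proof. apply (proj2_sig (chain k)). Qed.

Lemma level_le k l P : (k <= l)%nat -> level k P -> level l P.
Proof.
  induction 1 as [|m _ IH]; auto. intro H'. exact (proj1 (proj2_sig (next_stage (chain m))) P (IH H')).
Qed.

Lemma level_unif k : uniformizes (level k) (level (S k)).
Proof. apply (proj2_sig (next_stage (chain k))). Qed.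

Lemma level_limit k P : level k P -> limit_class P.
Proof. now exists k. Qed.

Lemma delta_limit P : delta limit_class P -> exists k, delta (level k) P.
Proof.
  intros [[k H] [l K]]. exists (k + l)%nat. split; [apply (level_le k)|apply (level_le l)]; auto; lia.
Qed.

(** Each condition concerns finitely many relations of the increasing chain, hence already holds at
    a single level. *)
Lemma limit_class_arena : arena limit_class.
Proof.
  split.
  - split; intros.
    + apply (level_limit 0). pose proof (level_arena 0). now apply closed_eq.
    + apply (level_limit 0). pose proof (level_arena 0). now apply closed_lt.
    + destruct H as [k H], H0 as [l H0]. apply (level_limit (k + l)). pose proof (level_arena (k + l)).
      apply closed_and; [apply (level_le k)|apply (level_le l)]; auto; lia.
    + destruct H as [k H], H0 as [l H0]. apply (level_limit (k + l)). pose proof (level_arena (k + l)).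
      apply closed_or; [apply (level_le k)|apply (level_le l)]; auto; lia.
    + destruct H0 as [k H0]. apply (level_limit k). pose proof (level_arena k). now apply closed_exb0.
    + destruct H0 as [k H0]. apply (level_limit k). pose proof (level_arena k). now apply closed_allb0.
    + destruct H as [k H]. apply (level_limit k). pose proof (level_arena k). now apply closed_sub.
  - intros P [k H]. exists k. pose proof (level_arena k). now apply has_ex0.
  - intros P [k H]. apply (ar_coll (arena := level_arena k) P H).
  - intros P H. apply delta_limit in H. destruct H as [k H]. apply (ar_lnp (arena := level_arena k) P H).
  - intros P [k H]. apply (ar_delta (arena := level_arena k)) in H. revert H. apply exists_mono.
    intros Q [H1 H2]. split; now apply (level_limit k).
  - intros P [k H]. apply (ar_fin (arena := level_arena k) P H).
Qed.

Lemma limit_unif : uniformizes limit_class limit_class.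
Proof.
  intros R [k HR]. destruct (level_unif k R HR) as [X [HX H]]. exists X. split; auto. now apply (level_limit (S k)).
Qed.

Lemma base_limit P : base P -> limit_class P.
Proof. now apply (level_limit 0). Qed.

(** A relation is determined by its level, a tuple length and an index in [M]; the last ranges over
    a countable set because [M] is enumerated by [p]. *)
Lemma limit_countable : exists en : nat -> env -> Prop, forall P, limit_class P -> exists i, forall e, P e <-> en i e.
Proof.
  destruct (choice (fun (k : nat) (D : M -> M -> M -> Prop) => forall P, level k P -> exists k0, forall l, (k0 <= l)%nat -> exists i, forall e : env,
    P e <-> exists y, D i (tuple l e) y)) as [D HD].
  { intro k. destruct (proj2 (proj2_sig (chain k))) as [D [_ H]]. exists D. exact H. }
  exists (fun n e => let (k, m) := of_nat n in let (l, q) := of_nat m in exists y, D k (p q) (tuple l e) y).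
  intros P [k HP]. destruct (HD k P HP) as [l H]. destruct (H l (le_n _)) as [i Hi].
  destruct (p_surj i) as [q <-]. exists (to_nat (k, to_nat (l, q))). intro e. now rewrite !cancel_of_to.
Qed.
End Chain.
End Uniformization.

(** * The generic ultrapower *)

Section Generic.
Context {M : arith_str} {HM : PAminus M}.
Local Notation "0" := (zero M) : m_scope.
Local Notation "1" := (one M) : m_scope.
Add Ring M_ring9 : M_semiring.
Local Notation env := (nat -> M).
Local Notation class := ((env -> Prop) -> Prop).
Context (C : class) {HA : arena C}.
Hypothesis C_unif : uniformizes C C.
Variable en : nat -> env -> Prop.
Hypothesis en_C : forall P, C P -> exists i, forall e, P e <-> en i e.
Variable nu : nat -> M.
Hypothesis nu_surj : forall x, exists i, nu i = x.

Definition large (S : M -> Prop) : Prop := rel1 C S /\ forall b, exists x, b <= x /\ S x.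

(** Two uses: for the graph of a function, its value becomes constant or stays at least [a]; for a
    relation ignoring its first argument and [a = 1], membership in a set is decided. *)
Definition settles (S : M -> Prop) (R : M -> M -> Prop) (a : M) : Prop :=
  (exists m, m < a /\ forall x, S x -> R m x) \/ (forall x, S x -> forall m, m < a -> ~ R m x).

Lemma settle_step (S : M -> Prop) R a : large S -> rel2 C R ->
  exists S', large S' /\ (forall x, S' x -> S x) /\ settles S' R a.
Proof.
  intros [HS HL] HR.
  destruct (classic (exists m, m < a /\ forall b, exists x, b <= x /\ (S x /\ R m x))) as [[m [Lm H]]|N].
  - exists (fun x => S x /\ R m x). split; [split; auto|split; [tauto|]].
    + unfold rel1. definable.
    + left. exists m. split; auto. tauto.
  (* No value below [a] recurs unboundedly. Collection bounds all these occurrences at once, and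
     removing an initial segment keeps the set large. *)
  - destruct (collects_rel (dual C) (fun b m => ~ exists x, b <= x /\ (S x /\ R m x)) ar_coll) with (a := a) as [b Hb].
    { apply (class_ext C) with (fun e => exists x, e 0%nat <= x /\ (S x /\ R (e 1%nat) x)); [|definable].
      intro e. split; [apply NNPP|tauto]. }
    { intros m Lm. apply NNPP. intro K. apply N. exists m. split; auto. intro b. apply NNPP. eauto. }
    exists (fun x => S x /\ b <= x). split; [split|split; [tauto|]].
    + unfold rel1. definable.
    + intro b'. destruct (HL (b + b')) as [x [L Hx]]. exists x. split; [|split; auto];
      apply m_le_trans with (2 := L). apply m_le_add_l. apply m_le_add_r.
    + right. intros x [Sx Lx] m Lm HRm. destruct (Hb m Lm) as [y [Ly K]]. apply K. exists x. split; auto.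
      apply m_le_trans with b; auto. now left.
Qed.

Definition task (t : nat) : (M -> M -> Prop) * M :=
  let (i, l) := of_nat t in (fun m x => en i (scons m (scons x (fun _ => 0))), nu l).

Lemma settle_task (t : nat) (S : {S | large S}) : {S' : {S | large S} |
  (forall x, proj1_sig S' x -> proj1_sig S x) /\
  (rel2 C (fst (task t)) -> settles (proj1_sig S') (fst (task t)) (snd (task t)))}.
Proof.
  apply constructive_indefinite_description.
  destruct (classic (rel2 C (fst (task t)))) as [H|H].
  - destruct (settle_step _ _ (snd (task t)) (proj2_sig S) H) as [S' [HL [HI HS]]].
    exists (exist _ S' HL). auto.
  (* The enumeration is only known to include all members of the class; a task whose relation lies
     outside it changes nothing. *)
  - exists S. tauto.
Qed.

Lemma large_all : large (fun _ => True).
Proof. split. unfold rel1. definable. intro b. exists b. split; auto. apply m_le_refl. Qed.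

Fixpoint generic_sets (j : nat) : {S | large S} :=
  match j with O => exist _ _ large_all | S j => proj1_sig (settle_task j (generic_sets j)) end.

Definition generic_set (j : nat) : M -> Prop := proj1_sig (generic_sets j).

Lemma generic_set_large j : large (generic_set j).
Proof. apply (proj2_sig (generic_sets j)). Qed.

Lemma generic_set_def j : rel1 C (generic_set j).
Proof. apply generic_set_large. Qed.
Hint Resolve generic_set_def : rel.

Lemma generic_set_le j l x : (j <= l)%nat -> generic_set l x -> generic_set j x.
Proof.
  induction 1 as [|l _ IH]; auto. intro H. apply IH. exact (proj1 (proj2_sig (settle_task l (generic_sets l))) x H).
Qed.

Lemma generic_set_settles R a : rel2 C R -> exists j, settles (generic_set j) R a.
Proof.
  intro HR. destruct (en_C _ HR) as [i Hi]. destruct (nu_surj a) as [l <-].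
  set (t := to_nat (i, l)). assert (K := proj2 (proj2_sig (settle_task t (generic_sets t)))).
  assert (E1 : fst (task t) = R).
  { unfold task, t. rewrite cancel_of_to. simpl. extensionality m. extensionality x.
    apply propositional_extensionality. symmetry. apply (Hi (scons m (scons x (fun _ => 0)))). }
  assert (E2 : snd (task t) = nu l).
  { unfold task, t. now rewrite cancel_of_to. }
  exists (S t).
  change (rel2 C (fst (task t)) -> settles (generic_set (S t)) (fst (task t)) (snd (task t))) in K. rewrite E1, E2 in K. now apply K.
Qed.

(** * Truth on a generic set and functions modulo it *)

Definition eventually (P : M -> Prop) : Prop := exists j, forall x, generic_set j x -> P x.

Lemma eventually_mono (P Q : M -> Prop) : (forall x, P x -> Q x) -> eventually P -> eventually Q.
Proof. intros H [j K]. exists j. auto. Qed.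

Lemma eventually_and (P Q : M -> Prop) : eventually P -> eventually Q -> eventually (fun x => P x /\ Q x).
Proof.
  intros [j H] [l K]. exists (j + l)%nat. intros x Hx.
  split; [apply H, (generic_set_le j (j + l))|apply K, (generic_set_le l (j + l))]; auto; lia.
Qed.

Lemma eventually_all (P : M -> Prop) : (forall x, P x) -> eventually P.
Proof. exists O. auto. Qed.

Lemma eventually_ge P b : eventually P -> exists x, b <= x /\ P x.
Proof. intros [j H]. destruct (proj2 (generic_set_large j) b) as [x [L Hx]]. eauto. Qed.

Lemma eventually_ex P : eventually P -> exists x, P x.
Proof. intro H. destruct (eventually_ge P 0 H) as [x [_ Hx]]. eauto. Qed.

Lemma eventually_generic_set j : eventually (generic_set j).
Proof. now exists j. Qed.

Definition eventually_sigma (P : M -> Prop) : Prop := exists j, rel1 C (fun x => generic_set j x /\ P x).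
Definition eventually_sigma2 (R : M -> M -> Prop) : Prop := exists j, rel2 C (fun y x => generic_set j x /\ R y x).

Lemma eventually_dec P : eventually_sigma P -> eventually P \/ eventually (fun x => ~ P x).
Proof.
  (* With bound 1 the first argument can only be 0, and settling becomes a decision. *)
  intros [j H]. destruct (generic_set_settles (fun _ x => generic_set j x /\ P x) 1) as [l [[m [_ K]]|K]].
  - unfold rel2. apply (closed_sub1 C (fun x => generic_set j x /\ P x)); auto. definable.
  - left. exists l. apply K.
  - right. exists (j + l)%nat. intros x Hx HP. apply (K x) with 0; auto using m_zero_one.
    + apply generic_set_le with (j + l)%nat; auto; lia.
    + split; auto. apply generic_set_le with (j + l)%nat; auto; lia.
Qed.

(* The generic sets are only Sigma, so functions are required to have a Sigma graph
   on some generic set and are arbitrary elsewhere. *)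
Definition generic_fun (F : M -> M) : Prop := eventually_sigma2 (fun y x => y = F x).

Lemma generic_fun_term t : term_fun t -> generic_fun (fun x => t (fun _ => x)).
Proof.
  intro H. exists O. unfold rel2. definable.
Qed.

Lemma generic_fun_op (op : M -> M -> M) F F' : term_fun (fun e => op (e 0%nat) (e 1%nat)) -> generic_fun F -> generic_fun F' ->
  generic_fun (fun x => op (F x) (F' x)).
Proof.
  intros Hop [j H] [l K]. exists (j + l)%nat.
  apply (class_ext C) with (fun e => exists u v, (generic_set j (e 1%nat) /\ u = F (e 1%nat)) /\ (generic_set l (e 1%nat) /\ v = F' (e 1%nat)) /\
    generic_set (j + l) (e 1%nat) /\ e 0%nat = op u v).
  - intro e. split.
    + intros [Hx ->]. exists (F (e 1%nat)), (F' (e 1%nat)).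
      split; [split; auto; apply generic_set_le with (j + l)%nat; auto; lia|].
      split; [split; auto; apply generic_set_le with (j + l)%nat; auto; lia|]. auto.
    + intros [u [v [[_ ->] [[_ ->] [? ?]]]]]. auto.
  - set (R1 := fun y x => generic_set j x /\ y = F x) in H. set (R2 := fun y x => generic_set l x /\ y = F' x) in K.
    change (C (fun e => exists u v, R1 u (e 1%nat) /\ R2 v (e 1%nat) /\ generic_set (j + l) (e 1%nat) /\ e 0%nat = op u v)).
    definable. apply (term_sub _ (fun e => scons (e 1%nat) (scons (e 0%nat) (fun _ => 0))) Hop). definable.
Qed.

(** Functions are substituted one at a time, since each graph may need its own generic set. Slot 0
    holds the index, and the variables not yet replaced follow it. *)
Lemma comp_aux P (F : nat -> M -> M) : C P -> (forall i, generic_fun (F i)) -> forall k,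
  exists j, C (fun e => generic_set j (e 0%nat) /\ P (fun i => if i <? k then F i (e 0%nat) else e (S (i - k)))).
Proof.
  intros HP HF. induction k as [|k [j H]].
  - exists O. apply closed_and. definable.
    apply (class_ext C) with (fun e => P (fun i => e (S i))); [|definable].
    intro e. simpl. replace (fun i => e (S (i - 0))%nat) with (fun i => e (S i)). reflexivity.
    extensionality i. do 2 f_equal. lia.
  - destruct (HF k) as [l K]. exists (j + l)%nat.
    set (R := fun y x => generic_set l x /\ y = F k x) in K.
    set (Q := fun e : env => generic_set j (e 0%nat) /\ P (fun i => if i <? k then F i (e 0%nat) else e (S (i - k)))) in H.
    apply (class_ext C) with (fun e => generic_set (j + l) (e 0%nat) /\ exists v, R v (e 0%nat) /\ Q (scons (e 0%nat) (scons v (fun i => e (S i))))).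
    + intro e.
      assert (F1 : (fun i => if i <? k then F i (e 0%nat) else scons (e 0%nat) (scons (F k (e 0%nat)) (fun i => e (S i))) (S (i - k))) =
        (fun i => if i <? S k then F i (e 0%nat) else e (S (i - S k)))).
      { extensionality i. destruct (Nat.ltb_spec i k), (Nat.ltb_spec i (S k)); try lia; auto.
        - replace i with k by lia. rewrite Nat.sub_diag. reflexivity.
        - replace (i - k)%nat with (S (i - S k)) by lia. reflexivity. }
      split.
      * intros [Hx HPx]. split; auto. exists (F k (e 0%nat)). split.
        -- split; auto. apply generic_set_le with (j + l)%nat; auto; lia.
        -- split. simpl. apply generic_set_le with (j + l)%nat; auto; lia. simpl in F1 |- *. now rewrite F1.
      * intros [Hx [v [[_ ->] [_ HPx]]]]. split; auto. simpl in F1, HPx. now rewrite F1 in HPx.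
    + definable.
Qed.

(** The predicate depends on finitely many variables, so substituting the first [N] functions
    suffices and a single generic set works. The free arguments [y] and [v] wait at positions [N]
    and [N + 1]. *)
Lemma comp P (F : nat -> M -> M) : C P -> (forall i, generic_fun (F i)) ->
  exists j, rel3 C (fun y v x => generic_set j x /\ P (scons y (scons v (fun i => F i x)))).
Proof.
  intros HP HF. destruct (ar_fin P HP) as [N HN].
  destruct (comp_aux (fun e => P (scons (e N) (scons (e (S N)) e))) F) with (k := N) as [j H]; auto.
  { definable. }
  exists j. unfold rel3.
  apply (class_ext C) with (fun e => (fun e => generic_set j (e 0%nat) /\ (fun e => P (scons (e N) (scons (e (S N)) e)))
     (fun i => if i <? N then F i (e 0%nat) else e (S (i - N)))) (scons (e 2%nat) (scons (e 0%nat) (scons (e 1%nat) (fun _ => 0))))).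
  - intro e. cbn beta. simpl (scons _ _ 0%nat). rewrite Nat.ltb_irrefl, Nat.sub_diag.
    destruct (Nat.ltb_spec (S N) N); [lia|]. replace (S N - N)%nat with 1%nat by lia. simpl (scons _ _ 1%nat). simpl (scons _ _ 2%nat).
    assert (A1 : forall i, (i < N)%nat -> scons (e 0%nat) (scons (e 1%nat) (fun i => F i (e 2%nat))) i =
      scons (e 0%nat) (scons (e 1%nat) (fun i => if i <? N then F i (e 2%nat) else
         scons (e 2%nat) (scons (e 0%nat) (scons (e 1%nat) (fun _ => 0))) (S (i - N)))) i).
    { intros [|[|i]] L; simpl; auto. destruct (Nat.ltb_spec i N); [auto|lia]. }
    split; intros [Hx HPx]; split; auto; revert HPx; apply HN; intros; [|symmetry]; apply A1; auto.
  - apply (closed_sub (C := C) _ (fun e => scons (e 2%nat) (scons (e 0%nat) (scons (e 1%nat) (fun _ => 0)))) H). definable.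
Qed.

Lemma comp1 P (F : nat -> M -> M) : C P -> (forall i, generic_fun (F i)) ->
  eventually_sigma2 (fun y x => P (scons y (fun i => F i x))).
Proof.
  intros HP HF. destruct (comp (fun e => P (scons (e 0%nat) (fun i => e (S (S i))))) F) as [j H]; auto.
  { definable. }
  exists j. set (R := fun y (v : M) x => generic_set j x /\ P (scons y (fun i => F i x))). change (rel3 C R) in H.
  apply (closed_sub3 C R (fun e => e 0%nat) (fun e => 0) (fun e => e 1%nat)); definable.
Qed.

Lemma comp0 P (F : nat -> M -> M) : C P -> (forall i, generic_fun (F i)) -> eventually_sigma (fun x => P (fun i => F i x)).
Proof.
  intros HP HF. destruct (comp1 (fun e => P (fun i => e (S i))) F) as [j H]; auto.
  { definable. }
  exists j. set (R := fun (y : M) x => generic_set j x /\ P (fun i => F i x)). change (rel2 C R) in H.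
  apply (closed_sub2 C R (fun e => 0) (fun e => e 0%nat)); definable.
Qed.

(** Sigma selection: write [R] as existential over a Delta relation, take the least bound on a value
    together with its witness, then the least value under that bound. Only least elements of Delta
    sets are involved. *)
Lemma choice_graph R : rel2 C R -> exists (F : M -> M) (Gr : M -> M -> Prop), rel2 C Gr /\
  (forall x y, Gr y x -> R y x) /\
  forall x, (exists y, R y x) -> Gr (F x) x /\ forall y, Gr y x -> y = F x.
Proof.
  intro HR. destruct (ar_delta _ HR) as [Q [HQ HE]].
  set (Q3 := fun w y x : M => Q (scons w (scons y (fun _ => x)))).
  assert (HQ3 : rel3 (delta C) Q3) by (unfold rel3, Q3; definable).
  assert (E3 : forall y x, R y x <-> exists w, Q3 w y x).
  { intros y x. apply (HE (scons y (fun _ => x))). }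
  set (W := fun b y x => exists w, w <= b /\ Q3 w y x).
  assert (HW : rel3 (delta C) W) by (unfold rel3, W; definable).
  set (T := fun b x => exists y, y <= b /\ W b y x).
  assert (HT : rel2 (delta C) T) by (unfold rel2, T; definable).
  set (Gr := fun y x => exists b, T b x /\ (forall b', b' < b -> ~ T b' x) /\ W b y x /\ forall y', y' < y -> ~ W b y' x).
  assert (GR : forall x y, Gr y x -> R y x).
  { intros x y [b [_ [_ [[w [_ Hw]] _]]]]. apply E3. eauto. }
  assert (Gex : forall x, (exists y, R y x) -> exists y, Gr y x).
  { intros x [y Hy]. apply E3 in Hy. destruct Hy as [w Hw].
    destruct (least_base C (fun b => T b x) (w + y)) as [b [Hb Hbm]].
    { apply delta_rel1. unfold rel1. definable. }
    { exists y. split. apply m_le_add_l. exists w. split; auto. apply m_le_add_r. }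
    pose proof Hb as Hb'. destruct Hb' as [y1 [_ Hy1]].
    destruct (least_base C (fun y => W b y x) y1) as [y2 [Hy2 Hm2]]; auto.
    { apply delta_rel1. unfold rel1. definable. }
    exists y2, b. auto. }
  assert (Gun : forall x y z, Gr y x -> Gr z x -> y = z).
  { intros x y z [b [H1 [H2 [H3 H4]]]] [b' [H1' [H2' [H3' H4']]]].
    assert (b = b').
    { destruct (m_lt_total b b') as [L|[L|L]]; auto; exfalso; [exact (H2' b L H1)|exact (H2 b' L H1')]. }
    subst b'. destruct (m_lt_total y z) as [L|[L|L]]; auto; exfalso; [exact (H4' y L H3)|exact (H4 z L H3')]. }
  destruct (choice (fun (x y : M) => (exists y, R y x) -> Gr y x)) as [F HF].
  { intro x. destruct (classic (exists y, R y x)) as [K|K].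
    - destruct (Gex x K) as [y Hy]. eauto.
    - exists 0. tauto. }
  exists F, Gr. split; [|split; auto].
  - unfold rel2, Gr. definable.
  - intros x K. split; auto. intros y Hy. apply (Gun x); auto.
Qed.

Lemma generic_fun_choice R : eventually_sigma2 R -> eventually (fun x => exists y, R y x) -> exists F, generic_fun F /\ eventually (fun x => R (F x) x).
Proof.
  intros [j HR] HU. pose proof (eventually_and _ _ (eventually_generic_set j) HU) as [l Hl].
  destruct (choice_graph _ HR) as [F [Gr [HG [H1 H2]]]]. exists F.
  assert (K : forall x, generic_set l x -> Gr (F x) x /\ forall y, Gr y x -> y = F x).
  { intros x Hx. apply H2. destruct (Hl x Hx) as [? [y ?]]. eauto. }
  split.
  - exists l. apply (class_ext C) with (fun e => generic_set l (e 1%nat) /\ Gr (e 0%nat) (e 1%nat)); [|definable].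
    intro e. split; intros [Hx Hy]; split; auto.
    + rewrite Hy. now apply K.
    + now apply K.
  - exists l. intros x Hx. apply K in Hx. destruct Hx as [Hx _]. apply H1 in Hx. tauto.
Qed.

(** * The ultrapower structure *)

Definition gen_class (F : M -> M) : (M -> M) -> Prop := fun F' => generic_fun F' /\ eventually (fun x => F x = F' x).

(** A quotient realized by actual equivalence classes; [rep] picks a representative, which is
    controlled only eventually. *)
Definition ult_carrier : Type := {c : (M -> M) -> Prop | exists F, generic_fun F /\ c = gen_class F}.

Definition mk (F : M -> M) (H : generic_fun F) : ult_carrier := exist _ (gen_class F) (ex_intro _ F (conj H eq_refl)).

Definition rep (k : ult_carrier) : M -> M := proj1_sig (constructive_indefinite_description _ (proj2_sig k)).

Lemma rep_generic_fun k : generic_fun (rep k).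
Proof. apply (proj2_sig (constructive_indefinite_description _ (proj2_sig k))). Qed.

Lemma gen_class_eq F F' : eventually (fun x => F x = F' x) -> gen_class F = gen_class F'.
Proof.
  intro H. extensionality F1. apply propositional_extensionality. unfold gen_class.
  split; intros [HF K]; split; auto; (eapply eventually_mono; [|apply (eventually_and _ _ H K)]); simpl; intros x [? ?]; congruence.
Qed.

Lemma ult_eq k l : k = l <-> eventually (fun x => rep k x = rep l x).
Proof.
  split.
  - intros ->. now apply eventually_all.
  - intro H. apply gen_class_eq in H. unfold rep in H.
    destruct (constructive_indefinite_description _ (proj2_sig k)) as [F [HF EF]].
    destruct (constructive_indefinite_description _ (proj2_sig l)) as [F' [HF' EF']]. simpl in H.
    apply eq_sig_hprop; [intros; apply proof_irrelevance|congruence].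
Qed.

Lemma rep_mk F H : eventually (fun x => rep (mk F H) x = F x).
Proof.
  unfold rep. destruct (constructive_indefinite_description _ (proj2_sig (mk F H))) as [F' [HF' EF]].
  simpl in *. assert (K : gen_class F F) by (split; auto; now apply eventually_all). rewrite EF in K. apply K.
Qed.

Lemma generic_fun_const c : generic_fun (fun _ => c).
Proof. exact (generic_fun_term _ (term_const c)). Qed.

Lemma generic_fun_add F F' : generic_fun F -> generic_fun F' -> generic_fun (fun x => F x + F' x).
Proof. apply (generic_fun_op (add M)). definable. Qed.

Lemma generic_fun_mul F F' : generic_fun F -> generic_fun F' -> generic_fun (fun x => F x * F' x).
Proof. apply (generic_fun_op (mul M)). definable. Qed.

Definition ultrapower : arith_str := ArithStr ult_carrier (mk _ (generic_fun_const 0)) (mk _ (generic_fun_const 1))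
  (fun k l => mk _ (generic_fun_add _ _ (rep_generic_fun k) (rep_generic_fun l)))
  (fun k l => mk _ (generic_fun_mul _ _ (rep_generic_fun k) (rep_generic_fun l)))
  (fun k l => eventually (fun x => rep k x < rep l x)).

Definition at_index (e : nat -> ultrapower) (x : M) : env := fun i => rep (e i) x.

Lemma at_index_scons k e x : at_index (scons k e) x = scons (rep k x) (at_index e x).
Proof. extensionality i. now destruct i. Qed.

Lemma eval_ultrapower e t : eventually (fun x => rep (eval ultrapower e t) x = eval M (at_index e x) t).
Proof.
  induction t; simpl.
  - now apply eventually_all.
  - apply rep_mk.
  - apply rep_mk.
  - eapply eventually_mono; [|exact (eventually_and _ _ (rep_mk _ (generic_fun_add _ _ (rep_generic_fun (eval ultrapower e t1)) (rep_generic_fun (eval ultrapower e t2)))) (eventually_and _ _ IHt1 IHt2))].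
    simpl. intros x [H [H1 H2]]. congruence.
  - eapply eventually_mono; [|exact (eventually_and _ _ (rep_mk _ (generic_fun_mul _ _ (rep_generic_fun (eval ultrapower e t1)) (rep_generic_fun (eval ultrapower e t2)))) (eventually_and _ _ IHt1 IHt2))].
    simpl. intros x [H [H1 H2]]. congruence.
Qed.

Lemma ultrapower_choice R : eventually_sigma2 R -> eventually (fun x => exists y, R y x) -> exists k : ultrapower, eventually (fun x => R (rep k x) x).
Proof.
  intros HR HU. destruct (generic_fun_choice R HR HU) as [F [HF H]]. exists (mk F HF).
  eapply eventually_mono; [|exact (eventually_and _ _ H (rep_mk F HF))]. simpl. intros x [H1 ->]. auto.
Qed.

(** * Los's theorem *)

Definition los (phi : formula) : Prop := forall e : nat -> ultrapower,
  sat ultrapower e phi <-> eventually (fun x => sat M (at_index e x) phi).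

Lemma eventually_not P : eventually_sigma P -> (~ eventually P <-> eventually (fun x => ~ P x)).
Proof.
  intro H. split.
  - intro N. destruct (eventually_dec P H); tauto.
  - intros H1 H2. destruct (eventually_ex _ (eventually_and _ _ H1 H2)) as [x ?]. tauto.
Qed.

Lemma eventually_dec_dual P : eventually_sigma (fun x => ~ P x) -> eventually P \/ eventually (fun x => ~ P x).
Proof.
  intro H. destruct (eventually_dec _ H) as [K1|K1]; auto. left. eapply eventually_mono; [|exact K1]. intro x. apply NNPP.
Qed.

Definition sat_sigma phi := C (fun e => sat M e phi).
Definition sat_pi phi := dual C (fun e => sat M e phi).

Lemma sat_eventually_sigma phi (e : nat -> ultrapower) : sat_sigma phi -> eventually_sigma (fun x => sat M (at_index e x) phi).
Proof. intro H. apply (comp0 (fun e => sat M e phi) (fun i => rep (e i)) H). intro. apply rep_generic_fun. Qed.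

Lemma los_not phi : sat_sigma phi -> los phi -> los (Fnot phi).
Proof. intros HS HL e. red in HL. simpl. rewrite HL. apply eventually_not. now apply sat_eventually_sigma. Qed.

Lemma los_and p q : los p -> los q -> los (Fand p q).
Proof.
  intros H1 H2 e. red in H1, H2. simpl. rewrite H1, H2. split.
  - intros [? ?]. now apply eventually_and.
  - intro K1. split; (eapply eventually_mono; [|exact K1]); simpl; tauto.
Qed.

Lemma los_or p q : sat_sigma p -> los p -> los q -> los (For p q).
Proof.
  intros HS H1 H2 e. red in H1, H2. simpl. rewrite H1, H2. split.
  - intros [K1|K1]; (eapply eventually_mono; [|exact K1]); simpl; tauto.
  - intro K1. destruct (eventually_dec _ (sat_eventually_sigma p e HS)) as [K2|K2]; auto. right.
    eapply eventually_mono; [|exact (eventually_and _ _ K1 K2)]. simpl. tauto.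
Qed.

Lemma los_imp p q : sat_sigma p -> los p -> los q -> los (Fimp p q).
Proof.
  intros HS H1 H2 e. red in H1, H2. simpl. rewrite H1, H2. split.
  - intros K1. destruct (eventually_dec _ (sat_eventually_sigma p e HS)) as [K2|K2]; [apply K1 in K2|];
    (eapply eventually_mono; [|exact K2]); simpl; tauto.
  - intros K1 K2. eapply eventually_mono; [|exact (eventually_and _ _ K1 K2)]. simpl. tauto.
Qed.

Lemma sat_sigma2 P (e : nat -> ultrapower) : C P -> eventually_sigma2 (fun y x => P (scons y (at_index e x))).
Proof. intro H. apply (comp1 P (fun i => rep (e i)) H). intro. apply rep_generic_fun. Qed.

Lemma los_ex p : sat_sigma p -> los p -> los (Fex p).
Proof.
  intros HS HL e. simpl. split.
  - intros [k Hk]. apply HL in Hk. eapply eventually_mono; [|exact Hk]. simpl. intros x Hx.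
    rewrite at_index_scons in Hx. eauto.
  - intro H. destruct (ultrapower_choice _ (sat_sigma2 _ e HS) H) as [k Hk]. exists k. apply HL.
    eapply eventually_mono; [|exact Hk]. simpl. intros x Hx. now rewrite at_index_scons.
Qed.

(** The failure of a Pi statement is Sigma, so it is decided generically and a counterexample can be
    chosen by a generic function. *)
Lemma los_all p : sat_pi p -> los p -> los (Fall p).
Proof.
  intros HS HL e. simpl. split.
  - intro H. destruct (eventually_dec_dual (fun x => sat M (at_index e x) (Fall p))) as [K1|K1].
    + apply (comp0 (fun e => ~ sat M e (Fall p)) (fun i => rep (e i))); [|intro; apply rep_generic_fun].
      apply (class_ext C) with (fun e => exists a, ~ sat M (scons a e) p).
      * intro. simpl. split; [apply not_all_ex_not|intros [a Ha] H'; apply Ha, H'].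
      * apply (has_ex0 (C := C) (fun e => ~ sat M e p)). exact HS.
    + exact K1.
    + exfalso. destruct (ultrapower_choice _ (sat_sigma2 _ e HS)) as [k Hk].
      { eapply eventually_mono; [|exact K1]. simpl. intros x Hx. now apply not_all_ex_not in Hx. }
      specialize (H k). apply HL in H. destruct (eventually_ex _ (eventually_and _ _ H Hk)) as [x [Hx Hx']].
      rewrite at_index_scons in Hx. contradiction.
  - intros H k. apply HL. eapply eventually_mono; [|exact H]. simpl. intros x Hx. rewrite at_index_scons. apply Hx.
Qed.

Lemma los_exb t p : sat_sigma p -> los p -> los (Fexb t p).
Proof.
  intros HS HL e. simpl. split.
  - intros [k [Lk Hk]]. apply HL in Hk.
    eapply eventually_mono; [|exact (eventually_and _ _ (eventually_and _ _ Lk (eval_ultrapower e t)) Hk)]. simpl. intros x [[Lx Ex'] Hx].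
    rewrite at_index_scons in Hx. exists (rep k x). rewrite <- Ex'. auto.
  - intro H.
    assert (HC : C (fun e => e 0%nat < eval M (fun i => e (S i)) t /\ sat M e p)).
    { apply closed_and; auto. apply closed_lt. apply term_var. apply (term_sub _ (fun e i => e (S i)) (eval_tm t)). intro; apply term_var. }
    destruct (ultrapower_choice _ (sat_sigma2 _ e HC) H) as [k Hk]. exists k. split.
    + eapply eventually_mono; [|exact (eventually_and _ _ (eval_ultrapower e t) Hk)]. simpl. intros x [-> [Lx _]]. exact Lx.
    + apply HL. eapply eventually_mono; [|exact Hk]. simpl. intros x [_ Hx]. now rewrite at_index_scons.
Qed.

Lemma los_equiv p q : (forall e, sat ultrapower e p <-> sat ultrapower e q) -> (forall e, sat M e p <-> sat M e q) -> los p -> los q.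
Proof.
  intros H1 H2 H e. red in H. rewrite <- H1, H. split; apply eventually_mono; intro x; apply H2.
Qed.

Section Elementary.
Variable n : nat.
Hypothesis sigma_rel_cls : forall k, (k <= S n)%nat -> closed (sigma_rel k : class).
Hypothesis sigma_rel_C : forall P, sigma_rel (S n) P -> C P.

Lemma sigma_in_class k phi : (k <= S n)%nat -> is_sigma k phi -> sat_sigma phi.
Proof.
  intros L H. apply sigma_rel_C. apply sigma_rel_mono with k; auto. now apply (sat_sigma_rel (S n) sigma_rel_cls k).
Qed.

Lemma pi_in_class k phi : (k <= S n)%nat -> is_pi k phi -> sat_pi phi.
Proof.
  intros L H. apply sigma_rel_C. apply sigma_rel_mono with k; auto. now apply (sat_sigma_rel (S n) sigma_rel_cls k).
Qed.

Lemma delta0_in_class phi : is_delta0 phi -> sat_sigma phi.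
Proof. intro H. apply sigma_in_class with O. lia. now constructor. Qed.

Lemma los_delta0 phi : is_delta0 phi -> los phi.
Proof.
  induction 1 as [s u|s u|p0 H IH|p0 q H IH H' IH'|p0 q H IH H' IH'|p0 q H IH H' IH'|t p0 H IH|t p0 H IH].
  - intro e. simpl. rewrite ult_eq. pose proof (eventually_and _ _ (eval_ultrapower e s) (eval_ultrapower e u)) as HE.
    split; intro H; (eapply eventually_mono; [|exact (eventually_and _ _ HE H)]); simpl; intros x [[-> ->] Hx]; auto.
  - intro e. simpl. pose proof (eventually_and _ _ (eval_ultrapower e s) (eval_ultrapower e u)) as HE.
    split; intro H; (eapply eventually_mono; [|exact (eventually_and _ _ HE H)]); simpl; intros x [[-> ->] Hx]; auto.
  - apply los_not; auto using delta0_in_class.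
  - now apply los_and.
  - apply los_or; auto using delta0_in_class.
  - apply los_imp; auto using delta0_in_class.
  (* Delta_0 formulas are closed under negation, so the bounded universal case follows by duality
     from the existential one. *)
  - apply (los_equiv (Fnot (Fexb t (Fnot p0)))).
    + intro e. simpl. split; [intros N k L; apply NNPP; eauto|intros H' [k [L N]]; auto].
    + intro e. simpl. split; [intros N k L; apply NNPP; eauto|intros H' [k [L N]]; auto].
    + assert (D : is_delta0 (Fnot p0)) by now constructor.
      apply los_not. apply delta0_in_class. now constructor. apply los_exb. now apply delta0_in_class.
      apply los_not; auto. now apply delta0_in_class.
  - apply los_exb; auto using delta0_in_class.
Qed.

Lemma los_sigma_pi k : (k <= S n)%nat -> forall phi,
  (is_sigma k phi -> los phi) /\ (is_pi k phi -> los phi).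
Proof.
  induction k; intros L phi.
  - split; intro H; inversion H; subst; now apply los_delta0.
  - specialize (IHk ltac:(lia)). split; intro H.
    + remember (S k) as l. induction H; try discriminate; injection Heql as ->.
      * now apply (proj2 (IHk _)).
      * apply los_ex; auto. now apply sigma_in_class with (S k).
    + remember (S k) as l. induction H; try discriminate; injection Heql as ->.
      * now apply (proj1 (IHk _)).
      * apply los_all; auto. now apply pi_in_class with (S k).
Qed.

(** * The embedding and the theory of the ultrapower *)

Definition emb (m : M) : ultrapower := mk _ (generic_fun_const m).

Lemma rep_emb m : eventually (fun x => rep (emb m) x = m).
Proof. apply rep_mk. Qed.

Lemma sat_finitary phi : exists k, forall e e' : env, (forall i, (i < k)%nat -> e i = e' i) ->
  (sat M e phi <-> sat M e' phi).
Proof.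
  assert (B : forall t, exists k, forall e e' : env, (forall i, (i < k)%nat -> e i = e' i) -> eval M e t = eval M e' t).
  { intro t. apply (term_finitary _ (eval_tm t)). }
  induction phi as [s t|s t|q [k Hk]|q [k Hk] r [l Hl]|q [k Hk] r [l Hl]|q [k Hk] r [l Hl]|q [k Hk]|q [k Hk]|t q [k Hk]|t q [k Hk]]; simpl.
  1,2: destruct (B s) as [k Hk], (B t) as [l Hl]; exists (k + l)%nat; intros e e' H;
    rewrite (Hk e e'), (Hl e e'); try tauto; intros; apply H; lia.
  - exists k. intros e e' H. now rewrite (Hk e e' H).
  - exists (k + l)%nat. intros e e' H. rewrite (Hk e e'), (Hl e e'); try tauto; intros; apply H; lia.
  - exists (k + l)%nat. intros e e' H. rewrite (Hk e e'), (Hl e e'); try tauto; intros; apply H; lia.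
  - exists (k + l)%nat. intros e e' H. rewrite (Hk e e'), (Hl e e'); try tauto; intros; apply H; lia.
  - exists k. intros e e' H.
    assert (F : forall a, sat M (scons a e) q <-> sat M (scons a e') q).
    { intro a. apply Hk. intros i Li. apply (scons_agree k); auto. }
    split; intros H1 a; apply F, H1.
  - exists k. intros e e' H.
    assert (F : forall a, sat M (scons a e) q <-> sat M (scons a e') q).
    { intro a. apply Hk. intros i Li. apply (scons_agree k); auto. }
    split; intros [a Ha]; exists a; now apply F.
  - destruct (B t) as [l Hl]. exists (k + l)%nat. intros e e' H. rewrite (Hl e e') by (intros; apply H; lia).
    assert (F : forall a, sat M (scons a e) q <-> sat M (scons a e') q).
    { intro a. apply Hk. intros i Li. apply (scons_agree (k + l)); auto. lia. }
    split; intros H1 a L; apply F, H1, L.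
  - destruct (B t) as [l Hl]. exists (k + l)%nat. intros e e' H. rewrite (Hl e e') by (intros; apply H; lia).
    assert (F : forall a, sat M (scons a e) q <-> sat M (scons a e') q).
    { intro a. apply Hk. intros i Li. apply (scons_agree (k + l)); auto. lia. }
    split; intros [a [L Ha]]; exists a; (split; [auto|]); now apply F.
Qed.

(** Representatives of constants are only eventually constant, and [eventually] is closed under
    finite conjunctions; hence the reduction to the variables that [phi] depends on. *)
Lemma at_index_emb phi (e : env) : eventually (fun x => sat M (at_index (fun i => emb (e i)) x) phi <-> sat M e phi).
Proof.
  destruct (sat_finitary phi) as [k Hk].
  assert (H : forall l, eventually (fun x => forall i, (i < l)%nat -> at_index (fun i => emb (e i)) x i = e i)).
  { induction l.
    - apply eventually_all. intros x i Li. lia.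
    - eapply eventually_mono; [|exact (eventually_and _ _ IHl (rep_emb (e l)))]. simpl. intros x [H1 H2] i Li.
      destruct (Nat.eq_dec i l) as [->|]; [exact H2|]. apply H1. lia. }
  eapply eventually_mono; [|exact (H k)]. simpl. intros x Hx. now apply Hk.
Qed.

Lemma sigma_up phi : is_sigma (S (S n)) phi -> forall e : env, sat M e phi -> sat ultrapower (fun i => emb (e i)) phi.
Proof.
  intro H. remember (S (S n)) as l. induction H as [q H|k q H|k q H IH]; intros e He; try discriminate; injection Heql as ->.
  - apply (proj2 (los_sigma_pi (S n) (le_n _) _) H).
    eapply eventually_mono; [|exact (at_index_emb q e)]. simpl. tauto.
  - destruct He as [a Ha]. exists (emb a). apply IH in Ha; auto.
    replace (scons (emb a) (fun i => emb (e i))) with (fun i => emb (scons a e i)); auto.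
    extensionality i. now destruct i.
Qed.

(** Only this half of Los's theorem is claimed at level [n + 2]: representatives give witnesses
    pointwise, whereas the converse would require choosing solutions of unbounded Pi conditions. *)
Lemma sigma_down phi : is_sigma (S (S n)) phi -> forall e : nat -> ultrapower, sat ultrapower e phi -> eventually (fun x => sat M (at_index e x) phi).
Proof.
  intro H. remember (S (S n)) as l. induction H as [q H|k q H|k q H IH]; intros e He; try discriminate; injection Heql as ->.
  - now apply (proj2 (los_sigma_pi (S n) (le_n _) _) H).
  - destruct He as [a Hk]. apply IH in Hk; auto. eapply eventually_mono; [|exact Hk]. simpl.
    intros x Hx. rewrite at_index_scons in Hx. eauto.
Qed.

Lemma emb_elementary : sigma_elementary (S (S n)) M ultrapower emb.
Proof.
  intros phi H e. split.
  - now apply sigma_up.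
  - intro HK. apply sigma_down in HK; auto. destruct (eventually_ex _ (eventually_and _ _ HK (at_index_emb phi e))) as [x [H1 H2]]. tauto.
Qed.

Lemma emb_embedding : embedding M ultrapower emb.
Proof.
  assert (R : forall (P : M -> M -> Prop) x y, eventually (fun z => P (rep (emb x) z) (rep (emb y) z)) <-> P x y).
  { intros P x y. pose proof (eventually_and _ _ (rep_emb x) (rep_emb y)) as H. split.
    - intro H1. destruct (eventually_ex _ (eventually_and _ _ H H1)) as [z [[Hx Hy] Hz]]. now rewrite Hx, Hy in Hz.
    - intro HP. eapply eventually_mono; [|exact H]. simpl. intros z [-> ->]. auto. }
  split; [|split; [|split; [|split; [|split]]]].
  - intros x y H. apply ult_eq in H. now apply (R eq) in H.
  - reflexivity.
  - reflexivity.
  - intros x y. apply ult_eq. eapply eventually_mono; [|exact (eventually_and _ _ (rep_emb (x + y)) (eventually_and _ _ (rep_mk _ (generic_fun_add _ _ (rep_generic_fun (emb x)) (rep_generic_fun (emb y))))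
      (eventually_and _ _ (rep_emb x) (rep_emb y))))]. simpl. intros z [H1 [H2 [H3 H4]]]. unfold emb in *. simpl in *. congruence.
  - intros x y. apply ult_eq. eapply eventually_mono; [|exact (eventually_and _ _ (rep_emb (x * y)) (eventually_and _ _ (rep_mk _ (generic_fun_mul _ _ (rep_generic_fun (emb x)) (rep_generic_fun (emb y))))
      (eventually_and _ _ (rep_emb x) (rep_emb y))))]. simpl. intros z [H1 [H2 [H3 H4]]]. unfold emb in *. simpl in *. congruence.
  - intros x y. symmetry. exact (R (lt M) x y).
Qed.

Lemma emb_end : end_extension M ultrapower emb.
Proof.
  split. apply emb_embedding. intros k Hk m.
  assert (eventually_sigma (fun x => m < rep k x)).
  { apply (comp0 (fun e => m < e 0%nat) (fun _ => rep k)). definable. intro. apply rep_generic_fun. }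
  assert (Lm : eventually (fun x => m < rep k x)).
  { destruct (eventually_dec _ H) as [H1|H1]; auto. exfalso.
    destruct (rep_generic_fun k) as [j Hj].
    (* The graph of [k] is settled with bound [m + 1]: a constant value would place [k] in [M], and
       otherwise no value is at most [m]. *)
    destruct (generic_set_settles (fun m' x => generic_set j x /\ m' = rep k x) (m + 1) Hj) as [l [[m' [_ Hm]]|Hm]].
    - apply (Hk m'). apply ult_eq. eapply eventually_mono; [|exact (eventually_and _ _ (rep_emb m') (eventually_generic_set l))].
      simpl. intros x [-> Hx]. now apply Hm.
    - destruct (eventually_ex _ (eventually_and _ _ H1 (eventually_and _ _ (eventually_generic_set j) (eventually_generic_set l)))) as [x [Hx [Hjx Hlx]]].
      apply (Hm x Hlx (rep k x)); auto. apply m_lt_succ_le. now apply m_not_lt. }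
  eapply eventually_mono; [|exact (eventually_and _ _ Lm (rep_emb m))]. simpl. intros x [H1 ->]. exact H1.
Qed.

Lemma emb_proper : proper_ext M ultrapower emb.
Proof.
  (* The class of the identity is new because every generic set is unbounded. *)
  exists (mk _ (generic_fun_term _ (term_var 0))). intros m H. apply ult_eq in H.
  destruct (eventually_ge _ (m + 1) (eventually_and _ _ H (eventually_and _ _ (rep_emb m) (rep_mk _ (generic_fun_term _ (term_var 0)))))) as [x [L [H1 [H2 H3]]]].
  rewrite H2, H3 in H1. subst m. apply m_succ_le_lt in L. now apply m_lt_irrefl in L.
Qed.

Lemma pi1_transfer phi : is_pi 1 phi -> (forall e, sat M e phi) -> forall e, sat ultrapower e phi.
Proof. intros H HM' e. apply (proj2 (los_sigma_pi 1 ltac:(lia) phi) H). now apply eventually_all. Qed.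

Instance ultrapower_PAminus : PAminus ultrapower.
Proof.
  set (e0 := fun _ : nat => zero ultrapower).
  assert (T : forall phi, is_pi 1 phi -> (forall e, sat M e phi) -> sat ultrapower e0 phi).
  { intros. now apply pi1_transfer. }
  destruct HM as (H1&H2&H3&H4&H5&H6&H7&H8&H9&H10&H11&H12&H13&H14&H15&H16).
  assert (D : forall phi, is_delta0 phi -> is_pi 1 phi) by (intros; repeat constructor; auto).
  split; [|split; [|split; [|split; [|split; [|split; [|split; [|split; [|split; [|split; [|split; [|split; [|split; [|split; [|split]]]]]]]]]]]]]].
  - refine (T (Fall (Fall (Fall (Feq (Tadd (Tadd (Tvar 2) (Tvar 1)) (Tvar 0)) (Tadd (Tvar 2) (Tadd (Tvar 1) (Tvar 0))))))) _ _);
    [do 3 apply PiAll; repeat constructor|simpl; auto].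
  - refine (T (Fall (Fall (Feq (Tadd (Tvar 1) (Tvar 0)) (Tadd (Tvar 0) (Tvar 1))))) _ _);
    [do 2 apply PiAll; repeat constructor|simpl; auto].
  - refine (T (Fall (Fall (Fall (Feq (Tmul (Tmul (Tvar 2) (Tvar 1)) (Tvar 0)) (Tmul (Tvar 2) (Tmul (Tvar 1) (Tvar 0))))))) _ _);
    [do 3 apply PiAll; repeat constructor|simpl; auto].
  - refine (T (Fall (Fall (Feq (Tmul (Tvar 1) (Tvar 0)) (Tmul (Tvar 0) (Tvar 1))))) _ _);
    [do 2 apply PiAll; repeat constructor|simpl; auto].
  - refine (T (Fall (Fall (Fall (Feq (Tmul (Tvar 2) (Tadd (Tvar 1) (Tvar 0))) (Tadd (Tmul (Tvar 2) (Tvar 1)) (Tmul (Tvar 2) (Tvar 0))))))) _ _);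
    [do 3 apply PiAll; repeat constructor|simpl; auto].
  - refine (T (Fall (Fand (Feq (Tadd (Tvar 0) Tzero) (Tvar 0)) (Feq (Tmul (Tvar 0) Tzero) Tzero))) _ _);
    [apply PiAll; repeat constructor|simpl; auto].
  - refine (T (Fall (Feq (Tmul (Tvar 0) Tone) (Tvar 0))) _ _);
    [apply PiAll; repeat constructor|simpl; auto].
  - refine (T (Fall (Fall (Fall (Fimp (Flt (Tvar 2) (Tvar 1)) (Fimp (Flt (Tvar 1) (Tvar 0)) (Flt (Tvar 2) (Tvar 0))))))) _ _);
    [do 3 apply PiAll; repeat constructor|simpl; intros; eauto].
  - refine (T (Fall (Fnot (Flt (Tvar 0) (Tvar 0)))) _ _);
    [apply PiAll; repeat constructor|simpl; auto].
  - refine (T (Fall (Fall (For (Flt (Tvar 1) (Tvar 0)) (For (Feq (Tvar 1) (Tvar 0)) (Flt (Tvar 0) (Tvar 1)))))) _ _);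
    [do 2 apply PiAll; repeat constructor|simpl; auto].
  - refine (T (Fall (Fall (Fall (Fimp (Flt (Tvar 2) (Tvar 1)) (Flt (Tadd (Tvar 2) (Tvar 0)) (Tadd (Tvar 1) (Tvar 0))))))) _ _);
    [do 3 apply PiAll; repeat constructor|simpl; auto].
  - refine (T (Fall (Fall (Fall (Fimp (Flt Tzero (Tvar 0)) (Fimp (Flt (Tvar 2) (Tvar 1)) (Flt (Tmul (Tvar 2) (Tvar 0)) (Tmul (Tvar 1) (Tvar 0)))))))) _ _);
    [do 3 apply PiAll; repeat constructor|simpl; auto].
  - intros x y L.
    (* The difference is at most [y], so bounding its quantifier by [y + 1] makes this axiom
       Pi_1. *)
    assert (S13 : sat ultrapower e0 (Fall (Fall (Fimp (Flt (Tvar 1) (Tvar 0)) (Fexb (Tadd (Tvar 0) Tone) (Feq (Tadd (Tvar 2) (Tvar 0)) (Tvar 1))))))).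
    { apply T; [do 2 apply PiAll; repeat constructor|]. simpl. intros _ a b Lab. destruct (H13 a b Lab) as [c Hc].
      exists c. split; auto. apply m_lt_succ_le. rewrite <- Hc. apply m_le_add_l. }
    destruct (S13 x y L) as [z [_ Hz]]. exists z. exact Hz.
  - refine (T (Flt Tzero Tone) _ _); [repeat constructor|simpl; auto].
  - refine (T (Fall (Fimp (Flt Tzero (Tvar 0)) (For (Flt Tone (Tvar 0)) (Feq Tone (Tvar 0))))) _ _);
    [apply PiAll; repeat constructor|simpl; intros _ x; apply H15].
  - refine (T (Fall (For (Flt Tzero (Tvar 0)) (Feq Tzero (Tvar 0)))) _ _);
    [apply PiAll; repeat constructor|simpl; intros _ x; apply H16].
Qed.

(** The least counterexample at each index is Delta_0-definable from the parameters, so it forms an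
    element of the ultrapower; its predecessor then contradicts the induction step. *)
Lemma ultrapower_IDelta0 : IDelta0 ultrapower.
Proof.
  split; [exact ultrapower_PAminus|]. intros phi D e H0 HS a. apply NNPP. intro N.
  assert (DC : delta C (fun e => sat M e phi)).
  { split. now apply delta0_in_class. apply (delta0_in_class (Fnot phi)). now constructor. }
  assert (HC : C (fun e => ~ sat M e phi /\ forall y, y < e 0%nat -> sat M (scons y (fun i => e (S i))) phi)).
  { apply delta_l. apply closed_and. now apply closed_not. apply (closed_allb (delta C) (fun e => e 0%nat) (fun y e => sat M (scons y (fun i => e (S i))) phi)). apply term_var.
    apply (closed_sub (C := delta C) (fun e => sat M e phi) (fun e => scons (e 0%nat) (fun i => e (S (S i))))); auto. definable. }
  assert (LN : los (Fnot phi)) by (apply los_delta0; now constructor).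
  apply (LN (scons a e)) in N.
  destruct (ultrapower_choice _ (sat_sigma2 _ e HC)) as [k Hk].
  { eapply eventually_mono; [|exact N]. simpl. intros x Hx. rewrite at_index_scons in Hx.
    destruct (ar_lnp (fun y => ~ sat M (scons y (at_index e x)) phi)) with (x := rep a x) as [y [Hy Hm]]; auto.
    - apply (closed_not (C := delta C) (fun e' => sat M (scons (e' 0%nat) (at_index e x)) phi)).
      apply (closed_sub (C := delta C) (fun e => sat M e phi) (fun e' => scons (e' 0%nat) (at_index e x))); auto. definable.
    - exists y. split; auto. intros z Lz. apply NNPP. exact (Hm z Lz). }
  assert (Nk : ~ sat ultrapower (scons k e) phi).
  { apply (LN (scons k e)). eapply eventually_mono; [|exact Hk]. simpl. intros x [Hx _]. now rewrite at_index_scons. }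
  destruct (m_zero_or_succ (k : ultrapower)) as [->|[b Hb]]; auto.
  apply Nk. rewrite Hb. apply HS. apply (los_delta0 phi D).
  eapply eventually_mono; [|exact (eventually_and _ _ Hk (eventually_and _ _ (proj1 (ult_eq _ _) Hb) (eventually_and _ _ (rep_mk _ (generic_fun_add _ _ (rep_generic_fun b) (rep_generic_fun (one ultrapower)))) (rep_mk _ (generic_fun_const 1)))))].
  simpl. intros x [[_ Hx] [E1 [E2 E3]]]. rewrite at_index_scons. apply (Hx (rep b x)). simpl. rewrite E1, E2, E3. apply m_lt_succ.
Qed.

Lemma ultrapower_collection phi : is_sigma (S n) phi -> collection_instance ultrapower phi.
Proof.
  intros HS e a H. assert (HC : sat_sigma phi) by now apply sigma_in_class with (S n).
  assert (HL : los phi) by now apply (proj1 (los_sigma_pi (S n) (le_n _) phi)).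
  destruct (comp _ (fun i => rep (e i)) HC (fun i => rep_generic_fun (e i))) as [j Hj].
  set (R := fun y v x => generic_set j x /\ sat M (scons y (scons v (fun i => rep (e i) x))) phi) in Hj.
  destruct (rep_generic_fun a) as [l Hl]. set (GA := fun w x => generic_set l x /\ w = rep a x) in Hl.
  set (B := fun v x => exists y, R y v x).
  assert (HB : rel2 C B) by (unfold rel2, B; definable).
  assert (HW : eventually_sigma (fun x => forall v, v < rep a x -> B v x)).
  { exists l. apply (class_ext C) with (fun e => exists w, GA w (e 0%nat) /\ forall v, v < w -> B v (e 0%nat)).
    - intro e'. split.
      + intros [Hx K1]. exists (rep a (e' 0%nat)). split; [split|]; auto.
      + intros [w [[Hx ->] K1]]. auto.
    - definable. }
  destruct (eventually_dec _ HW) as [[m Hm]|[m Hm]].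
  (* The value of [a] is reached through its graph [GA], since it is Sigma-definable only on a
     generic set. *)
  - set (T := fun b x => exists w, GA w x /\ forall v, v < w -> exists y, y < b /\ R y v x).
    assert (HT : rel2 C T) by (unfold rel2, T; definable).
    destruct (ultrapower_choice T) as [b Hb].
    { exists O. unfold rel2. definable. }
    { eapply eventually_mono; [|exact (eventually_and _ _ (eventually_generic_set l) (eventually_generic_set m))]. simpl. intros x [Hlx Hmx].
      destruct (collects_rel C (fun y v => R y v x) (collects_base C)) with (a := rep a x) as [b Hb].
      - unfold rel2. definable.
      - exact (Hm x Hmx).
      - exists b, (rep a x). split; auto. split; auto. }
    exists b. intros k Lk.
    destruct (ultrapower_choice (fun y x => y < rep b x /\ R y (rep k x) x)) as [y Hy].
    { destruct (rep_generic_fun b) as [j1 Hj1]. destruct (rep_generic_fun k) as [j2 Hj2].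
      set (GB := fun w x => generic_set j1 x /\ w = rep b x) in Hj1. set (GK := fun w x => generic_set j2 x /\ w = rep k x) in Hj2.
      exists (j1 + j2)%nat.
      apply (class_ext C) with (fun e => generic_set (j1 + j2) (e 1%nat) /\ exists w, GB w (e 1%nat) /\ exists v, GK v (e 1%nat) /\
         (e 0%nat < w /\ R (e 0%nat) v (e 1%nat))).
      - intro e'. split.
        + intros [Hx [L1 L2]]. split; auto. exists (rep b (e' 1%nat)). split.
          { split; auto. apply generic_set_le with (j1 + j2)%nat; auto; lia. }
          exists (rep k (e' 1%nat)). split; auto.
          { split; auto. apply generic_set_le with (j1 + j2)%nat; auto; lia. }
        + intros [Hx [w [[_ ->] [v [[_ ->] K1]]]]]. auto.
      - definable. }
    { eapply eventually_mono; [|exact (eventually_and _ _ Hb Lk)]. simpl. intros x [[w [[_ ->] K1]] Lx]. apply (K1 _ Lx). }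
    exists y. split.
    + eapply eventually_mono; [|exact Hy]. simpl. tauto.
    + apply HL. eapply eventually_mono; [|exact Hy]. simpl. intros x [_ [_ Hx]]. now rewrite !at_index_scons.
  (* The failing [v] solves a Pi condition, so [choice_graph] cannot select it; the bound [rep a x]
     allows uniformization to do so. *)
  - exfalso. destruct (C_unif B HB) as [X [HX HXB]]. red in HX.
    set (GX := fun y i w => y = X i w) in HX. change (rel3 C GX) in HX.
    destruct (ultrapower_choice (fun y x => GX y x (rep a x))) as [k Hk].
    { exists l. apply (class_ext C) with (fun e => exists w, GA w (e 1%nat) /\ GX (e 0%nat) (e 1%nat) w).
      - intro e'. split.
        + intros [Hx K1]. exists (rep a (e' 1%nat)). split; auto. split; auto.
        + intros [w [[Hx ->] K1]]. auto.
      - definable. }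
    { apply eventually_all. intro x. unfold GX. eauto. }
    assert (P1 : eventually (fun x => rep k x < rep a x /\ ~ B (rep k x) x)).
    { eapply eventually_mono; [|exact (eventually_and _ _ Hk (eventually_generic_set m))]. simpl. unfold GX. intros x [-> Hx]. apply HXB.
      specialize (Hm x Hx). apply not_all_ex_not in Hm. destruct Hm as [v Hv]. exists v. now apply imply_to_and. }
    destruct (H k) as [y Hy].
    { eapply eventually_mono; [|exact P1]. simpl. tauto. }
    apply HL in Hy. destruct (eventually_ex _ (eventually_and _ _ P1 (eventually_and _ _ Hy (eventually_generic_set j)))) as [x [[_ N] [Hx Hjx]]].
    apply N. exists (rep y x). split; auto. now rewrite !at_index_scons in Hx.
Qed.

Lemma ultrapower_BSigma : BSigma (S n) ultrapower.
Proof. split. apply ultrapower_IDelta0. apply ultrapower_collection. Qed.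
End Elementary.
End Generic.

Theorem theorem4p2 :
  forall (n : nat) (M : arith_str),
    countable M -> BSigma (n + 2) M ->
    exists (K : arith_str) (f : M -> K),
      end_extension M K f /\ proper_ext M K f /\
      sigma_elementary (n + 2) M K f /\ BSigma (n + 1) K.
Proof.
  intros n M [g Hg] HB. replace (n + 2)%nat with (S (S n)) in * by lia. replace (n + 1)%nat with (S n) by lia.
  assert (HM : PAminus M) by apply HB.
  (* An enumeration of [M] is obtained by inverting [g], with value zero off its range. *)
  destruct (choice (fun (i : nat) (x : M) => forall y, g y = i -> x = y)) as [p Hp].
  { intro i. destruct (classic (exists x, g x = i)) as [[x <-]|N].
    - exists x. intros y E1. apply Hg. auto.
    - exists (zero M). intros y E1. destruct N. eauto. }
  assert (p_surj : forall x, exists i, p i = x).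
  { intro x. exists (g x). now apply Hp. }
  assert (H0 : arena (sigma_rel (S n) : ((nat -> M) -> Prop) -> Prop) /\ universal (sigma_rel (S n) : ((nat -> M) -> Prop) -> Prop)).
  { split. now apply (sigma_arena p p_surj). now apply (sigma_universal p). }
  set (C := limit_class _ H0). assert (HA : arena C) by apply limit_class_arena.
  assert (Hu : uniformizes C C) by apply limit_unif.
  destruct (limit_countable p p_surj _ H0) as [en Hen].
  assert (Hcls : forall k, (k <= S n)%nat -> closed (sigma_rel k : ((nat -> M) -> Prop) -> Prop)).
  { apply (sigma_closed p p_surj n HB). }
  assert (HC : forall P, sigma_rel (S n) P -> C P) by apply base_limit.
  exists (ultrapower C en p), (emb C en p). split; [|split; [|split]].
  - now apply emb_end.
  - now apply emb_proper.
  - now apply (emb_elementary C en Hen p p_surj n Hcls HC).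
  - now apply (ultrapower_BSigma C Hu en Hen p p_surj n Hcls HC).
Qed.
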